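(* Let $p\ge2$ be a fixed integer and $\theta_0\in\mathcal S^{p-1}$. Let $(\eta_n)$ be either the constant sequence $\eta_n\equiv1$ or a sequence in $\mathbb R^+$ that is $o(1)$. Let $(\tau_n)$ be a sequence in $\mathbb R^p$ converging to some $\tau\neq\mathbf 0$ and such that $\theta_0+\nu_n\tau_n\in\mathcal S^{p-1}$ for any $n$, where $\nu_n=1/(\sqrt n\,\eta_n)$ if $\sqrt n\,\eta_n\to\infty$, and $\nu_n\equiv1$ if $\sqrt n\,\eta_n=O(1)$. Let $(F_n)$ be a sequence of cumulative distribution functions on $[-1,1]$ and assume that ${\rm P}^{(n)}_{\theta_0+\nu_n\tau_n,F_n}$ is in an $\eta_n$-neighbourhood of uniformity, with locality parameters $\xi$ and $\tilde e_2$ if $\eta_n\equiv1$ and with locality parameter $\xi$ otherwise, for some $\xi,\tilde e_2>0$. Let $$W_n:=\frac{n(p-1)\bar{\mathbf X}_n'(\mathbf I_p-\theta_0\theta_0')\bar{\mathbf X}_n}{1-\frac1n\sum_{i=1}^n(\mathbf X_{ni}'\theta_0)^2},\qquad S_n:=\frac{n(p-1)(\bar{\mathbf X}_n'\theta_0)^2\,\hat\theta_n'(\mathbf I_p-\theta_0\theta_0')\hat\theta_n}{1-\frac1n\sum_{i=1}^n(\mathbf X_{ni}'\theta_0)^2},$$ where $\bar{\mathbf X}_n:=\frac1n\sum_{i=1}^n\mathbf X_{ni}$ and $\hat\theta_n:=\bar{\mathbf X}_n/\|\bar{\mathbf X}_n\|$. Then, as $n\to\infty$ under ${\rm P}^{(n)}_{\theta_0+\nu_n\tau_n,F_n}$: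 (i) if $\eta_n\equiv1$, then $W_n$ and $S_n$ both converge in distribution to $$\chi^2_{p-1}\Big(\frac{1-1/p}{1-\xi^2/p-\tilde e_2}\,\xi^2\|\tau\|^2\Big),$$ and one actually then has $S_n=W_n+o_{\rm P}(1)$; (ii) if $\eta_n=o(1)$ with $\sqrt n\,\eta_n\to\infty$, then $W_n$ and $S_n$ both converge in distribution to $\chi^2_{p-1}(\xi^2\|\tau\|^2)$, and one then still has $S_n=W_n+o_{\rm P}(1)$; (iii) if $\sqrt n\,\eta_n\to1$, then $$W_n\stackrel{\mathcal D}{\to}\chi^2_{p-1}\Big(\tfrac14\xi^2\|\tau\|^2(4-\|\tau\|^2)\Big)\quad\text{and}\quad S_n\stackrel{\mathcal D}{\to}\Big(1+\frac{Q_{\xi,\tau}}{(Z+\xi-\xi\|\tau\|^2/2)^2}\Big)^{-1}Q_{\xi,\tau},$$ where $Z\sim\mathcal N(0,1)$ and $Q_{\xi,\tau}\sim\chi^2_{p-1}\big(\xi^2\|\tau\|^2\big)$ are independent; (iv) if $\sqrt n\,\eta_n\to0$, then $$W_n\stackrel{\mathcal D}{\to}\chi^2_{p-1}\quad\text{and}\quad S_n\stackrel{\mathcal D}{\to}\Big(1+\frac{Q}{Z^2}\Big)^{-1}Q,$$ where $Z\sim\mathcal N(0,1)$ and $Q\sim\chi^2_{p-1}$ are independent.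
   Context: $\mathcal S^{p-1}=\{\mathbf x\in\mathbb R^p:\|\mathbf x\|=1\}$; a prime denotes transpose; $\mathbf I_p$ is the $p\times p$ identity matrix; $\stackrel{\mathcal D}{\to}$ is weak convergence; $o_{\rm P}(1)$ denotes convergence to zero in probability; $\chi^2_\ell(\lambda)$ is the non-central chi-square distribution with $\ell$ degrees of freedom and non-centrality parameter $\lambda$ (the law of $\|\mathbf Y\|^2$ with $\mathbf Y\sim\mathcal N(\mu,\mathbf I_\ell)$, $\|\mu\|^2=\lambda$), and $\chi^2_\ell=\chi^2_\ell(0)$. Rotational symmetry: a random vector $\mathbf X$ with values in $\mathcal S^{p-1}$ is rotationally symmetric about $\theta\in\mathcal S^{p-1}$ if $\mathbf O\mathbf X$ is equal in distribution to $\mathbf X$ for every orthogonal $p\times p$ matrix $\mathbf O$ with $\mathbf O\theta=\theta$. Such a distribution is characterized by $\theta$ and the cumulative distribution function $F$ of $\mathbf X'\theta$, and is denoted $\mathcal R(\theta,F)$. For sequences $(\theta_n)$ in $\mathcal S^{p-1}$ and $(F_n)$ of cumulative distribution functions on $[-1,1]$, ${\rm P}^{(n)}_{\theta_n,F_n}$ denotes the hypothesis under which $\mathbf X_{n1},\ldots,\mathbf X_{nn}$ are i.i.d. with distribution $\mathcal R(\theta_n,F_n)$ (triangular array). Put $e_{n1}={\rm E}[\mathbf X_{n1}'\theta_n]$ and $\tilde e_{n2}={\rm Var}[\mathbf X_{n1}'\theta_n]$ under ${\rm P}^{(n)}_{\theta_n,F_n}$. For a sequence $\eta_n=o(1)$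 in $\mathbb R^+$ and $\xi>0$, ${\rm P}^{(n)}_{\theta_n,F_n}$ is in an $\eta_n$-neighbourhood of uniformity with locality parameter $\xi$ if and only if $e_{n1}=\eta_n\xi/\sqrt p+o(\eta_n)$ and $\tilde e_{n2}=1/p+o(1)$ as $n\to\infty$. For $\eta_n\equiv1$ and $\xi,\tilde e_2>0$, ${\rm P}^{(n)}_{\theta_n,F_n}$ is in a $1$-neighbourhood of uniformity (stays away from uniformity) with locality parameters $\xi$ and $\tilde e_2$ if and only if $e_{n1}=\xi/\sqrt p+o(1)$ and $\tilde e_{n2}=\tilde e_2+o(1)$ as $n\to\infty$.
   Formalization: In (iii) the chi-square variable Q in the limit of S_n has non-centrality ξ²‖τ‖²(4−‖τ‖²)/4, as for W_n, because the printed ξ²‖τ‖² is false; in (i) the condition ξ²/p+ẽ₂<1 is assumed so that the non-centrality parameter is defined. *)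

(* Defs.v *)
From HB Require Import structures.
From mathcomp Require Import all_boot all_order all_algebra.
From mathcomp Require Import all_classical all_reals all_analysis.
From mathcomp Require Import measurable_realfun.

Set Implicit Arguments.
Unset Strict Implicit.
Unset Printing Implicit Defensive.

Import Order.TTheory GRing.Theory Num.Theory.
Import numFieldNormedType.Exports.
Local Open Scope classical_set_scope.
Local Open Scope ring_scope.

Definition dotv (R : realType) (p : nat) (x y : 'cV[R]_p) : R :=
  (x^T *m y) 0 0.

(* Euclidean norm: the norm `|x| that the library puts on matrices is the
   max-norm. *)
Definition enorm (R : realType) (p : nat) (x : 'cV[R]_p) : R :=
  Num.sqrt (dotv x x).

Definition unit_sphere (R : realType) (p : nat) : set 'cV[R]_p :=
  [set x | enorm x = 1].

Definition orthogonal_mx (R : realType) (p : nat) (O : 'M[R]_p) : Prop :=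
  O^T *m O = 1%:M.

(* The Borel sigma-algebra of R^p, as the sigma-algebra generated by the
   coordinate maps (the library's construction for tuples). *)
Section measurable_colvec.
Variables (R : realType) (p : nat).

Let coors : 'I_p -> 'cV[R]_p -> R := fun i x => x i 0.

Let colvec_set0 : g_sigma_preimage coors set0.
Proof. exact: sigma_algebra0. Qed.

Let colvec_setC A : g_sigma_preimage coors A -> g_sigma_preimage coors (~` A).
Proof. exact: sigma_algebraC. Qed.

Let colvec_bigcup (F : (set 'cV[R]_p)^nat) :
  (forall i, g_sigma_preimage coors (F i)) ->
  g_sigma_preimage coors (\bigcup_i (F i)).
Proof. exact: sigma_algebra_bigcup. Qed.

HB.instance Definition _ :=
  @isMeasurable.Build (measure_tuple_display default_measure_display)
    'cV[R]_p (g_sigma_preimage coors) colvec_set0 colvec_setC colvec_bigcup.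

End measurable_colvec.

Section probability_notions.
Local Open Scope ereal_scope.

(* [X 0, ..., X n.-1] are mutually independent. *)
Definition mutually_independent (R : realType) (d d' : measure_display)
    (T : measurableType d) (T' : measurableType d') (P : probability T R)
    (n : nat) (X : nat -> {RV P >-> T'}) : Prop :=
  forall (J : {set 'I_n}) (B : 'I_n -> set T'),
    (forall i, measurable (B i)) ->
    P (\bigcap_(i in [set i | i \in J]) (X i @^-1` B i)) =
    \prod_(i in J) P (X i @^-1` B i).

(* Weak convergence of the law of [X n] under [P n] to the law of [Y] under
   [Q], tested on bounded continuous functions. *)
Definition cvg_in_distribution (R : realType) (d : nat -> measure_display)
    (T : forall n, measurableType (d n)) (P : forall n, probability (T n) R)
    (X : forall n, T n -> R) (d' : measure_display) (T' : measurableType d')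
    (Q : probability T' R) (Y : T' -> R) : Prop :=
  forall f : R -> R, continuous f ->
    (exists M : R, forall x, (`|f x| <= M)%R) ->
    'E_(P n)[f \o X n] @[n --> \oo] --> 'E_Q[f \o Y].

(* [X n = o_P(1)]. *)
Definition cvg_in_probability0 (R : realType) (d : nat -> measure_display)
    (T : forall n, measurableType (d n)) (P : forall n, probability (T n) R)
    (X : forall n, T n -> R) : Prop :=
  forall eps : R, (0 < eps)%R ->
    P n [set w | (eps <= `|X n w|)%R] @[n --> \oo] --> 0.

End probability_notions.

Section noncentral_chi2.
Variable R : realType.

(* [normal_prob] lives on [measurableTypeR R], a copy of R whose canonical
   sigma-algebra is the Borel one; so do the laws built from it. *)
Local Notation RB := (measurableTypeR R).

Section cons_tuple.
Variable l : nat.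

Definition cons_pair (z : RB * l.-tuple RB) : l.+1.-tuple RB :=
  [tuple of z.1 :: z.2].

Let measurable_cons_pair : measurable_fun [set: RB * l.-tuple RB] cons_pair.
Proof. exact: measurable_cons. Qed.

HB.instance Definition _ :=
  @isMeasurableFun.Build _ _ (RB * l.-tuple RB)%type (l.+1.-tuple RB)
    cons_pair measurable_cons_pair.

End cons_tuple.

(* N(0, I_l) *)
Fixpoint std_normal_vec (l : nat) : probability (l.-tuple RB) R :=
  match l with
  | 0 => \d_ [tuple]
  | l'.+1 => distribution (normal_prob (0 : R) 1 \x std_normal_vec l')%E
               (@cons_pair l')
  end.

Section shifted_sqnorm.
Variables (l : nat) (mu : 'I_l -> R).

Definition shifted_sqnorm (y : l.-tuple RB) : RB :=
  \sum_(i < l) (mu i + (tnth y i : R)) ^+ 2.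

Let measurable_shifted_sqnorm : measurable_fun [set: l.-tuple RB] shifted_sqnorm.
Proof.
apply: (@measurable_sum _ _ R) => i; apply: measurable_funX.
by apply: measurable_funD => //; exact: measurable_tnth.
Qed.

HB.instance Definition _ :=
  @isMeasurableFun.Build _ _ (l.-tuple RB) RB
    shifted_sqnorm measurable_shifted_sqnorm.

End shifted_sqnorm.

(* Law of ||Y||^2 for Y ~ N(mu, I_l) with ||mu||^2 = lam; this law depends on
   mu through ||mu|| only, and we take mu = (sqrt lam, 0, ..., 0). *)
Definition chi2_mean (l : nat) (lam : R) (i : 'I_l) : R :=
  if val i == 0%N then Num.sqrt lam else 0.

Definition chi2 (l : nat) (lam : R) : probability RB R :=
  distribution (std_normal_vec l) (shifted_sqnorm (@chi2_mean l lam)).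

End noncentral_chi2.

Section rotational_symmetry.
Variables (R : realType) (p : nat) (d : measure_display).
Variables (T : measurableType d) (P : probability T R).

Definition rotationally_symmetric (X : {RV P >-> 'cV[R]_p})
    (theta : 'cV[R]_p) : Prop :=
  (forall w, unit_sphere (X w)) /\
  forall O : 'M[R]_p, orthogonal_mx O -> O *m theta = theta ->
  forall B : set 'cV[R]_p, measurable B ->
    P [set w | B (O *m X w)] = P [set w | B (X w)].

(* X ~ R(theta, F) *)
Definition has_rotsym_law (X : {RV P >-> 'cV[R]_p}) (theta : 'cV[R]_p)
    (F : R -> R) : Prop :=
  rotationally_symmetric X theta /\
  forall x : R, P [set w | dotv (X w) theta <= x] = (F x)%:E.

(* X 0, ..., X n.-1 stand for X_{n1}, ..., X_{nn}; the later terms of X are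
   unconstrained. A common law follows from common theta and F. *)
Definition iid_rotsym (n : nat) (X : nat -> {RV P >-> 'cV[R]_p})
    (theta : 'cV[R]_p) (F : R -> R) : Prop :=
  mutually_independent n X /\
  forall i, (i < n)%N -> has_rotsym_law (X i) theta F.

Definition cos_mean (X : {RV P >-> 'cV[R]_p}) (theta : 'cV[R]_p) : R :=
  fine 'E_P[fun w => dotv (X w) theta]%E.

Definition cos_var (X : {RV P >-> 'cV[R]_p}) (theta : 'cV[R]_p) : R :=
  fine 'V_P[fun w => dotv (X w) theta]%E.

End rotational_symmetry.

(* A cumulative distribution function on [-1, 1]. *)
Definition cdf_on_m11 (R : realType) (F : cumulativeBounded (0 : R) (1 : R)) :=
  (forall x, x < -1 -> F x = 0) /\ (forall x, 1 <= x -> F x = 1).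

(* e1 and e2t are the sequences of means and variances of X_{n1}'theta_n;
   [near_uniformity] is for eta_n = o(1), [away_from_uniformity] for
   eta_n = 1. *)
Definition near_uniformity (R : realType) (p : nat) (eta : nat -> R) (xi : R)
    (e1 e2t : nat -> R) : Prop :=
  e1 = (fun n => eta n * xi / Num.sqrt p%:R) +o_\oo eta /\
  e2t n @[n --> \oo] --> (p%:R^-1 : R).

Definition away_from_uniformity (R : realType) (p : nat) (xi e2 : R)
    (e1 e2t : nat -> R) : Prop :=
  e1 n @[n --> \oo] --> xi / Num.sqrt p%:R /\ e2t n @[n --> \oo] --> e2.

Section statistics.
Variables (R : realType) (p : nat) (theta0 : 'cV[R]_p).
Variables (n : nat) (x : nat -> 'cV[R]_p).

Definition sample_mean : 'cV[R]_p := n%:R^-1 *: \sum_(i < n) x i.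

Definition spherical_mean : 'cV[R]_p := (enorm sample_mean)^-1 *: sample_mean.

Definition cos_second_moment : R := n%:R^-1 * \sum_(i < n) dotv (x i) theta0 ^+ 2.

Definition tangent_proj : 'M[R]_p := 1%:M - theta0 *m theta0^T.

Definition W_stat : R :=
  n%:R * (p%:R - 1) * dotv sample_mean (tangent_proj *m sample_mean)
  / (1 - cos_second_moment).

Definition S_stat : R :=
  n%:R * (p%:R - 1) * dotv sample_mean theta0 ^+ 2
  * dotv spherical_mean (tangent_proj *m spherical_mean)
  / (1 - cos_second_moment).

End statistics.

(* Main.v *)
(** The tangent statistics of a rotationally symmetric sample depend on the
    observations only through normalized sums in an orthonormal basis adapted to
    [theta0] and [t].  Reflections fixing [theta] determine the mean and covariance
    of these coordinates, which form a bounded triangular array, so that a central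
    limit theorem applies.  The latter is proved by Lindeberg replacement: after
    smoothing by an independent Gaussian vector of size [sg], replacing one summand by
    a Gaussian vector costs only third-order terms, because by Cameron-Martin the
    smoothed function expands to second order with a remainder controlled by the
    sup norm of the test function alone; then [sg] tends to 0.  Slutsky's lemma
    handles the denominator [1 - cos_second_moment], whose variance vanishes.  With
    [a] the normalized axial component and [Q] the squared tangential one, [W_stat]
    and [S_stat] are [Q] and [a^2 Q / (a^2 + Q)] up to the same factor: [a]
    diverges when [sqrt n eta -> oo], so the two statistics merge, and otherwise [a]
    has a normal limit independent of [Q]. *)

Require Import Defs.
From HB Require Import structures.
From mathcomp Require Import all_boot all_order all_algebra.
From mathcomp Require Import all_classical all_reals all_analysis.
From mathcomp Require Import measurable_realfun.
From mathcomp Require Import ring lra.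

Set Implicit Arguments.
Unset Strict Implicit.
Unset Printing Implicit Defensive.

Import Order.TTheory GRing.Theory Num.Theory.
Import numFieldNormedType.Exports.
Local Open Scope classical_set_scope.
Local Open Scope ring_scope.

(** * Gaussian measures *)

(** The test functions are merely Lipschitz in the squared coordinates, hence an expansion whose
    constants see the sup norm alone. The summands are bounded and scaled by the inverse root of
    [n], so the third-order terms add up to that same order and no truncation is called for. Two
    instances of the limit theorem are used. When [sqrt n * eta] diverges, the axial and tangential
    second moments may have different limits and the axial mean is unbounded: only the [p - 1]
    tangential coordinates enter the central limit theorem, and the axial one is controlled by its
    variance. When [sqrt n * eta] converges, both second moments tend to [1 / p] and the whole
    vector of [p] coordinates converges, which yields the independence of [Z] and [Q]. In that case
    [theta] does not tend to [theta0], and the unit norm of [theta] forces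
    [theta0' tau = - |tau|^2 / 2] in the limit: this is the source of the shift of [Z] and of the
    factor [4 - |tau|^2]. *)

Section density.
Context (R : realType).
Local Open Scope ereal_scope.
Notation mu := (@lebesgue_measure R).
Local Notation RB := (measurableTypeR R).

(** The Radon-Nikodym derivative and [normal_pdf] have the same integral over every measurable set,
    hence agree almost everywhere. *)
Lemma ge0_integral_normal_prob (m s : R) (f : RB -> \bar R) :
  measurable_fun setT f -> (forall x, 0 <= f x) ->
  \int[normal_prob m s]_x f x = \int[mu]_x (f x * (normal_pdf m s x)%:E).
Proof.
move=> mf f0.
have dom := @normal_prob_dominates R m s.
rewrite -(Radon_Nikodym_SigmaFinite.change_of_variables dom f0 measurableT)//.
apply: ae_eq_integral => //.
- apply: emeasurable_funM => //.
  exact: (measurable_int mu (Radon_Nikodym_SigmaFinite.f_integrable dom)).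
- by apply: emeasurable_funM => //; apply/measurable_EFinP; exact: measurable_normal_pdf.
apply: ae_eqe_mul2l.
apply: integral_ae_eq => //.
- exact: Radon_Nikodym_SigmaFinite.f_integrable.
- by apply/measurable_EFinP; exact: measurable_normal_pdf.
- move=> E _ mE.
  by rewrite -Radon_Nikodym_SigmaFinite.f_integral.
Qed.

End density.

Section affine.
Context (R : realType).
Notation mu := (@lebesgue_measure R).
Local Notation RB := (measurableTypeR R).

(** By uniqueness of Lebesgue measure: the pushforward, rescaled by [a], gives each interval []x,
    y]] its length. *)
Lemma lebesgue_measure_affine (a b : R) (A : set RB) : 0 < a ->
  measurable A ->
  (a%:E * mu ((fun x : RB => (a * x + b)%R : RB) @^-1` A))%E = mu A.
Proof.
move=> a0 mA; set phi := fun x : RB => a * x + b : RB.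
have mphi : measurable_fun setT phi.
  by apply: measurable_funD => //; exact: measurable_funM.
pose m' := mscale (NngNum (ltW a0))
  (measure_function_pushforward__canonical__measure_function_Measure mu mphi).
transitivity (m' A); first by [].
apply/esym/lebesgue_measure_unique => // _ [[x y]] _ <-.
transitivity (a%:E * mu (phi @^-1` `]x, y]%classic))%E; last by [].
have -> : phi @^-1` `]x, y]%classic = `](x - b) / a, (y - b) / a]%classic.
  apply/seteqP; split => z /=; rewrite /phi !in_itv/= ltr_pdivrMr// ler_pdivlMr//
    ltrBlDr lerBrDr mulrC//.
rewrite !lebesgue_measure_itv/= !lte_fin ltr_pM2r ?invr_gt0// ltrD2r.
case: ifPn => _; last by rewrite mule0.
by rewrite -!EFinB -EFinM -mulrBl opprB addrA subrK mulrC divfK// gt_eqF.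
Qed.

Lemma ge0_integral_affine (a b : R) (f : RB -> \bar R) : 0 < a ->
  measurable_fun setT f -> (forall x, (0 <= f x)%E) ->
  (\int[mu]_x f x = a%:E * \int[mu]_x f (a * x + b)%R)%E.
Proof.
move=> a0 mf f0.
have mphi : measurable_fun setT (fun x : RB => a * x + b : RB).
  by apply: measurable_funD => //; exact: measurable_funM.
pose m' := mscale (NngNum (ltW a0))
  (measure_function_pushforward__canonical__measure_function_Measure mu mphi).
transitivity (\int[m']_x f x)%E.
  by apply: eq_measure_integral => A mA _; exact/esym/(lebesgue_measure_affine b a0).
rewrite ge0_integral_mscale//=; congr (_ * _)%E.
by rewrite ge0_integral_pushforward.
Qed.

End affine.

Section gauss1.
Context (R : realType).
Notation mu := (@lebesgue_measure R).
Local Notation RB := (measurableTypeR R).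
Local Notation N01 := (normal_prob (0 : R) 1).
Local Notation g := (normal_pdf (0 : R) 1).

Lemma normal_pdf01E x : g x = normal_peak 1 * expR (- x ^+ 2 / 2).
Proof.
rewrite normal_pdfE ?oner_neq0// /normal_fun subr0 expr1n.
by [].
Qed.

Lemma ge0_integral_normal01 (f : RB -> \bar R) :
  measurable_fun setT f -> (forall x, (0 <= f x)%E) ->
  (\int[N01]_x f x = \int[mu]_x (f x * (g x)%:E))%E.
Proof. exact: ge0_integral_normal_prob. Qed.

(** Translation of the Lebesgue integral by [u], then completion of the square in the exponent. *)
Lemma cameron_martin1 (u : R) (f : RB -> \bar R) :
  measurable_fun setT f -> (forall x, (0 <= f x)%E) ->
  (\int[N01]_x f (x + u)%R =
   \int[N01]_x (f x * (expR (u * x - u ^+ 2 / 2))%:E))%E.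
Proof.
move=> mf f0.
have mD : measurable_fun [set: RB] (fun x : RB => x + u : RB).
  exact: measurable_funD.
have mg : measurable_fun [set: RB] (fun x : RB => (g x)%:E).
  by apply/measurable_EFinP; exact: measurable_normal_pdf.
have me : measurable_fun [set: RB] (fun x : RB => (expR (u * x - u ^+ 2 / 2))%:E).
  apply/measurable_EFinP; apply: measurableT_comp => //.
  by apply: measurable_funB => //; exact: measurable_funM.
rewrite ge0_integral_normal01//; last exact: (measurableT_comp mf mD).
rewrite ge0_integral_normal01//; last 2 first.
- exact: emeasurable_funM.
- by move=> x; rewrite mule_ge0// lee_fin expR_ge0.
rewrite [RHS](@ge0_integral_affine R 1 u)//; last 2 first.
- by apply: emeasurable_funM => //; exact: emeasurable_funM.
- by move=> x; rewrite !mule_ge0// lee_fin ?expR_ge0// normal_pdf_ge0.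
rewrite mul1e; apply: eq_integral => x _; rewrite mul1r -muleA; congr (_ * _)%E.
rewrite -EFinM; congr (_%:E); rewrite !normal_pdf01E mulrCA -expRD.
congr (_ * expR _); by field.
Qed.

(** For fixed [y], replacing [x] by [(c x - b y) / a] turns the argument of [f] into [c x]. The
    weights then regroup as the density at [x] times a rescaled density in [y] of total mass 1. *)
Lemma gauss_semigroup1 (a b c : R) (f : RB -> \bar R) :
  0 < a -> 0 < b -> 0 < c -> c ^+ 2 = a ^+ 2 + b ^+ 2 ->
  measurable_fun setT f -> (forall x, (0 <= f x)%E) ->
  (\int[N01]_y \int[N01]_x f (a * x + b * y)%R = \int[N01]_x f (c * x)%R)%E.
Proof.
move=> a0 b0 c0 cab mf f0.
have mg : measurable_fun [set: RB] g by exact: measurable_normal_pdf.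
have mE : measurable_fun [set: RB * RB] (fun z : RB * RB => f (a * z.2 + b * z.1)).
  apply: (measurableT_comp mf).
  by apply: measurable_funD => //; exact: measurable_funM.
have ma y : measurable_fun [set: RB] (fun x : RB => a * x + b * y : RB).
  by apply: measurable_funD => //; exact: measurable_funM.
have mc : measurable_fun [set: RB] (fun x : RB => c * x : RB).
  exact: measurable_funM.
rewrite [LHS]ge0_integral_normal01; last 2 first.
- exact: (@measurable_fun_fubini_tonelli_F _ _ RB RB R N01 (fun z => f (a * z.2 + b * z.1))).
- by move=> x; exact: integral_ge0.
transitivity (\int[mu]_y \int[mu]_x
   (f (c * x)%R * (g x)%:E * (c / a * g (c / a * y + - (b / a * x)))%:E))%E.
  apply: eq_integral => y _.
  rewrite ge0_integral_normal01//; last exact: (measurableT_comp mf (ma y)).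
  rewrite (@ge0_integral_affine R (c / a) (- (b / a * y))) ?divr_gt0//; last 2 first.
  - apply: emeasurable_funM; first exact: (measurableT_comp mf (ma y)).
    exact/measurable_EFinP.
  - by move=> x; rewrite mule_ge0// lee_fin normal_pdf_ge0.
  have ca0 : 0 < c / a by rewrite divr_gt0.
  rewrite muleC muleA -ge0_integralZl//; last 3 first.
  - apply: emeasurable_funM; last first.
      apply/measurable_EFinP; apply: measurableT_comp => //.
      by apply: measurable_funD => //; exact: measurable_funM.
    apply: (measurableT_comp mf).
    apply: measurable_funD => //; apply: measurable_funM => //.
    by apply: measurable_funD => //; exact: measurable_funM.
  - by move=> x _; rewrite mule_ge0// lee_fin normal_pdf_ge0.
  - by rewrite -EFinM lee_fin mulr_ge0// ?normal_pdf_ge0// ltW.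
  apply: eq_integral => x _.
  have -> : a * (c / a * x - b / a * y) + b * y = c * x.
    by field; rewrite gt_eqF.
  rewrite muleC -!muleA; congr (_ * _)%E; rewrite -!EFinM; congr (_%:E).
  (* Both exponents are [- (c^2 x^2 - 2 b c x y + c^2 y^2) / (2 a^2)], symmetric in [x] and [y],
     because [c^2 = a^2 + b^2]. *)
  have E : g (c / a * x - b / a * y) * g y = g x * g (c / a * y - b / a * x).
    rewrite !normal_pdf01E mulrACA [RHS]mulrACA -!expRD; congr (_ * expR _).
    have -> : c / a * x - b / a * y = (c * x - b * y) / a by field; rewrite gt_eqF.
    have -> : c / a * y - b / a * x = (c * y - b * x) / a by field; rewrite gt_eqF.
    apply/eqP; rewrite -subr_eq0; apply/eqP.
    transitivity ((a ^+ 2 + b ^+ 2 - c ^+ 2) * (x ^+ 2 - y ^+ 2) / (2 * a ^+ 2)).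
      by field; rewrite gt_eqF.
    by rewrite cab subrr !mul0r.
  by rewrite mulrA E mulrCA; ring.
have mgg : measurable_fun [set: RB * RB]
    (fun z : RB * RB => c / a * g (c / a * z.1 + - (b / a * z.2))).
  apply: measurable_funM => //; apply: measurableT_comp => //.
  by apply: measurable_funB => //; exact: measurable_funM.
have mgx x : measurable_fun [set: RB]
    (fun y : RB => c / a * g (c / a * y + - (b / a * x))).
  apply: measurable_funM => //; apply: measurableT_comp => //.
  by apply: measurable_funB => //; exact: measurable_funM.
have me : measurable_fun [set: RB * RB] (fun z : RB * RB =>
    f (c * z.2)%R * (g z.2)%:E * (c / a * g (c / a * z.1 + - (b / a * z.2)))%:E)%E.
  apply: emeasurable_funM; last exact/measurable_EFinP.
  apply: emeasurable_funM; last first.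
    by apply/measurable_EFinP; exact: (measurableT_comp mg).
  by apply: (measurableT_comp mf); exact: measurable_funM.
rewrite (@fubini_tonelli _ _ RB RB R mu mu (fun z => f (c * z.2)%R * (g z.2)%:E * (c / a * g (c / a * z.1 + - (b / a * z.2)))%:E)%E) //; last first.
  move=> z; rewrite !mule_ge0 ?lee_fin ?mulr_ge0 ?normal_pdf_ge0// ?invr_ge0 ltW//.
rewrite [RHS]ge0_integral_normal01//; last exact: (measurableT_comp mf mc).
apply: eq_integral => x _.
rewrite /= ge0_integralZl//; last 3 first.
- by apply/measurable_EFinP; exact: mgx.
- by move=> y _; rewrite lee_fin !mulr_ge0 ?normal_pdf_ge0 ?invr_ge0// ltW.
- by rewrite mule_ge0// lee_fin normal_pdf_ge0.
under eq_integral do rewrite EFinM.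
have mgx' : measurable_fun [set: RB] (fun y : RB => g (c / a * y + - (b / a * x))).
  apply: measurableT_comp => //.
  by apply: measurable_funB => //; exact: measurable_funM.
rewrite ge0_integralZl//; last 3 first.
- by apply/measurable_EFinP; exact: mgx'.
- by move=> y _; rewrite lee_fin normal_pdf_ge0.
- by rewrite lee_fin ltW// divr_gt0.
rewrite -(@ge0_integral_affine R (c / a) (- (b / a * x)) (fun y => (g y)%:E)) ?divr_gt0//.
- by rewrite integral_normal_pdf mule1.
- exact/measurable_EFinP.
- by move=> y; rewrite lee_fin normal_pdf_ge0.
Qed.

End gauss1.

Section lcomb.
Context (R : realType).
Local Notation RB := (measurableTypeR R).

(** All vector arithmetic on tuples goes through this operation; the scalar multiple [a x] is
    written [lcomb a 0 x x]. *)
Definition lcomb (m : nat) (a b : R) (x y : m.-tuple RB) : m.-tuple RB :=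
  [tuple a * (tnth x i : R) + b * (tnth y i : R) | i < m].

Lemma tnth_lcomb m a b (x y : m.-tuple RB) i :
  tnth (lcomb a b x y) i = a * (tnth x i : R) + b * (tnth y i : R).
Proof. by rewrite tnth_mktuple. Qed.

Lemma measurable_lcomb d (T : measurableType d) m a b (f g : T -> m.-tuple RB) :
  measurable_fun setT f -> measurable_fun setT g ->
  measurable_fun setT (fun w => lcomb a b (f w) (g w)).
Proof.
move=> mf mg; apply/measurable_fun_tnthP => i.
rewrite (_ : _ \o _ = fun w => a * (tnth (f w) i : R) + b * (tnth (g w) i : R)); last first.
  by apply/funext => w /=; rewrite tnth_lcomb.
have mi : measurable_fun [set: m.-tuple RB] (fun z => tnth z i).
  exact: measurable_tnth.
apply: measurable_funD; apply: measurable_funM => //.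
  exact: (measurableT_comp mi mf).
exact: (measurableT_comp mi mg).
Qed.

Lemma cons_pair_lcomb m a b (x y : RB) (x' y' : m.-tuple RB) :
  lcomb a b (cons_pair (x, x')) (cons_pair (y, y')) =
  cons_pair (a * x + b * y : R, lcomb a b x' y').
Proof.
apply: eq_from_tnth => i; rewrite tnth_lcomb.
case: (unliftP ord0 i) => [j|] ->; first by rewrite !tnthS tnth_lcomb.
by rewrite !tnth0.
Qed.

Lemma cons_pair_eta m (u : m.+1.-tuple RB) :
  exists u0 u', u = cons_pair (u0, u').
Proof. by exists (thead u), [tuple of behead u]; rewrite {1}(tuple_eta u). Qed.

End lcomb.

Section gauss_vec.
Context (R : realType).
Local Notation RB := (measurableTypeR R).
Local Notation N01 := (normal_prob (0 : R) 1).
Local Notation N := (@std_normal_vec R).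
Local Open Scope ereal_scope.

Lemma measurable_cons_pairT m : measurable_fun [set: RB * m.-tuple RB] (@cons_pair R m).
Proof. exact: measurable_funPT. Qed.

Lemma measurable_cons_pair2 m (f : m.+1.-tuple RB -> \bar R) (x : RB) :
  measurable_fun setT f -> measurable_fun setT (fun y => f (cons_pair (x, y))).
Proof.
move=> mf; apply: (measurableT_comp mf).
apply: (measurableT_comp (@measurable_cons_pairT m)).
exact: measurable_fun_pair.
Qed.

Lemma ge0_integral_cons m (f : m.+1.-tuple RB -> \bar R) :
  measurable_fun setT f -> (forall x, 0 <= f x) ->
  \int[N m.+1]_z f z = \int[N01]_x \int[N m]_y f (cons_pair (x, y)).
Proof.
move=> mf f0; rewrite ge0_integral_distribution//=.
rewrite fubini_tonelli1//.
exact: (measurableT_comp mf (@measurable_cons_pairT m)).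
Qed.

(* Density of N(u, I_m) with respect to N(0, I_m). *)
Definition tilt m (u y : m.-tuple RB) : R :=
  expR (\sum_(i < m) ((tnth u i : R) * (tnth y i : R) - (tnth u i : R) ^+ 2 / 2)).

Lemma measurable_tilt m (u : m.-tuple RB) : measurable_fun setT (tilt u).
Proof.
apply: measurableT_comp => //.
apply: (@measurable_sum _ _ R) => i; apply: measurable_funB => //.
by apply: measurable_funM => //; exact: measurable_tnth.
Qed.

Lemma tilt_cons m (u0 x : RB) (u y : m.-tuple RB) :
  tilt (cons_pair (u0, u)) (cons_pair (x, y)) =
  (expR (u0 * x - u0 ^+ 2 / 2) * tilt u y)%R.
Proof.
rewrite /tilt big_ord_recl !tnth0 -expRD; congr (expR (_ + _)).
by apply: eq_bigr => i _; rewrite !tnthS.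
Qed.

Lemma cameron_martin m (u : m.-tuple RB) (f : m.-tuple RB -> \bar R) :
  measurable_fun setT f -> (forall x, 0 <= f x) ->
  \int[N m]_y f (lcomb 1 1 y u) = \int[N m]_y (f y * (tilt u y)%:E).
Proof.
elim: m u f => [|m IH] u f mf f0.
  apply: eq_integral => y _; rewrite /tilt big_ord0 expR0 mule1.
  by rewrite (tuple0 y) (tuple0 (lcomb _ _ _ _)).
have [u0 [u' ->]] := cons_pair_eta u.
have mfu : measurable_fun setT
    (fun y : m.+1.-tuple RB => f (lcomb 1 1 y (cons_pair (u0, u')))).
  by apply: (measurableT_comp mf); exact: measurable_lcomb.
have mft : measurable_fun setT
    (fun y : m.+1.-tuple RB => f y * (tilt (cons_pair (u0, u')) y)%:E).
  by apply: emeasurable_funM => //; apply/measurable_EFinP; exact: measurable_tilt.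
have ft0 y : 0 <= f y * (tilt (cons_pair (u0, u')) y)%:E.
  by rewrite mule_ge0// lee_fin expR_ge0.
rewrite [LHS](ge0_integral_cons mfu (fun _ => f0 _)).
rewrite [RHS](ge0_integral_cons mft ft0).
pose g x := \int[N m]_y (f (cons_pair (x, y)) * (tilt u' y)%:E).
have mg : measurable_fun [set: RB] g.
  apply: (@measurable_fun_fubini_tonelli_F _ _ RB (m.-tuple RB) R (N m)
     (fun z => f (cons_pair z) * (tilt u' z.2)%:E)).
  - apply: emeasurable_funM; first exact: (measurableT_comp mf (@measurable_cons_pairT m)).
    by apply/measurable_EFinP; exact: (measurableT_comp (measurable_tilt u')).
  - by move=> y; rewrite mule_ge0// lee_fin expR_ge0.
have g0 x : 0 <= g x.
  by apply: integral_ge0 => y _; rewrite mule_ge0// lee_fin expR_ge0.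
transitivity (\int[N01]_x g (x + u0)%R).
  apply: eq_integral => x _.
  under eq_integral do rewrite cons_pair_lcomb !mul1r.
  by rewrite (IH u' (fun y => f (cons_pair ((x + u0)%R, y))))//; exact: measurable_cons_pair2.
apply: (etrans (cameron_martin1 u0 mg g0)); apply: eq_integral => x _.
rewrite -ge0_integralZr; last 4 first.
- exact: measurableT.
- apply: emeasurable_funM; first exact: measurable_cons_pair2.
  by apply/measurable_EFinP; exact: measurable_tilt.
- by move=> y _; rewrite mule_ge0// lee_fin expR_ge0.
- by rewrite lee_fin expR_ge0.
apply: eq_integral => y _.
by rewrite tilt_cons -muleA -EFinM; congr (_ * _%:E); exact: mulrC.
Qed.

Lemma gauss_semigroup m (a b c : R) (f : m.-tuple RB -> \bar R) :
  (0 < a)%R -> (0 < b)%R -> (0 < c)%R -> (c ^+ 2 = a ^+ 2 + b ^+ 2)%R ->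
  measurable_fun setT f -> (forall x, 0 <= f x) ->
  \int[N m]_y \int[N m]_x f (lcomb a b x y) = \int[N m]_x f (lcomb c 0 x x).
Proof.
move=> a0 b0 c0 cab; elim: m f => [|m IH] f mf f0.
  transitivity (\int[N 0]_y f [tuple]).
    apply: eq_integral => y _; transitivity (\int[N 0]_x f [tuple]).
      by apply: eq_integral => x _; rewrite (tuple0 (lcomb _ _ _ _)).
    by rewrite (integral_cst (N 0) measurableT) [X in _ * X](@probability_setT _ _ _ (N 0)) mule1.
  by apply: eq_integral => x _; rewrite (tuple0 (lcomb _ _ _ _)).
have m2 : measurable_fun setT (fun z : m.+1.-tuple RB * m.+1.-tuple RB => f (lcomb a b z.2 z.1)).
  by apply: (measurableT_comp mf); exact: measurable_lcomb.
have mfa y : measurable_fun setT (fun x : m.+1.-tuple RB => f (lcomb a b x y)).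
  by apply: (measurableT_comp mf); exact: measurable_lcomb.
have mfc : measurable_fun setT (fun x : m.+1.-tuple RB => f (lcomb c 0 x x)).
  by apply: (measurableT_comp mf); exact: measurable_lcomb.
have mF : measurable_fun setT (fun y : m.+1.-tuple RB => \int[N m.+1]_x f (lcomb a b x y)).
  apply: (@measurable_fun_fubini_tonelli_F _ _ (m.+1.-tuple RB) (m.+1.-tuple RB) R (N m.+1)
     (fun z => f (lcomb a b z.2 z.1))) => //.
rewrite [LHS](ge0_integral_cons mF (fun _ => integral_ge0 _ (fun _ _ => f0 _))).
rewrite [RHS](ge0_integral_cons mfc (fun _ => f0 _)).
pose g (x : RB) := \int[N m]_x' f (cons_pair (x, lcomb c 0 x' x')).
have mpc : measurable_fun [set: RB * m.-tuple RB]
    (fun z => f (cons_pair (z.1, lcomb c 0 z.2 z.2))).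
  apply: (measurableT_comp mf); apply: (measurableT_comp (@measurable_cons_pairT m)).
  by apply: measurable_fun_pair => //; exact: measurable_lcomb.
have mg : measurable_fun [set: RB] g.
  exact: (@measurable_fun_fubini_tonelli_F _ _ RB (m.-tuple RB) R (N m)
     (fun z => f (cons_pair (z.1, lcomb c 0 z.2 z.2)))).
have g0 x : 0 <= g x by apply: integral_ge0.
transitivity (\int[N01]_y \int[N01]_x g (a * x + b * y)%R); last first.
  rewrite (gauss_semigroup1 a0 b0 c0 cab mg g0).
  apply: eq_integral => x _; apply: eq_integral => x' _.
  by rewrite cons_pair_lcomb mul0r addr0.
apply: eq_integral => y _.
transitivity (\int[N m]_y' \int[N01]_x \int[N m]_x'
    f (cons_pair (a * x + b * y, lcomb a b x' y'))%R).
  apply: eq_integral => y' _.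
  rewrite (ge0_integral_cons (mfa _) (fun _ => f0 _)).
  apply: eq_integral => x _; apply: eq_integral => x' _.
  by rewrite cons_pair_lcomb.
have m3 : measurable_fun setT (fun z : (m.-tuple RB * RB) * m.-tuple RB =>
    f (cons_pair (a * z.1.2 + b * y : R, lcomb a b z.2 z.1.1))%R).
  apply: (measurableT_comp mf); apply: (measurableT_comp (@measurable_cons_pairT m)).
  apply: measurable_fun_pair.
    apply: measurable_funD => //; apply: measurable_funM => //.
    exact: (measurableT_comp measurable_snd measurable_fst).
  apply: measurable_lcomb => //.
  exact: (measurableT_comp measurable_fst measurable_fst).
(* The integral over [y'] must pass inside the one over [x] before the induction hypothesis applies
   to the pair [x'], [y']. *)
rewrite (@fubini_tonelli _ _ (m.-tuple RB) RB R (N m) N01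
  (fun z => \int[N m]_x' f (cons_pair (a * z.2 + b * y, lcomb a b x' z.1))%R)); last 2 first.
- exact: (@measurable_fun_fubini_tonelli_F _ _ (m.-tuple RB * RB)%type (m.-tuple RB) R (N m)
     (fun z => f (cons_pair (a * z.1.2 + b * y : R, lcomb a b z.2 z.1.1))%R)).
- by move=> z; exact: integral_ge0.
apply: eq_integral => x _.
rewrite (IH (fun y' => f (cons_pair (a * x + b * y : R, y'))%R)) => //.
exact: measurable_cons_pair2.
Qed.

End gauss_vec.

(** * Moments *)

Section moments.
Context d (T : measurableType d) (R : realType) (P : probability T R).
Implicit Types f g : T -> R.

(* Finiteness of all absolute moments is stable under sums and products, unlike
   integrability. *)
Definition momfin f :=
  measurable_fun setT f /\
  forall k, P.-integrable setT (EFin \o (fun x => `|f x| ^+ k)).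

Lemma momfin_measurable f : momfin f -> measurable_fun setT f.
Proof. by case. Qed.

Lemma momfin_integrable f : momfin f -> P.-integrable setT (EFin \o f).
Proof.
move=> [mf /(_ 1%N)]; apply: le_integrable => //; first exact/measurable_EFinP.
by move=> x _ /=; rewrite lee_fin expr1 normr_id.
Qed.

Lemma momfin_le f (g : nat -> T -> R) : measurable_fun setT f ->
  (forall k, P.-integrable setT (EFin \o g k)) ->
  (forall k x, `|f x| ^+ k <= g k x) -> momfin f.
Proof.
move=> mf ig fg; split=> // k; apply: le_integrable (ig k) => //.
  apply/measurable_EFinP; apply: measurable_funX; exact: measurableT_comp.
by move=> x _ /=; rewrite lee_fin ger0_norm ?exprn_ge0// (le_trans (fg k x))// ler_norm.
Qed.

Lemma momfin_dom f g : measurable_fun setT f -> momfin g ->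
  (forall x, `|f x| <= `|g x|) -> momfin f.
Proof.
move=> mf [mg ig] fg; apply: (momfin_le mf ig) => k x.
by rewrite lerXn2r ?nnegrE.
Qed.

Lemma momfin_cst (c : R) : momfin (fun=> c).
Proof.
split; first exact: measurable_cst.
move=> k; exact: finite_measure_integrable_cst.
Qed.

Lemma momfin_bounded f M : measurable_fun setT f -> (forall x, `|f x| <= M) -> momfin f.
Proof.
move=> mf fM; apply: (momfin_dom mf (momfin_cst M)) => x.
by rewrite (le_trans (fM x))// ler_norm.
Qed.

Lemma momfinD f g : momfin f -> momfin g -> momfin (fun x => f x + g x).
Proof.
move=> [mf hf] [mg hg].
apply: (momfin_le (g := fun k x => 2 ^+ k * (`|f x| ^+ k + `|g x| ^+ k))).
- exact: measurable_funD.
- move=> k.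
  rewrite (_ : EFin \o _ = fun x => ((2 ^+ k)%:E *
    ((EFin \o (fun x => `|f x| ^+ k)%R) \+ (EFin \o (fun x => `|g x| ^+ k)%R)) x)%E).
    by apply: (integrableZl measurableT); exact: integrableD.
  by apply/funext => x /=; rewrite -EFinD -EFinM.
- move=> k x; have [fg|gf] := lerP `|f x| `|g x|.
    apply: (@le_trans _ _ ((2 * `|g x|) ^+ k)).
      rewrite lerXn2r ?nnegrE ?mulr_ge0//.
      by rewrite (le_trans (ler_normD _ _))// mulr_natl mulr2n lerD2r.
    by rewrite exprMn ler_pM2l ?exprn_gt0// lerDr exprn_ge0.
  apply: (@le_trans _ _ ((2 * `|f x|) ^+ k)).
    rewrite lerXn2r ?nnegrE ?mulr_ge0//.
    by rewrite (le_trans (ler_normD _ _))// mulr_natl mulr2n lerD2l ltW.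
  by rewrite exprMn ler_pM2l ?exprn_gt0// lerDl exprn_ge0.
Qed.

Lemma momfinM f g : momfin f -> momfin g -> momfin (fun x => f x * g x).
Proof.
move=> [mf hf] [mg hg].
apply: (momfin_le (g := fun k x => `|f x| ^+ k.*2 + `|g x| ^+ k.*2)).
- exact: measurable_funM.
- move=> k.
  rewrite (_ : EFin \o _ =
    (EFin \o (fun x => `|f x| ^+ k.*2)%R) \+ (EFin \o (fun x => `|g x| ^+ k.*2)%R))%E.
    exact: integrableD.
  by apply/funext => x /=; rewrite -EFinD.
- move=> k x; rewrite normrM exprMn -!muln2 !exprM.
  set a := _ ^+ k; set b := _ ^+ k.
  have a0 : 0 <= a by rewrite exprn_ge0.
  have b0 : 0 <= b by rewrite exprn_ge0.
  nra.
Qed.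

Lemma momfinZ (c : R) f : momfin f -> momfin (fun x => c * f x).
Proof. by move=> hf; apply: momfinM => //; exact: momfin_cst. Qed.

Lemma momfinN f : momfin f -> momfin (fun x => - f x).
Proof.
move=> [mf hf]; apply: (@momfin_dom _ f) => //; first exact: measurable_funN.
by move=> x; rewrite normrN.
Qed.

Lemma momfinB f g : momfin f -> momfin g -> momfin (fun x => f x - g x).
Proof. by move=> hf hg; apply: momfinD => //; exact: momfinN. Qed.

Lemma momfin_norm f : momfin f -> momfin (fun x => `|f x|).
Proof.
move=> [mf hf]; apply: (@momfin_dom _ f) => //; first exact: measurableT_comp.
by move=> x; rewrite normr_id.
Qed.

Lemma momfinX f k : momfin f -> momfin (fun x => f x ^+ k).
Proof.
move=> hf; elim: k => [|k IH].
  by under eq_fun do rewrite expr0; exact: momfin_cst.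
by under eq_fun do rewrite exprS; exact: momfinM.
Qed.

Lemma momfin_sum (I : Type) (s : seq I) (Q : pred I) (f : I -> T -> R) :
  (forall i, momfin (f i)) -> momfin (fun x => \sum_(i <- s | Q i) f i x).
Proof.
move=> hf; elim: s => [|i s IH].
  by under eq_fun do rewrite big_nil; exact: momfin_cst.
under eq_fun do rewrite big_cons.
by case: (Q i) => //; exact: momfinD.
Qed.

Lemma ExD f g : momfin f -> momfin g ->
  \int[P]_x (f x + g x) = \int[P]_x f x + \int[P]_x g x.
Proof. by move=> /momfin_integrable hf /momfin_integrable hg; exact: RintegralD. Qed.

Lemma ExB f g : momfin f -> momfin g ->
  \int[P]_x (f x - g x) = \int[P]_x f x - \int[P]_x g x.
Proof. by move=> /momfin_integrable hf /momfin_integrable hg; exact: RintegralB. Qed.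

Lemma ExZ (c : R) f : momfin f -> \int[P]_x (c * f x) = c * \int[P]_x f x.
Proof. by move=> /momfin_integrable hf; exact: RintegralZl. Qed.

Lemma Ex_cst (c : R) : \int[P]_x c = c.
Proof.
transitivity (c * fine (P setT)); first exact: Rintegral_cst.
by rewrite probability_setT mulr1.
Qed.

Lemma Ex_sum (I : Type) (s : seq I) (Q : pred I) (f : I -> T -> R) :
  (forall i, momfin (f i)) ->
  \int[P]_x (\sum_(i <- s | Q i) f i x) = \sum_(i <- s | Q i) \int[P]_x f i x.
Proof.
move=> hf; elim: s => [|i s IH].
  by under eq_Rintegral do rewrite big_nil; rewrite big_nil Ex_cst.
under eq_Rintegral do rewrite big_cons; rewrite big_cons.
case: (Q i) => //; rewrite ExD ?IH//; exact: momfin_sum.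
Qed.

Lemma Ex_le f g : momfin f -> momfin g -> (forall x, f x <= g x) ->
  \int[P]_x f x <= \int[P]_x g x.
Proof. by move=> /momfin_integrable ? /momfin_integrable ? fg; exact: le_Rintegral. Qed.

Lemma Ex_norm f : momfin f -> `|\int[P]_x f x| <= \int[P]_x `|f x|.
Proof. by move=> /momfin_integrable ?; exact: le_normr_Rintegral. Qed.

Lemma Ex_norm_le f g : momfin f -> momfin g -> (forall x, `|f x| <= g x) ->
  `|\int[P]_x f x| <= \int[P]_x g x.
Proof.
move=> hf hg fg; apply: (le_trans (Ex_norm hf)); apply: Ex_le => //.
exact: momfin_norm.
Qed.

Lemma Ex_bounded f M : measurable_fun setT f -> (forall x, `|f x| <= M) ->
  `|\int[P]_x f x| <= M.
Proof.
move=> mf fM; rewrite -[leRHS](Ex_cst M); apply: Ex_norm_le => //.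
  exact: momfin_bounded fM.
exact: momfin_cst.
Qed.

Lemma expectation_Ex f : momfin f -> ('E_P[f] = (\int[P]_x f x)%:E)%E.
Proof.
move=> hf; rewrite unlock /Rintegral fineK//.
exact: integrable_fin_num (momfin_integrable hf).
Qed.

End moments.

Section transfer.
Context (R : realType) d1 d2 d3 (T1 : measurableType d1) (T2 : measurableType d2)
  (S : measurableType d3) (P1 : probability T1 R) (P2 : probability T2 R).

(** Positive and negative parts are transferred separately, so [f] may fail to be integrable. *)
Lemma Rintegral_same_law (X : T1 -> S) (Y : T2 -> S) (f : S -> R) :
  (forall g : S -> \bar R, measurable_fun setT g -> (forall x, 0 <= g x)%E ->
    (\int[P1]_x g (X x) = \int[P2]_y g (Y y))%E) ->
  measurable_fun setT f ->
  \int[P1]_x f (X x) = \int[P2]_y f (Y y).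
Proof.
move=> XY mf; congr fine.
have mf' : measurable_fun setT (EFin \o f) by exact/measurable_EFinP.
rewrite integralE [RHS]integralE; congr (_ - _)%E.
- have E1 : ((fun x => (f (X x))%:E)^\+)%E = (fun x => (EFin \o f)^\+%E (X x)).
    by apply/funext => x; rewrite !funeposE.
  have E2 : ((fun x => (f (Y x))%:E)^\+)%E = (fun x => (EFin \o f)^\+%E (Y x)).
    by apply/funext => x; rewrite !funeposE.
  rewrite E1 E2; apply: (XY (EFin \o f)^\+%E); [exact: measurable_funepos|].
  by move=> x; exact: funepos_ge0.
- have E1 : ((fun x => (f (X x))%:E)^\-)%E = (fun x => (EFin \o f)^\-%E (X x)).
    by apply/funext => x; rewrite !funenegE.
  have E2 : ((fun x => (f (Y x))%:E)^\-)%E = (fun x => (EFin \o f)^\-%E (Y x)).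
    by apply/funext => x; rewrite !funenegE.
  rewrite E1 E2; apply: (XY (EFin \o f)^\-%E); [exact: measurable_funeneg|].
  by move=> x; exact: funeneg_ge0.
Qed.

End transfer.

(** * Taylor bound for the exponential *)

Section exp_bounds.
Context (R : realType).

(** Each application raises the order of a Taylor remainder of [expR] by one, through the mean value
    theorem. The maximum bounds [expR c] for every [c] between 0 and [x], whatever the sign of
    [x]. *)
Lemma mvt_expR_step (k : nat) (r g : R -> R) :
  (forall x : R, is_derive x (1:R) r (g x)) -> r 0 = 0 ->
  (forall x, `|g x| <= `|x| ^+ k * Num.max 1 (expR x)) ->
  forall x, `|r x| <= `|x| ^+ k.+1 * Num.max 1 (expR x).
Proof.
move=> dr r0 gb x.
have rc : continuous r.
  move=> z; apply: differentiable_continuous; apply/derivable1_diffP.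
  exact: (@ex_derive _ _ _ _ _ _ _ (dr z)).
have max0 (z : R) : 0 <= Num.max 1 (expR z) by rewrite le_max ler01.
have [x0|x0|->] := ltrgt0P x.
- have [c /[!in_itv]/= /andP[c0 cx]] := @MVT _ r g 0 x x0 (fun z _ => dr z)
     (continuous_subspaceT rc).
  rewrite r0 !subr0 => ->; rewrite normrM mulrC exprS -mulrA ler_pM//.
    by rewrite gtr0_norm.
  rewrite (le_trans (gb c))// ler_pM ?exprn_ge0//.
    by rewrite gtr0_norm// lerXn2r ?nnegrE// ltW.
  rewrite ge_max le_max lexx/= le_max; apply/orP; right.
  by rewrite ler_expR ltW.
- have [c /[!in_itv]/= /andP[c0 cx]] := @MVT _ r g x 0 x0 (fun z _ => dr z)
     (continuous_subspaceT rc).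
  rewrite r0 !sub0r => /eqP; rewrite eqr_oppLR => /eqP ->.
  rewrite normrN normrM normrN mulrC exprS -mulrA ler_pM//.
    by rewrite ltr0_norm.
  rewrite (le_trans (gb c))// ler_pM ?exprn_ge0//.
    by rewrite -(ltr0_norm x0) lerXn2r ?nnegrE// !ltr0_norm// lerN2 ltW.
  rewrite ge_max le_max lexx/= le_max; apply/orP; left.
  by rewrite -expR0 ler_expR ltW.
- by rewrite r0 normr0 expr0n/= mul0r.
Qed.

Lemma expR_taylor2 (x : R) :
  `|expR x - 1 - x - x ^+ 2 / 2| <= `|x| ^+ 3 * (1 + expR x).
Proof.
apply: (@le_trans _ _ (`|x| ^+ 3 * Num.max 1 (expR x))); last first.
  by rewrite ler_wpM2l ?exprn_ge0// ge_max lerDl lerDr expR_ge0 ler01.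
apply: (@mvt_expR_step 2 (fun x => expR x - 1 - x - x ^+ 2 / 2) (fun x => expR x - 1 - x)).
- move=> y; apply: is_derive_eq; rewrite /GRing.scale/=; by field.
- by rewrite expR0 expr0n/= mul0r !subr0 subrr.
apply: (@mvt_expR_step 1 (fun x => expR x - 1 - x) (fun x => expR x - 1)).
- by move=> y; apply: is_derive_eq; rewrite subr0.
- by rewrite expR0 !subr0 subrr.
apply: (@mvt_expR_step 0 (fun x => expR x - 1) expR).
- by move=> y; apply: is_derive_eq; rewrite subr0.
- by rewrite expR0 subrr.
by move=> y; rewrite expr0 mul1r ger0_norm ?expR_ge0// le_max lexx orbT.
Qed.

End exp_bounds.

(** * Moments of the standard Gaussian vector *)

Section gauss_moments.
Context (R : realType).
Local Notation RB := (measurableTypeR R).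
Local Notation N := (@std_normal_vec R).
Variable m : nat.
Implicit Types u y : m.-tuple RB.

Lemma integral_tilt u : (\int[N m]_y (tilt u y)%:E = 1)%E.
Proof.
transitivity (\int[N m]_y (1 * (tilt u y)%:E))%E.
  by apply: eq_integral => y _; rewrite mul1e.
rewrite -(@cameron_martin R m u (fun=> 1%E))//.
rewrite (integral_cst (N m) measurableT).
by rewrite [X in (_ * X)%E](@probability_setT _ _ _ (N m)) mule1.
Qed.

(** A power of a tilt is a tilt up to a constant factor, so that [integral_tilt] controls all its
    moments. *)
Lemma tiltX u k y : tilt u y ^+ k =
  tilt (lcomb k%:R 0 u u) y *
  expR (\sum_(i < m) ((k%:R * (tnth u i : R)) ^+ 2 / 2 - k%:R * (tnth u i : R) ^+ 2 / 2)).
Proof.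
rewrite /tilt -expRM_natl -expRD; congr expR.
rewrite mulr_sumr -big_split/=; apply: eq_bigr => i _.
by rewrite tnth_lcomb; field.
Qed.

Lemma momfin_tilt u : momfin (N m) (tilt u).
Proof.
apply: (@momfin_le _ _ _ _ _ (fun k y => tilt u y ^+ k)).
- exact: measurable_tilt.
- move=> k; apply/integrableP; split.
    apply/measurable_EFinP; apply: measurable_funX; exact: measurable_tilt.
  under eq_integral => y _.
    rewrite /= ger0_norm ?exprn_ge0 ?expR_ge0// tiltX EFinM.
    over.
  rewrite ge0_integralZr; last 4 first.
  + exact: measurableT.
  + by apply/measurable_EFinP; exact: measurable_tilt.
  + by move=> y _; rewrite lee_fin expR_ge0.
  + by rewrite lee_fin expR_ge0.
  by rewrite integral_tilt mul1e ltry.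
- by move=> k x; rewrite ger0_norm// expR_ge0.
Qed.

(** From [expR z = expR (z / k) ^+ k] and [z / k <= expR (z / k)]; the two exponentials take care of
    the sign of [x]. *)
Lemma normX_le_expR (x : R) k :
  `|x| ^+ k <= k%:R ^+ k * (expR x + expR (- x)).
Proof.
have H (z : R) : 0 <= z -> z ^+ k <= k%:R ^+ k * expR z.
  case: k => [|k] z0; first by rewrite !expr0 mul1r -expR0 ler_expR.
  have k0 : 0 < k.+1%:R :> R by [].
  have -> : expR z = expR (z / k.+1%:R) ^+ k.+1.
    by rewrite -expRM_natl mulrC divfK// gt_eqF.
  rewrite -exprMn lerXn2r ?nnegrE ?mulr_ge0 ?expR_ge0//.
  rewrite -[leLHS](divfK (lt0r_neq0 k0)) mulrC ler_wpM2l//.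
  by rewrite (le_trans _ (expR_ge1Dx _))// lerDr.
rewrite (le_trans (H `|x| _))// ler_wpM2l ?exprn_ge0//.
by case: (ger0P x) => x0; rewrite ?lerDl ?lerDr expR_ge0.
Qed.

Lemma momfin_tnth i : momfin (N m) (fun y => tnth y i : R).
Proof.
pose e (c : R) : m.-tuple RB := [tuple (if j == i then c else 0 : RB) | j < m].
have tiltE c y : tilt (e c) y = expR (c * tnth y i - c ^+ 2 / 2).
  rewrite /tilt (bigD1 i)//= big1 ?addr0 ?tnth_mktuple ?eqxx//.
  by move=> j /negbTE ji; rewrite tnth_mktuple ji mul0r expr0n/= mul0r subr0.
(* For [c = 1] and [c = -1], [expR (c y_i)] is [expR 2^-1] times the tilt by [c] times the [i]-th
   basis vector. *)
apply: (@momfin_le _ _ _ _ _ (fun k y =>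
   k%:R ^+ k * expR 2^-1 * tilt (e 1) y + k%:R ^+ k * expR 2^-1 * tilt (e (-1)) y)).
- exact: measurable_tnth.
- by move=> k; apply: momfin_integrable; apply: momfinD; apply: momfinZ; exact: momfin_tilt.
- move=> k y; rewrite (le_trans (normX_le_expR _ _))// !tiltE mulrDr.
  rewrite -!(mulrA (k%:R ^+ k)) -!expRD sqrrN expr1n mul1r mulN1r.
  by rewrite mul1r !(addrC 2^-1) !subrK.
Qed.

Definition dot_tuple (a y : m.-tuple RB) : R :=
  \sum_(i < m) (tnth a i : R) * (tnth y i : R).

Lemma momfin_dot a : momfin (N m) (dot_tuple a).
Proof. by apply: momfin_sum => i; apply: momfinZ; exact: momfin_tnth. Qed.

(** Adding [M] makes [f] nonnegative, where [cameron_martin] applies; the same shift carries the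
    other Tonelli-type identities over to bounded functions. *)
Lemma cameron_martinR u (f : m.-tuple RB -> R) M :
  measurable_fun setT f -> (forall x, `|f x| <= M) ->
  \int[N m]_y f (lcomb 1 1 y u) = \int[N m]_y (f y * tilt u y).
Proof.
move=> mf fM.
have mtu : momfin (N m) (tilt u) by exact: momfin_tilt.
have mfu : measurable_fun setT (fun y => f (lcomb 1 1 y u)).
  by apply: (measurableT_comp mf); exact: measurable_lcomb.
have hf : momfin (N m) f by exact: momfin_bounded fM.
have hfu : momfin (N m) (fun y => f (lcomb 1 1 y u)) by exact: momfin_bounded (fun _ => fM _).
have f0 y : (0 <= (f y + M)%:E)%E.
  by rewrite lee_fin -lerBlDr sub0r; have := fM y; rewrite ler_norml => /andP[].
have mfM : measurable_fun setT (fun y => (f y + M)%:E).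
  by apply/measurable_EFinP; exact: measurable_funD.
have E : \int[N m]_y (f (lcomb 1 1 y u) + M) = \int[N m]_y ((f y + M) * tilt u y).
  congr fine; apply: (etrans (@cameron_martin R m u (fun y => (f y + M)%:E) mfM f0)).
  by apply: eq_integral => y _; rewrite EFinM.
move: E; rewrite ExD//; last exact: momfin_cst.
under [X in _ = X -> _]eq_Rintegral do rewrite mulrDl.
rewrite ExD; [|exact: momfinM|exact: momfinZ].
rewrite Ex_cst ExZ//.
have -> : \int[N m]_y tilt u y = 1 by rewrite /Rintegral integral_tilt.
by rewrite mulr1 => /addIr.
Qed.

(** The moments are the Taylor coefficients at 0 of the moment generating function, known from
    [integral_tilt] to be [expR (t ^+ 2 * A / 2)]. Both sides are expanded to second order with an
    error of order [t^3], uniformly on [0 < t <= 1]. *)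
Lemma dot_tuple_mean_var a :
  \int[N m]_y dot_tuple a y = 0 /\
  \int[N m]_y (dot_tuple a y ^+ 2) = \sum_(i < m) (tnth a i : R) ^+ 2.
Proof.
pose A := \sum_(i < m) (tnth a i : R) ^+ 2; rewrite -/A.
set m1 := \int[N m]_y _; set m2 := \int[N m]_y _.
have hw := momfin_dot a.
have A0 : 0 <= A by apply: sumr_ge0 => i _; exact: sqr_ge0.
have tiltE t y : tilt (lcomb t 0 a a) y = expR (- (t ^+ 2 * A / 2)) * expR (t * dot_tuple a y).
  rewrite /tilt -expRD; congr expR.
  rewrite /A /dot_tuple !mulr_sumr mulr_suml -sumrN -big_split/=.
  by apply: eq_bigr => i _; rewrite tnth_lcomb; field.
have het t : momfin (N m) (fun y => expR (t * dot_tuple a y)).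
  have -> : (fun y => expR (t * dot_tuple a y)) =
      (fun y => expR (t ^+ 2 * A / 2) * tilt (lcomb t 0 a a) y).
    by apply/funext => y; rewrite tiltE mulrA -expRD subrr expR0 mul1r.
  by apply: momfinZ; exact: momfin_tilt.
have Eet t : \int[N m]_y expR (t * dot_tuple a y) = expR (t ^+ 2 * A / 2).
  transitivity (\int[N m]_y (expR (t ^+ 2 * A / 2) * tilt (lcomb t 0 a a) y)).
    by apply: eq_Rintegral => y _; rewrite tiltE mulrA -expRD subrr expR0 mul1r.
  rewrite ExZ; last exact: momfin_tilt.
  by rewrite /Rintegral integral_tilt mulr1.
(* For [0 < t <= 1], [expR (t w) <= expR w + expR (- w)]: the remainder of [expR_taylor2] at [t w]
   is at most [t^3] times an integrable variable free of [t]. *)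
pose C1 := \int[N m]_y (`|dot_tuple a y| ^+ 3 *
  (1 + (expR (1 * dot_tuple a y) + expR (-1 * dot_tuple a y)))).
have hC1 : momfin (N m) (fun y => `|dot_tuple a y| ^+ 3 *
  (1 + (expR (1 * dot_tuple a y) + expR (-1 * dot_tuple a y)))).
  apply: momfinM; first by apply: momfinX; exact: momfin_norm.
  by apply: momfinD; [exact: momfin_cst|exact: momfinD].
have B1 (t : R) : 0 < t <= 1 ->
    `|expR (t ^+ 2 * A / 2) - 1 - t * m1 - t ^+ 2 * m2 / 2| <= t ^+ 3 * C1.
  move=> /andP[t0 t1].
  have -> : expR (t ^+ 2 * A / 2) - 1 - t * m1 - t ^+ 2 * m2 / 2 =
      \int[N m]_y (expR (t * dot_tuple a y) - 1 - t * dot_tuple a y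
        - (t ^+ 2 / 2) * dot_tuple a y ^+ 2).
    have h1 : momfin (N m) (fun y => expR (t * dot_tuple a y) - 1).
      by apply: momfinB => //; exact: momfin_cst.
    have h2 : momfin (N m) (fun y => expR (t * dot_tuple a y) - 1 - t * dot_tuple a y).
      by apply: momfinB => //; exact: momfinZ.
    have h3 : momfin (N m) (fun y => dot_tuple a y ^+ 2) by exact: momfinX.
    rewrite ExB//; last exact: momfinZ.
    rewrite ExB//; last exact: momfinZ.
    rewrite ExB//; last exact: momfin_cst.
    by rewrite Ex_cst !ExZ// Eet -/m1 -/m2; ring.
  rewrite -ExZ//; apply: Ex_norm_le.
  - apply: momfinB; last by apply: momfinZ; exact: momfinX.
    apply: momfinB; last exact: momfinZ.
    by apply: momfinB => //; exact: momfin_cst.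
  - exact: momfinZ.
  - move=> y; set w := dot_tuple a y.
    have := expR_taylor2 (t * w); rewrite exprMn mulrAC => /le_trans; apply.
    rewrite normrM exprMn (gtr0_norm t0) -mulrA ler_wpM2l ?exprn_ge0 ?(ltW t0)//.
    rewrite ler_wpM2l ?exprn_ge0// lerD2l mul1r mulN1r.
    have [w0|w0] := lerP 0 w.
      rewrite (@le_trans _ _ (expR w))// ?lerDl ?expR_ge0// ler_expR.
      by rewrite ler_piMl.
    rewrite (@le_trans _ _ (expR (- w)))// ?lerDr ?expR_ge0// ler_expR.
    by rewrite (@le_trans _ _ 0)// ?oppr_ge0 ?(ltW w0)// pmulr_rle0// ltW.
(* At [x = t^2 (A / 2)] the term [x^2 / 2] is of order [t^4] and the Taylor remainder of order
   [t^6]; both are weakened to [t^3], since [t <= 1]. *)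
pose C2 := (A / 2) ^+ 2 / 2 + (A / 2) ^+ 3 * (1 + expR (A / 2)).
have B2 (t : R) : 0 < t <= 1 -> `|expR (t ^+ 2 * A / 2) - 1 - t ^+ 2 * A / 2| <= t ^+ 3 * C2.
  move=> /andP[t0 t1].
  have t01 k : t ^+ k <= 1 by rewrite exprn_ile1 ?(ltW t0).
  have t00 k : 0 <= t ^+ k by rewrite exprn_ge0 ?(ltW t0).
  set x := _ * A / 2.
  have x0 : 0 <= x by rewrite /x divr_ge0// mulr_ge0.
  have xE : x = t ^+ 2 * (A / 2) by rewrite /x mulrA.
  have A20 : 0 <= A / 2 by rewrite divr_ge0.
  have xA : x <= A / 2 by rewrite xE ler_piMl.
  have := expR_taylor2 x; rewrite (ger0_norm x0) => H.
  have -> : expR x - 1 - x = (expR x - 1 - x - x ^+ 2 / 2) + x ^+ 2 / 2 by ring.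
  rewrite (le_trans (ler_normD _ _))// addrC /C2 mulrDr lerD//.
    rewrite ger0_norm ?divr_ge0 ?sqr_ge0// xE [leRHS]mulrA ler_pM2r ?invr_gt0// exprMn.
    by rewrite -exprM ler_wpM2r ?sqr_ge0// (exprD t 3 1) ler_piMr.
  rewrite (le_trans H)// mulrA; apply: ler_pM.
  - exact: exprn_ge0.
  - by rewrite addr_ge0// expR_ge0.
  - rewrite xE exprMn -exprM ler_wpM2r ?exprn_ge0//.
    by rewrite (exprD t 3 3) ler_piMr.
  - by rewrite lerD2l ler_expR.
have B3 (t : R) : 0 < t <= 1 -> `|t * m1 + t ^+ 2 * ((m2 - A) / 2)| <= t ^+ 3 * (C1 + C2).
  move=> t01; have b1 := B1 t t01; have b2 := B2 t t01.
  have -> : t * m1 + t ^+ 2 * ((m2 - A) / 2) =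
     (expR (t ^+ 2 * A / 2) - 1 - t ^+ 2 * A / 2) -
     (expR (t ^+ 2 * A / 2) - 1 - t * m1 - t ^+ 2 * m2 / 2) by field.
  by rewrite (le_trans (ler_normB _ _))// mulrDr addrC lerD.
(* The choice [t = |b| / (2 C)], which is at most 1 by the case [t = 1], gives [|b| <= |b| / 2]. *)
have lim0 (b C : R) : (forall t : R, 0 < t <= 1 -> `|b| <= t * C) -> b = 0.
  move=> H; apply/eqP; rewrite -normr_le0 leNgt; apply/negP => b0.
  have C0 : 0 < C.
    by have := H 1; rewrite ltr01 lexx mul1r => /(_ isT); exact: lt_le_trans.
  have t0 : 0 < `|b| / (2 * C) by rewrite divr_gt0// mulr_gt0.
  have t1 : `|b| / (2 * C) <= 1.
    rewrite ler_pdivrMr ?mulr_gt0// mul1r.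
    have := H 1; rewrite ltr01 lexx mul1r => /(_ isT) /le_trans; apply.
    by rewrite ler_peMl ?(ltW C0)// ler1n.
  have := H _ (introT andP (conj t0 t1)).
  have -> : `|b| / (2 * C) * C = `|b| / 2 by field; rewrite gt_eqF.
  by rewrite ler_pdivlMr// leNgt => /negP; apply; rewrite ltr_pMr// ltr1n.
have m10 : m1 = 0.
  apply: (lim0 _ (`|C1 + C2| + `|(m2 - A) / 2|)) => t t01.
  have /andP[t0 t1] := t01.
  rewrite -(ler_pM2l t0).
  have -> : t * `|m1| = `|(t * m1 + t ^+ 2 * ((m2 - A) / 2)) - t ^+ 2 * ((m2 - A) / 2)|.
    by rewrite addrK normrM (gtr0_norm t0).
  have -> : t * (t * (`|C1 + C2| + `|(m2 - A) / 2|)) =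
      t ^+ 2 * `|C1 + C2| + t ^+ 2 * `|(m2 - A) / 2| by ring.
  apply: (le_trans (ler_normB _ _)); apply: lerD; last first.
    by rewrite normrM (ger0_norm (sqr_ge0 t)).
  apply: (le_trans (B3 t t01)); apply: (le_trans (ler_norm _)).
  rewrite normrM ler_wpM2r//.
  rewrite ger0_norm ?exprn_ge0 ?(ltW t0)//.
  by rewrite (exprD t 2 1) ler_piMr ?exprn_ge0 ?(ltW t0).
split => //; apply/eqP; rewrite -subr_eq0; apply/eqP.
have : (m2 - A) / 2 = 0.
  apply: (lim0 _ (C1 + C2)) => t t01.
  have /andP[t0 t1] := t01.
  have := B3 t t01; rewrite m10 mulr0 add0r normrM ger0_norm ?sqr_ge0//.
  by rewrite (exprD t 2 1) -mulrA ler_pM2l// exprn_gt0.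
by move=> /eqP; rewrite mulf_eq0 invr_eq0 pnatr_eq0 orbF => /eqP.
Qed.

Lemma gauss_mean i : \int[N m]_y (tnth y i : R) = 0.
Proof.
pose e : m.-tuple RB := [tuple (if j == i then 1 else 0 : RB) | j < m].
have [<- _] := dot_tuple_mean_var e.
apply: eq_Rintegral => y _; rewrite /dot_tuple (bigD1 i)//= big1 ?addr0.
  by rewrite tnth_mktuple eqxx mul1r.
by move=> j /negbTE ji; rewrite tnth_mktuple ji mul0r.
Qed.

Lemma gauss_var i : \int[N m]_y ((tnth y i : R) ^+ 2) = 1.
Proof.
pose e : m.-tuple RB := [tuple (if j == i then 1 else 0 : RB) | j < m].
transitivity (\sum_(j < m) (tnth e j : R) ^+ 2).
  rewrite -(dot_tuple_mean_var e).2.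
  apply: eq_Rintegral => y _; rewrite /dot_tuple (bigD1 i)//= big1 ?addr0.
    by rewrite tnth_mktuple eqxx mul1r.
  by move=> j /negbTE ji; rewrite tnth_mktuple ji mul0r.
rewrite (bigD1 i)//= big1 ?addr0; first by rewrite tnth_mktuple eqxx expr1n.
by move=> j /negbTE ji; rewrite tnth_mktuple ji expr0n.
Qed.

(** Off the diagonal, by polarization: [dot_tuple_mean_var] gives variance 2 to [y_i + y_j]. *)
Lemma gauss_cov i j : \int[N m]_y ((tnth y i : R) * (tnth y j : R)) = (i == j)%:R.
Proof.
have [->|ij] := eqVneq i j; first exact: gauss_var.
pose e : m.-tuple RB := [tuple (if (k == i) || (k == j) then 1 else 0 : RB) | k < m].
have ji : (j == i) = false by rewrite eq_sym (negbTE ij).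
have dotE y : dot_tuple e y = (tnth y i : R) + (tnth y j : R).
  rewrite /dot_tuple (bigD1 i)//= (bigD1 j)/= ?ji// big1 ?addr0.
    by rewrite !tnth_mktuple !eqxx orbT !mul1r.
  by move=> k /andP[/negbTE ki /negbTE kj]; rewrite tnth_mktuple ki kj mul0r.
have sumE : \sum_(k < m) (tnth e k : R) ^+ 2 = 2.
  rewrite (bigD1 i)//= (bigD1 j)/= ?ji// big1 ?addr0.
    by rewrite !tnth_mktuple !eqxx orbT !expr1n.
  by move=> k /andP[/negbTE ki /negbTE kj]; rewrite tnth_mktuple ki kj expr0n.
have := (dot_tuple_mean_var e).2; rewrite sumE.
have h1 k : momfin (N m) (fun y => (tnth y k : R) ^+ 2).
  by apply: momfinX; exact: momfin_tnth.
have h2 : momfin (N m) (fun y => (tnth y i : R) * (tnth y j : R)).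
  by apply: momfinM; exact: momfin_tnth.
have -> : \int[N m]_y (dot_tuple e y ^+ 2) =
    2 + 2 * \int[N m]_y ((tnth y i : R) * (tnth y j : R)).
  have -> : 2 = \int[N m]_y ((tnth y i : R) ^+ 2) + \int[N m]_y ((tnth y j : R) ^+ 2) :> R.
    by rewrite !gauss_var.
  rewrite [in RHS]gauss_var [in RHS]gauss_var -[1 + 1]/(2 : R) -ExZ//.
  rewrite -[X in X + _](_ : \int[N m]_y ((tnth y i : R) ^+ 2) + \int[N m]_y ((tnth y j : R) ^+ 2) = _); last by rewrite !gauss_var.
  rewrite -ExD// -ExD//; [|exact: momfinD|exact: momfinZ].
  by apply: eq_Rintegral => y _; rewrite dotE; ring.
by move=> H; rewrite /=; lra.
Qed.

End gauss_moments.

Section param.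
Context (R : realType) d1 d2 (T1 : measurableType d1) (T2 : measurableType d2)
  (Q : probability T2 R).

Lemma measurable_Ex_param (f : T1 * T2 -> R) M :
  measurable_fun setT f -> (forall z, `|f z| <= M) ->
  measurable_fun setT (fun x => \int[Q]_y f (x, y)).
Proof.
move=> mf fM.
have mfx x : measurable_fun setT (fun y => f (x, y)).
  by apply: (measurableT_comp mf); exact: measurable_fun_pair.
have hfx x : momfin Q (fun y => f (x, y)) by exact: momfin_bounded (fun _ => fM _).
rewrite (_ : (fun x => _) = fun x => \int[Q]_y (f (x, y) + M) - M); last first.
  by apply/funext => x; rewrite ExD ?Ex_cst ?addrK//; exact: momfin_cst.
apply: measurable_funB => //; apply: measurableT_comp => //.
apply: (@measurable_fun_fubini_tonelli_F _ _ T1 T2 R Q (fun z => (f z + M)%:E)).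
- by apply/measurable_EFinP; exact: measurable_funD.
- by move=> z; rewrite lee_fin -lerBlDr sub0r; have := fM z; rewrite ler_norml => /andP[].
Qed.

End param.

(** * Second-order expansion of Gaussian averages *)

Section l1.
Context (R : realType) (m : nat).
Local Notation RB := (measurableTypeR R).
Implicit Types u y : m.-tuple RB.

Definition l1 y : R := \sum_(i < m) `|tnth y i : R|.

Lemma l1_ge0 y : 0 <= l1 y.
Proof. exact: sumr_ge0. Qed.

Lemma l1_lcomb a b x y : l1 (lcomb a b x y) <= `|a| * l1 x + `|b| * l1 y.
Proof.
rewrite /l1 !mulr_sumr -big_split/=; apply: ler_sum => i _.
by rewrite tnth_lcomb (le_trans (ler_normD _ _))// !normrM.
Qed.

Lemma le_tnth_l1 y i : `|tnth y i : R| <= l1 y.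
Proof. by rewrite /l1 (bigD1 i)//= lerDl sumr_ge0. Qed.

Lemma dot_tuple_le u y : `|dot_tuple u y| <= l1 u * l1 y.
Proof.
rewrite /dot_tuple (le_trans (ler_norm_sum _ _ _))// /l1 mulr_suml.
by apply: ler_sum => i _; rewrite normrM ler_wpM2l// le_tnth_l1.
Qed.

Definition half_sq u : R := (\sum_(i < m) (tnth u i : R) ^+ 2) / 2.

Lemma half_sq_ge0 u : 0 <= half_sq u.
Proof. by rewrite divr_ge0// sumr_ge0// => i _; exact: sqr_ge0. Qed.

Lemma half_sq_le u : half_sq u <= l1 u ^+ 2.
Proof.
have : half_sq u * 2 <= l1 u ^+ 2.
  rewrite divfK// expr2 [X in X * _]/l1 mulr_suml; apply: ler_sum => i _.
  by rewrite -real_normK ?num_real// expr2 ler_wpM2l// le_tnth_l1.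
by apply: le_trans; rewrite ler_peMr ?half_sq_ge0// ler1n.
Qed.

Lemma tiltE u y : tilt u y = expR (dot_tuple u y - half_sq u).
Proof.
by rewrite /tilt /dot_tuple /half_sq mulr_suml -sumrB.
Qed.

End l1.

Section taylor.
Context (R : realType) (m : nat).
Local Notation RB := (measurableTypeR R).
Local Notation N := (@std_normal_vec R m).
Implicit Types u y h : m.-tuple RB.

Lemma momfin_l1 : momfin N (@l1 R m).
Proof. by apply: momfin_sum => i; apply: momfin_norm; exact: momfin_tnth. Qed.

Lemma cameron_martin_ge0R u (f : m.-tuple RB -> R) :
  measurable_fun setT f -> (forall x, 0 <= f x) ->
  \int[N]_y f (lcomb 1 1 y u) = \int[N]_y (f y * tilt u y).
Proof.
move=> mf f0; congr fine.
apply: (etrans (@cameron_martin R m u (EFin \o f) _ _)) => //.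
exact/measurable_EFinP.
Qed.

(** The subtracted terms are those of degree 0, 1 and 2 in [u]; [half_sq u] is itself of second
    order, hence grouped with the quadratic term. *)
Definition tilt_rem u y : R :=
  tilt u y - 1 - dot_tuple u y - (dot_tuple u y ^+ 2 / 2 - half_sq u).

Lemma momfin_tilt_rem u : momfin N (tilt_rem u).
Proof.
have hd := @momfin_dot R m u.
apply: momfinB.
  by apply: momfinB => //; apply: momfinB; [exact: momfin_tilt|exact: momfin_cst].
apply: momfinB; last exact: momfin_cst.
by apply: momfinM; [exact: momfinX|exact: momfin_cst].
Qed.

(** [expR_taylor2] at the exponent [a - b], with the terms [b ^+ 2 / 2 - a * b], of order at least
    three in [u], added back. *)
Lemma tilt_rem_le u y :
  `|tilt_rem u y| <= (l1 u * (l1 y + l1 u)) ^+ 3 +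
     `|dot_tuple u y - half_sq u| ^+ 3 * tilt u y + l1 u ^+ 3 * (l1 y + l1 u).
Proof.
set a := dot_tuple u y; set b := half_sq u; set s := l1 u; set r := l1 y.
have s0 : 0 <= s by exact: l1_ge0.
have r0 : 0 <= r by exact: l1_ge0.
have b0 : 0 <= b by exact: half_sq_ge0.
have bs : b <= s ^+ 2 by exact: half_sq_le.
have as_ : `|a| <= s * r by exact: dot_tuple_le.
have := expR_taylor2 (a - b); rewrite -tiltE => H.
have abs_ : `|a - b| <= s * (r + s).
  by rewrite (le_trans (ler_normB _ _))// mulrDr lerD// -?expr2 ger0_norm.
have -> : tilt_rem u y = (tilt u y - 1 - (a - b) - (a - b) ^+ 2 / 2) + (b ^+ 2 / 2 - a * b).
  by rewrite /tilt_rem -/a -/b; field.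
rewrite (le_trans (ler_normD _ _))// lerD//.
  rewrite (le_trans H)// mulrDr mulr1 lerD2r.
  by rewrite lerXn2r ?nnegrE// mulr_ge0// addr_ge0.
rewrite (le_trans (ler_normB _ _))// mulrDr addrC lerD//.
  rewrite normrM (ger0_norm b0) (exprD s 2 1) expr1 mulrC -mulrA ler_pM//.
rewrite ger0_norm ?divr_ge0 ?sqr_ge0//.
have : b ^+ 2 <= s ^+ 4 by rewrite (exprM s 2 2) lerXn2r ?nnegrE// sqr_ge0.
rewrite -exprSr; apply: le_trans.
by rewrite ler_piMr ?sqr_ge0// invf_le1// ler1n.
Qed.

Lemma cube_le (x y : R) : 0 <= x -> 0 <= y -> (x + y) ^+ 3 <= 4 * (x ^+ 3 + y ^+ 3).
Proof.
move=> x0 y0.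
have : 0 <= (x - y) ^+ 2 * (x + y) by rewrite mulr_ge0 ?sqr_ge0// addr_ge0.
rewrite -subr_ge0 => H; rewrite -subr_ge0.
have -> : 4 * (x ^+ 3 + y ^+ 3) - (x + y) ^+ 3 = 3 * ((x - y) ^+ 2 * (x + y)) by ring.
by move: H; rewrite subr0 => H; rewrite mulr_ge0.
Qed.

Lemma tilt_rem_integral : exists2 C : R, 0 <= C &
  forall u, \int[N]_y `|tilt_rem u y| <= C * (l1 u ^+ 3 + l1 u ^+ 6).
Proof.
pose G := \int[N]_y (1 + l1 y) ^+ 3.
have hG : momfin N (fun y => (1 + l1 y) ^+ 3).
  by apply: momfinX; apply: momfinD; [exact: momfin_cst|exact: momfin_l1].
have G0 : 0 <= G by apply: Rintegral_ge0 => y _; rewrite exprn_ge0// addr_ge0// l1_ge0.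
(* Each of the three terms of [tilt_rem_le] has integral at most that of [f1], itself at most
   [4 * (s ^+ 3 * G + s ^+ 6)]; hence [12 = 3 * 4]. *)
exists (12 * (G + 1)); first by rewrite mulr_ge0// addr_ge0.
move=> u; set s := l1 u.
have s0 : 0 <= s by exact: l1_ge0.
pose f1 y := s ^+ 3 * (1 + l1 y + s) ^+ 3.
have hf1 : momfin N f1.
  apply: momfinZ; apply: momfinX; apply: momfinD; last exact: momfin_cst.
  by apply: momfinD; [exact: momfin_cst|exact: momfin_l1].
pose f2 y := `|dot_tuple u y - half_sq u| ^+ 3.
have hd : momfin N (fun y => dot_tuple u y - half_sq u).
  by apply: momfinB; [exact: momfin_dot|exact: momfin_cst].
have hf2 : momfin N f2 by apply: momfinX; exact: momfin_norm.
have hf2t : momfin N (fun y => f2 y * tilt u y) by apply: momfinM => //; exact: momfin_tilt.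
(* The tilt is traded for a translation of [y] by [u], under which [dot_tuple u y - half_sq u]
   becomes [dot_tuple u y + half_sq u]. *)
have E2 : \int[N]_y (f2 y * tilt u y) <= \int[N]_y f1 y.
  rewrite -(@cameron_martin_ge0R u f2); last 2 first.
  - exact: momfin_measurable hf2.
  - by move=> y; rewrite exprn_ge0.
  have f2E y : f2 (lcomb 1 1 y u) = `|dot_tuple u y + half_sq u| ^+ 3.
    rewrite /f2; congr (`|_| ^+ 3).
    rewrite /dot_tuple /half_sq !mulr_suml -sumrB -big_split/=.
    by apply: eq_bigr => i _; rewrite tnth_lcomb; field.
  apply: Ex_le => //.
    have -> : (fun y => f2 (lcomb 1 1 y u)) = (fun y => `|dot_tuple u y + half_sq u| ^+ 3).
      by apply/funext => y; rewrite f2E.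
    apply: momfinX; apply: momfin_norm; apply: momfinD; [exact: momfin_dot|exact: momfin_cst].
  move=> y; rewrite f2E /f1 -exprMn.
  rewrite lerXn2r ?nnegrE//.
    by rewrite mulr_ge0// addr_ge0// addr_ge0// l1_ge0.
  rewrite (le_trans (ler_normD _ _))// mulrDr lerD//.
    by rewrite (le_trans (dot_tuple_le _ _))// ler_wpM2l// lerDr.
  by rewrite ger0_norm ?half_sq_ge0// (le_trans (half_sq_le _))// expr2.
have E1 : \int[N]_y f1 y <= 4 * (s ^+ 3 * G + s ^+ 6).
  have -> : 4 * (s ^+ 3 * G + s ^+ 6) = (4 * s ^+ 3) * G + 4 * s ^+ 6 by ring.
  rewrite -[X in _ + X](Ex_cst N) -ExZ// -ExD//; last 2 first.
  - exact: momfinZ.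
  - exact: momfin_cst.
  apply: Ex_le => //.
    by apply: momfinD; [exact: momfinZ|exact: momfin_cst].
  move=> y; rewrite /f1.
  have /(ler_wpM2l (exprn_ge0 3 s0)) : (1 + l1 y + s) ^+ 3 <= 4 * ((1 + l1 y) ^+ 3 + s ^+ 3).
    by apply: cube_le => //; rewrite addr_ge0// l1_ge0.
  by move/le_trans; apply; rewrite le_eqVlt; apply/orP; left; apply/eqP; ring.
apply: (@le_trans _ _ (\int[N]_y (f1 y + f2 y * tilt u y + f1 y))).
  apply: Ex_le.
  - by apply: momfin_norm; exact: momfin_tilt_rem.
  - by apply: momfinD => //; exact: momfinD.
  move=> y; apply: (le_trans (tilt_rem_le u y)); rewrite -/s -/(f2 y).
  have l10 := l1_ge0 y.
  apply: lerD; first apply: lerD => //.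
    by rewrite /f1 exprMn ler_wpM2l ?exprn_ge0// lerXn2r ?nnegrE ?addr_ge0// -addrA lerDr.
  rewrite /f1 ler_wpM2l ?exprn_ge0//.
  apply: (@le_trans _ _ (1 + l1 y + s)); first by rewrite -addrA lerDr.
  by rewrite ler_eXnr// -addrA lerDl addr_ge0.
rewrite ExD//; last exact: momfinD.
rewrite ExD//.
have -> : 12 * (G + 1) * (s ^+ 3 + s ^+ 6) =
   4 * (s ^+ 3 * G + s ^+ 6) + 4 * (s ^+ 3 * G + s ^+ 6) + 4 * (s ^+ 3 * G + s ^+ 6)
   + 12 * s ^+ 3 + 12 * s ^+ 6 * G by ring.
rewrite -[X in _ <= X]addrA; apply: ler_wpDr.
  by rewrite addr_ge0 ?mulr_ge0// exprn_ge0.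
by apply: lerD => //; apply: lerD => //; exact: le_trans E2 E1.
Qed.

(* The remainder involves no derivative of [F]: by Cameron-Martin, translating by
   [h] amounts to integrating [F] against [tilt (h / v)], which is smooth in [h]. *)
Lemma gauss_taylor (sg : R) : 0 < sg -> exists2 C : R, 0 <= C &
  forall (F : m.-tuple RB -> R) (M v : R),
  measurable_fun setT F -> (forall x, `|F x| <= M) -> sg <= v ->
  exists A0 (A : 'I_m -> R) (B : 'I_m -> 'I_m -> R),
    (forall j k, `|B j k| <= C * M) /\
    forall h, `|\int[N]_y F (lcomb v 1 y h) -
      (A0 + \sum_(j < m) A j * (tnth h j : R) +
       \sum_(j < m) \sum_(k < m) B j k * ((tnth h j : R) * (tnth h k : R)))| <=
      C * M * (l1 h ^+ 3 + l1 h ^+ 6).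
Proof.
move=> sg0; have [C1 C10 HC1] := tilt_rem_integral.
(* Second-order Hermite polynomials: the integrals of [F'] against them are, up to [2 * v ^+ 2], the
   quadratic coefficients. *)
pose g (j k : 'I_m) (y : m.-tuple RB) : R :=
  (tnth y j : R) * (tnth y k : R) - (j == k)%:R.
have hg j k : momfin N (g j k).
  by apply: momfinB; [apply: momfinM; exact: momfin_tnth|exact: momfin_cst].
pose C2 := \sum_(j < m) \sum_(k < m) \int[N]_y `|g j k y|.
have I0 j k : 0 <= \int[N]_y `|g j k y| by apply: Rintegral_ge0.
have C20 : 0 <= C2 by apply: sumr_ge0 => j _; apply: sumr_ge0.
have C2jk j k : \int[N]_y `|g j k y| <= C2.
  rewrite /C2 (bigD1 j)//= (bigD1 k)//= -addrA lerDl addr_ge0//.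
    exact: sumr_ge0.
  by apply: sumr_ge0 => ? _; apply: sumr_ge0.
exists (C1 * (sg^-1 ^+ 3 + sg^-1 ^+ 6) + C2 * (sg^-1 ^+ 2)).
  by rewrite addr_ge0// mulr_ge0// ?addr_ge0// ?exprn_ge0// invr_ge0 ltW.
move=> F M v mF FM sgv.
have v0 : 0 < v by exact: lt_le_trans sgv.
have M0 : 0 <= M.
  exact: le_trans (FM [tuple (0 : RB) | i < m]).
(* Since [F (v y + h) = F' (y + h / v)], rescaling to unit variance makes [u = h / v] the tilt
   parameter, and [sg <= v] bounds it uniformly in [v]. *)
pose F' y := F (lcomb v 0 y y).
have mF' : measurable_fun setT F'.
  by apply: (measurableT_comp mF); exact: measurable_lcomb.
have F'M y : `|F' y| <= M by exact: FM.
have hF' : momfin N F' by exact: momfin_bounded F'M.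
exists (\int[N]_y F' y), (fun j => \int[N]_y (F' y * (tnth y j : R)) / v),
  (fun j k => \int[N]_y (F' y * g j k y) / (2 * v ^+ 2)).
have vV : v^-1 <= sg^-1 by rewrite lef_pV2.
have vV0 : 0 <= v^-1 by rewrite invr_ge0 ltW.
split.
  move=> j k; rewrite normrM (ger0_norm (_ : 0 <= (2 * v ^+ 2)^-1)); last first.
    by rewrite invr_ge0 mulr_ge0// sqr_ge0.
  apply: (@le_trans _ _ (M * C2 * sg^-1 ^+ 2)); last first.
    have -> : (C1 * (sg^-1 ^+ 3 + sg^-1 ^+ 6) + C2 * sg^-1 ^+ 2) * M =
      M * C2 * sg^-1 ^+ 2 + M * (C1 * (sg^-1 ^+ 3 + sg^-1 ^+ 6)) by ring.
    rewrite lerDl mulr_ge0// mulr_ge0// addr_ge0// exprn_ge0//.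
      by rewrite invr_ge0 ltW.
    by rewrite invr_ge0 ltW.
  apply: ler_pM => //.
  - by rewrite invr_ge0 mulr_ge0// sqr_ge0.
  - apply: (@le_trans _ _ (M * \int[N]_y `|g j k y|)); last by rewrite ler_wpM2l.
    rewrite -ExZ; last exact: momfin_norm.
    apply: Ex_norm_le; [exact: momfinM|by apply: momfinZ; exact: momfin_norm|].
    by move=> y; rewrite normrM ler_wpM2r.
  - rewrite invfM exprVn; apply: (@le_trans _ _ (v ^- 2)).
      by rewrite ler_piMl ?invr_ge0 ?sqr_ge0// invf_le1// ler1n.
    by rewrite lef_pV2 ?posrE ?exprn_gt0// lerXn2r ?nnegrE// ltW.
move=> h; set u := lcomb v^-1 0 h h.
have u1 : l1 u <= sg^-1 * l1 h.
  rewrite (le_trans (l1_lcomb _ _ _ _))// normr0 mul0r addr0 ger0_norm//.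
  by rewrite ler_wpM2r// l1_ge0.
have -> : \int[N]_y F (lcomb v 1 y h) = \int[N]_y (F' y * tilt u y).
  rewrite -(@cameron_martinR R m u F' M)//; apply: eq_Rintegral => y _.
  rewrite /F'; congr F; apply: eq_from_tnth => i; rewrite !tnth_lcomb /u.
  by field; rewrite gt_eqF.
have hFt k : momfin N (fun y => F' y * (tnth y k : R)).
  by apply: momfinM => //; exact: momfin_tnth.
have hFg j k : momfin N (fun y => F' y * g j k y) by exact: momfinM.
have hFtilt : momfin N (fun y => F' y * tilt u y).
  by apply: momfinM => //; exact: momfin_tilt.
have -> : \int[N]_y (F' y * tilt u y) -
  (\int[N]_y F' y + \sum_(j < m) \int[N]_y (F' y * (tnth y j : R)) / v * (tnth h j : R) +
   \sum_(j < m) \sum_(k < m) \int[N]_y (F' y * g j k y) / (2 * v ^+ 2) *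
      ((tnth h j : R) * (tnth h k : R))) = \int[N]_y (F' y * tilt_rem u y).
  transitivity (\int[N]_y (F' y * tilt u y) -
    (\int[N]_y F' y + \int[N]_y (\sum_(j < m) ((tnth h j : R) / v) * (F' y * (tnth y j : R))) +
   \int[N]_y (\sum_(j < m) \sum_(k < m) ((tnth h j : R) * (tnth h k : R)) / (2 * v ^+ 2) *
      (F' y * g j k y)))).
    rewrite Ex_sum; last by move=> j; exact: momfinZ.
    rewrite Ex_sum; last by move=> j; apply: momfin_sum => k; exact: momfinZ.
    congr (_ - (_ + _ + _)).
      by apply: eq_bigr => j _; rewrite ExZ//; ring.
    apply: eq_bigr => j _; rewrite Ex_sum; last by move=> k; exact: momfinZ.
    by apply: eq_bigr => k _; rewrite ExZ//; ring.
  have h1 : momfin N (fun y => \sum_(j < m) ((tnth h j : R) / v) * (F' y * (tnth y j : R))).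
    by apply: momfin_sum => j; exact: momfinZ.
  have h2 : momfin N (fun y => \sum_(j < m) \sum_(k < m)
      ((tnth h j : R) * (tnth h k : R)) / (2 * v ^+ 2) * (F' y * g j k y)).
    by apply: momfin_sum => j; apply: momfin_sum => k; exact: momfinZ.
  rewrite -ExD// -ExD//; last exact: momfinD.
  rewrite -ExB//; last by apply: momfinD => //; exact: momfinD.
  apply: eq_Rintegral => y _; rewrite /tilt_rem.
  have -> : \sum_(j < m) (tnth h j : R) / v * (F' y * (tnth y j : R)) = F' y * dot_tuple u y.
    rewrite /dot_tuple mulr_sumr; apply: eq_bigr => j _.
    by rewrite tnth_lcomb; ring.
  have -> : \sum_(j < m) \sum_(k < m) (tnth h j : R) * (tnth h k : R) / (2 * v ^+ 2) *
       (F' y * g j k y) = F' y * (dot_tuple u y ^+ 2 / 2 - half_sq u).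
    have -> : F' y * (dot_tuple u y ^+ 2 / 2 - half_sq u) =
      \sum_(j < m) F' y * ((tnth u j : R) * (tnth y j : R) * dot_tuple u y / 2
        - (tnth u j : R) ^+ 2 / 2).
      by rewrite -mulr_sumr sumrB -!mulr_suml -/(dot_tuple u y) expr2.
    apply: eq_bigr => j _; rewrite /g.
    (* The diagonal correction in [g] is what produces [half_sq u]; it is split off as a sum whose
       only nonzero term is [k = j]. *)
    transitivity (\sum_(k < m) (F' y * ((tnth u j : R) * (tnth y j : R) * ((tnth u k : R) * (tnth y k : R)) / 2)
       - (if k == j then F' y * (tnth u j : R) ^+ 2 / 2 else 0))).
      apply: eq_bigr => k _; rewrite !tnth_lcomb eq_sym; have [->|kj] := eqVneq k j.
        by rewrite mulr1n; field; rewrite gt_eqF.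
      by rewrite mulr0n; field; rewrite gt_eqF.
    rewrite sumrB -big_mkcond big_pred1_eq -mulr_sumr -mulr_suml -mulr_sumr -/(dot_tuple u y).
    by ring.
  by ring.
apply: (@le_trans _ _ (M * \int[N]_y `|tilt_rem u y|)).
  have hr := @momfin_tilt_rem u.
  rewrite -ExZ; last exact: momfin_norm.
  apply: Ex_norm_le; [exact: momfinM|by apply: momfinZ; exact: momfin_norm|].
  by move=> y; rewrite normrM ler_wpM2r.
rewrite (mulrC _ M) -mulrA ler_wpM2l//.
apply: (le_trans (HC1 u)).
have s0 := l1_ge0 h; have u0 := l1_ge0 u.
have sV0 : 0 <= sg^-1 by rewrite invr_ge0 ltW.
have uX k : l1 u ^+ k <= sg^-1 ^+ k * l1 h ^+ k.
  by rewrite -exprMn lerXn2r ?nnegrE// mulr_ge0.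
have := uX 3; have := uX 6; set a3 := _ ^+ 3; set a6 := _ ^+ 6.
set b3 := sg^-1 ^+ 3; set b6 := sg^-1 ^+ 6; set c3 := l1 h ^+ 3; set c6 := l1 h ^+ 6.
have b30 : 0 <= b3 by exact: exprn_ge0.
have b60 : 0 <= b6 by exact: exprn_ge0.
have c30 : 0 <= c3 by exact: exprn_ge0.
have c60 : 0 <= c6 by exact: exprn_ge0.
move=> H6 H3; rewrite mulrDl; apply: ler_wpDr.
  by rewrite mulr_ge0 ?addr_ge0// mulr_ge0// exprn_ge0.
rewrite -mulrA ler_wpM2l// mulrDl !mulrDr.
have p1 := mulr_ge0 b30 c60; have p2 := mulr_ge0 b60 c30.
apply: (le_trans (lerD H3 H6)); lra.
Qed.

End taylor.

(** * Central limit theorem *)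

Section rect_unique.
Local Open Scope ereal_scope.
Context (R : realType) d1 d2 (T1 : measurableType d1) (T2 : measurableType d2).

Lemma rect_unique (m1 m2 : {measure set (T1 * T2) -> \bar R}) :
  m1 setT < +oo ->
  (forall A B, measurable A -> measurable B -> m1 (A `*` B) = m2 (A `*` B)) ->
  forall X, measurable X -> m1 X = m2 X.
Proof.
move=> fin1 H X mX.
pose C : set (set (T1 * T2)) :=
  [set C | exists2 A, measurable A & exists2 B, measurable B & A `*` B = C].
apply: (measure_unique C (fun=> setT)) => //.
- by rewrite measurable_prod_measurableType.
- move=> _ _ [A1 mA1 [B1 mB1 <-]] [A2 mA2 [B2 mB2 <-]].
  rewrite -setXI; exists (A1 `&` A2); first exact: measurableI.
  by exists (B1 `&` B2) => //; exact: measurableI.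
- by move=> n; exists setT => //; exists setT => //; rewrite setXTT.
- by rewrite bigcup_const.
- by move=> _ [A mA [B mB <-]]; exact: H.
Qed.

End rect_unique.

Section independent_pair.
Context (R : realType) d d1 d2 (T : measurableType d) (T1 : measurableType d1)
  (T2 : measurableType d2) (P : probability T R).
Variables (X1 : T -> T1) (X2 : T -> T2).
Hypotheses (mX1 : measurable_fun setT X1) (mX2 : measurable_fun setT X2).
Hypothesis indep : forall A B, measurable A -> measurable B ->
  P (X1 @^-1` A `&` X2 @^-1` B) = (P (X1 @^-1` A) * P (X2 @^-1` B))%E.

Lemma ge0_integral_indep (f : T1 * T2 -> \bar R) : measurable_fun setT f ->
  (forall x, 0 <= f x)%E ->
  (\int[P]_w f (X1 w, X2 w) = \int[P]_w \int[P]_w' f (X1 w, X2 w'))%E.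
Proof.
move=> mf f0.
pose Y1 : {mfun T >-> T1} := HB.pack X1 (isMeasurableFun.Build _ _ _ _ _ mX1).
pose Y2 : {mfun T >-> T2} := HB.pack X2 (isMeasurableFun.Build _ _ _ _ _ mX2).
have mX : measurable_fun setT (fun w => (X1 w, X2 w)) by exact: measurable_fun_pair.
pose Y : {mfun T >-> (T1 * T2)%type} :=
  HB.pack (fun w => (X1 w, X2 w)) (isMeasurableFun.Build _ _ _ _ _ mX).
pose P1 : probability T1 R := distribution P Y1.
pose P2 : probability T2 R := distribution P Y2.
transitivity (\int[distribution P Y]_z f z)%E.
  by rewrite ge0_integral_distribution.
transitivity (\int[(P1 \x P2)%E]_z f z)%E.
  apply: eq_measure_integral => A mA _.
  apply: rect_unique => //.
    exact: (le_lt_trans (probability_le1 (distribution P Y) measurableT) (ltry 1)).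
  move=> A1 A2 mA1 mA2; rewrite [RHS]product_measure1E//.
  by rewrite -[RHS]indep.
rewrite fubini_tonelli1//.
rewrite ge0_integral_distribution//; last 2 first.
- exact: measurable_fun_fubini_tonelli_F.
- by move=> x; exact: integral_ge0.
apply: eq_integral => w _ /=.
rewrite [LHS]ge0_integral_distribution//.
by apply: (measurableT_comp mf); exact: measurable_fun_pair.
Qed.

Lemma Ex_indep (f : T1 * T2 -> R) M : measurable_fun setT f ->
  (forall z, `|f z| <= M) ->
  \int[P]_w f (X1 w, X2 w) = \int[P]_w \int[P]_w' f (X1 w, X2 w').
Proof.
move=> mf fM.
have mX : measurable_fun setT (fun w => (X1 w, X2 w)) by exact: measurable_fun_pair.
have h1 : momfin P (fun w => f (X1 w, X2 w)).
  by apply: (@momfin_bounded _ _ _ _ _ M) => //; exact: (measurableT_comp mf mX).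
have h2 x : momfin P (fun w' => f (x, X2 w')).
  apply: (@momfin_bounded _ _ _ _ _ M) => //; apply: (measurableT_comp mf).
  exact: measurable_fun_pair.
have mfM : measurable_fun setT (fun z => (f z + M)%:E).
  by apply/measurable_EFinP; exact: measurable_funD.
have fM0 z : (0 <= (f z + M)%:E)%E.
  by rewrite lee_fin -lerBlDr sub0r; have := fM z; rewrite ler_norml => /andP[].
have m2 : measurable_fun setT (fun z : T1 * T => f (z.1, X2 z.2)).
  apply: (measurableT_comp mf); apply: measurable_fun_pair => //.
  exact: (measurableT_comp mX2).
have mp : measurable_fun setT (fun x => \int[P]_w' f (x, X2 w')).
  exact: (@measurable_Ex_param _ _ _ _ _ P (fun z : T1 * T => f (z.1, X2 z.2)) M).
have h3 : momfin P (fun w => \int[P]_w' f (X1 w, X2 w')).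
  apply: (@momfin_bounded _ _ _ _ _ M); first exact: (measurableT_comp mp mX1).
  by move=> w; apply: Ex_bounded => //; exact: momfin_measurable (h2 _).
have : \int[P]_w (f (X1 w, X2 w) + M) = \int[P]_w (\int[P]_w' f (X1 w, X2 w') + M).
  congr fine; apply: (etrans (ge0_integral_indep mfM fM0)).
  apply: eq_integral => w _; rewrite -[X in (_ + X)%:E](Ex_cst P) -ExD//; last exact: momfin_cst.
  rewrite /Rintegral fineK//.
  apply: (@integrable_fin_num _ _ _ P setT) => //.
  by apply: momfin_integrable; apply: momfinD => //; exact: momfin_cst.
by rewrite !ExD ?Ex_cst//; try exact: momfin_cst; move/addIr.
Qed.

Lemma Ex_indepM (f : T1 -> R) (g : T2 -> R) (M1 M2 : R) :
  measurable_fun setT f -> measurable_fun setT g ->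
  (forall w, `|f (X1 w)| <= M1) -> (forall w, `|g (X2 w)| <= M2) ->
  \int[P]_w (f (X1 w) * g (X2 w)) = \int[P]_w f (X1 w) * \int[P]_w g (X2 w).
Proof.
move=> mf mg fM gM.
(* [f] and [g] are bounded only along [X1] and [X2]; truncation makes them bounded everywhere, as
   [Ex_indep] asks, without changing the values taken. *)
pose clamp (M x : R) := Num.max (- `|M|) (Num.min `|M| x).
have clamp_le M x : `|clamp M x| <= `|M|.
  rewrite ler_norml le_max lexx/= ge_max ge_min lexx/= andbT.
  by rewrite (le_trans (_ : _ <= 0))// oppr_le0.
have clampE M x : `|x| <= M -> clamp M x = x.
  move=> xM; have M0 : 0 <= M by exact: le_trans xM.
  rewrite /clamp (ger0_norm M0); move: xM; rewrite ler_norml => /andP[h1 h2].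
  by rewrite (min_idPr h2) (max_idPr h1).
have mclamp M d' (S : measurableType d') (h : S -> R) :
    measurable_fun setT h -> measurable_fun setT (fun x => clamp M (h x)).
  by move=> mh; apply: measurable_maxr => //; exact: measurable_minr.
have hg : momfin P (fun w => g (X2 w)).
  by apply: (@momfin_bounded _ _ _ _ _ M2) => //; exact: (measurableT_comp mg).
have hf : momfin P (fun w => f (X1 w)).
  by apply: (@momfin_bounded _ _ _ _ _ M1) => //; exact: (measurableT_comp mf).
transitivity (\int[P]_w (clamp M1 (f (X1 w)) * clamp M2 (g (X2 w)))).
  by apply: eq_Rintegral => w _; rewrite !clampE.
rewrite (@Ex_indep (fun z => clamp M1 (f z.1) * clamp M2 (g z.2)) (`|M1| * `|M2|)); last 2 first.
- by apply: measurable_funM; apply: mclamp;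
    [exact: (measurableT_comp mf)|exact: (measurableT_comp mg)].
- by move=> z; rewrite normrM ler_pM.
rewrite mulrC -ExZ//; apply: eq_Rintegral => w _ /=.
rewrite clampE// mulrC -ExZ//; apply: eq_Rintegral => w' _.
by rewrite clampE.
Qed.

End independent_pair.

(** * Partial sums of independent vectors *)

Section partial_sums.
Context (R : realType) d (T : measurableType d) (P : probability T R).
Local Notation RB := (measurableTypeR R).
Variables (m n : nat) (Y : nat -> T -> m.-tuple RB).
Hypothesis mY : forall i, measurable_fun setT (Y i).
Hypothesis indY : forall (J : {set 'I_n}) (B : 'I_n -> set (m.-tuple RB)),
  (forall i, measurable (B i)) ->
  P (\bigcap_(i in [set i | i \in J]) (Y i @^-1` B i)) =
  (\prod_(i in J) P (Y i @^-1` B i))%E.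

Fixpoint psum (k : nat) (w : T) : m.-tuple RB :=
  if k is k'.+1 then lcomb 1 1 (psum k' w) (Y k' w) else [tuple (0 : RB) | i < m].

Lemma measurable_psum k : measurable_fun setT (psum k).
Proof.
by elim: k => [|k IH]; [exact: measurable_cst|exact: measurable_lcomb].
Qed.

Lemma tnth_psum k w i : (tnth (psum k w) i : R) = \sum_(j < k) (tnth (Y j w) i : R).
Proof.
elim: k => [|k IH]; first by rewrite big_ord0 tnth_mktuple.
by rewrite big_ord_recr/= tnth_lcomb IH !mul1r.
Qed.

Let tail (k : nat) (B : nat -> set (m.-tuple RB)) : set T :=
  \bigcap_(i in [set i | (k <= i < n)%N]) (Y i @^-1` B i).

Let measurable_tail k B : (forall i, measurable (B i)) -> measurable (tail k B).
Proof.
move=> mB; apply: bigcap_measurableType => i _.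
by rewrite -[X in measurable X]setTI; exact: mY.
Qed.

Let tailS k B : (k < n)%N -> tail k B = Y k @^-1` B k `&` tail k.+1 B.
Proof.
move=> kn; apply/seteqP; split => w.
  move=> H; split; first by apply: H; rewrite /= leqnn.
  by move=> i /= /andP[ki i_n]; apply: H; rewrite /= (ltnW ki).
move=> [Hk H] i /= /andP[]; rewrite leq_eqVlt => /orP[/eqP <- //|ki i_n].
by apply: H; rewrite /= ki.
Qed.

(** The induction carries the whole remaining tail and not only the next term: [psum k.+1] depends
    on the pair formed by [psum k] and [Y k], whose joint law has to be factored against all that
    follows. *)
Let psum_tail k : (k <= n)%N -> forall A B, measurable A -> (forall i, measurable (B i)) ->
  P (psum k @^-1` A `&` tail k B) =
  (P (psum k @^-1` A) * \prod_(k <= i < n) P (Y i @^-1` B i))%E.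
Proof.
elim: k => [_|k IH kn] A B mA mB.
  have -> : psum 0 @^-1` A = if [tuple (0 : RB) | i < m] \in A then setT else set0.
    by case: ifPn => [/set_mem|/negP] H; apply/seteqP; split => w //= ?; apply: H; exact: mem_set.
  case: ifPn => _; last by rewrite set0I measure0 mul0e.
  rewrite setTI probability_setT mul1e big_mkord.
  have := @indY [set: 'I_n]%SET (fun i => B i) (fun i => mB i).
  have -> : \bigcap_(i in [set i | i \in [set: 'I_n]%SET]) (Y i @^-1` B i) = tail 0 B.
    apply/seteqP; split => w H i /=.
      by move=> i_n; apply: (H (Ordinal i_n)); rewrite /= inE.
    by move=> _; apply: H; rewrite /=.
  by move=> ->; apply: eq_bigl => i; rewrite inE.
have mk : measurable_fun setT (fun w => (psum k w, Y k w)).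
  by apply: measurable_fun_pair => //; exact: measurable_psum.
pose q (C : nat -> set (m.-tuple RB)) := (\prod_(k.+1 <= i < n) P (Y i @^-1` C i))%E.
have q0 C : (0 <= q C)%E by apply: prode_ge0.
have mYi i C : measurable C -> measurable (Y i @^-1` C).
  by move=> mC; rewrite -[X in measurable X]setTI; exact: mY.
have qfin C : (forall i, measurable (C i)) -> q C \is a fin_num.
  move=> mC; rewrite /q; elim/big_ind : _ => [//|x y ? ?|i _]; first by rewrite fin_numM.
  by apply: fin_num_measure; exact: mYi.
(* The induction hypothesis for the tail starting at [k], with [A2] put at index [k]. *)
have rect A1 A2 C : measurable A1 -> measurable A2 -> (forall i, measurable (C i)) ->
   P ((psum k @^-1` A1 `&` Y k @^-1` A2) `&` tail k.+1 C) =
   (q C * (P (psum k @^-1` A1) * P (Y k @^-1` A2)))%E.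
  move=> mA1 mA2 mC.
  have := IH (ltnW kn) A1 (fun i => if i == k then A2 else C i) mA1.
  rewrite tailS// eqxx big_ltn// eqxx => H.
  have {H} := H _; rewrite (_ : tail k.+1 _ = tail k.+1 C); last first.
    apply/seteqP; split => w H i /= /andP[ki i_n]; have := H i; rewrite /= ki i_n gtn_eqF//;
      by apply.
  rewrite setIA => ->; last by move=> i; case: ifP.
  rewrite [RHS]muleC muleA; congr (_ * _)%E; apply: eq_big_nat => i /andP[ki _].
  by rewrite gtn_eqF.
pose Y1 : {mfun T >-> (m.-tuple RB)} :=
  HB.pack (psum k) (isMeasurableFun.Build _ _ _ _ _ (measurable_psum k)).
pose Y2 : {mfun T >-> (m.-tuple RB)} := HB.pack (Y k) (isMeasurableFun.Build _ _ _ _ _ (mY k)).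
pose P12 : {measure set (m.-tuple RB * m.-tuple RB) -> \bar R} :=
  (distribution P Y1 \x distribution P Y2)%E.
have P12E A1 A2 : measurable A1 -> measurable A2 ->
    P12 (A1 `*` A2) = (P (psum k @^-1` A1) * P (Y k @^-1` A2))%E.
  by move=> mA1 mA2; exact: product_measure1E.
(* Both sides are finite measures in [X]: the law of the pair restricted to the tail event, and the
   product law scaled by [q C]. Agreement on rectangles suffices. *)
have main C X : (forall i, measurable (C i)) -> measurable X ->
    P ((fun w => (psum k w, Y k w)) @^-1` X `&` tail k.+1 C) = (q C * P12 X)%E.
  move=> mC mX.
  have qC0 : 0 <= fine (q C) by exact: fine_ge0.
  pose m1 := measure_function_pushforward__canonical__measure_function_Measure
    (mrestr P (measurable_tail k.+1 mC)) mk.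
  pose m2 := mscale (NngNum qC0) P12.
  transitivity (m1 X); first by [].
  transitivity (m2 X); last first.
    by rewrite -[in RHS](fineK (qfin _ mC)).
  apply: rect_unique => //.
    have -> : m1 setT = P (setT `&` tail k.+1 C) by [].
    by rewrite setTI (le_lt_trans (probability_le1 P (measurable_tail k.+1 mC)))// ltry.
  move=> A1 A2 mA1 mA2; transitivity (q C * P12 (A1 `*` A2))%E.
    by rewrite P12E// -rect.
  by rewrite -[in LHS](fineK (qfin _ mC)).
have mlc : measurable_fun setT (fun z : m.-tuple RB * m.-tuple RB => lcomb 1 1 z.1 z.2).
  exact: measurable_lcomb.
have mAA : measurable ((fun z : m.-tuple RB * m.-tuple RB => lcomb 1 1 z.1 z.2) @^-1` A).
  by rewrite -[X in measurable X]setTI; exact: mlc.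
(* The trivial tail identifies the [P12]-mass of the event with the probability that [psum k.+1]
   lies in [A]. *)
have := main B _ mB mAA.
have := main (fun=> setT) _ (fun=> measurableT) mAA.
rewrite (_ : tail k.+1 (fun=> setT) = setT); last by apply/seteqP; split.
rewrite setIT (_ : q (fun=> setT) = 1%E); last first.
  by rewrite /q big1// => i _; rewrite preimage_setT probability_setT.
rewrite mul1e => <- H; rewrite [RHS]muleC; exact: H.
Qed.

Lemma psum_indep k A B : (k < n)%N -> measurable A -> measurable B ->
  P (psum k @^-1` A `&` Y k @^-1` B) = (P (psum k @^-1` A) * P (Y k @^-1` B))%E.
Proof.
move=> kn mA mB.
have := @psum_tail k (ltnW kn) A (fun i => if i == k then B else setT) mA.
rewrite tailS// eqxx big_ltn// eqxx big_nat_cond big1; last first.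
  by move=> i /andP[/andP[ki _] _]; rewrite gtn_eqF// preimage_setT probability_setT.
rewrite mule1 (_ : tail k.+1 _ = setT) ?setIT.
  by move=> H; apply: H => i; case: ifP.
by apply/seteqP; split => // w _ i /= /andP[ki _]; rewrite gtn_eqF.
Qed.

(** The second moments [q i] may vary with the index: for the squared axial coordinates they are
    only bounded, not computed. *)
Lemma psum_moments j (c be : R) (q : nat -> R) :
  (forall i, (i < n)%N -> forall w, `|tnth (Y i w) j : R| <= c) ->
  (forall i, (i < n)%N -> \int[P]_w (tnth (Y i w) j : R) = be) ->
  (forall i, (i < n)%N -> \int[P]_w ((tnth (Y i w) j : R) ^+ 2) = q i) ->
  forall k, (k <= n)%N -> [/\ forall w, `|tnth (psum k w) j : R| <= k%:R * c,
    \int[P]_w (tnth (psum k w) j : R) = k%:R * be &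
    \int[P]_w ((tnth (psum k w) j : R) ^+ 2) = \sum_(i < k) (q i - be ^+ 2) + (k%:R * be) ^+ 2].
Proof.
move=> Yc Ybe Yq; elim => [|k IH] kn.
  split; first by move=> w; rewrite tnth_mktuple normr0 mul0r.
    by rewrite mul0r -[RHS](Ex_cst P); apply: eq_Rintegral => w _; rewrite tnth_mktuple.
  rewrite big_ord0 !mul0r expr0n addr0 -[RHS](Ex_cst P).
  by apply: eq_Rintegral => w _; rewrite tnth_mktuple expr0n.
have [Sk Ek Vk] := IH (ltnW kn).
have mt i (f : T -> m.-tuple RB) : measurable_fun setT f ->
    measurable_fun setT (fun w => tnth (f w) i : R).
  by move=> mf; exact: (measurableT_comp (measurable_tnth i) mf).
have hS : momfin P (fun w => tnth (psum k w) j : R).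
  apply: (@momfin_bounded _ _ _ _ _ (k%:R * c)) => //.
  exact: mt (measurable_psum k).
have hY : momfin P (fun w => tnth (Y k w) j : R).
  by apply: (@momfin_bounded _ _ _ _ _ c) => //; [exact: mt|exact: Yc].
split.
- move=> w; rewrite tnth_lcomb !mul1r (le_trans (ler_normD _ _))// -natr1 mulrDl mul1r.
  by rewrite lerD// Yc.
- transitivity (\int[P]_w ((tnth (psum k w) j : R) + (tnth (Y k w) j : R))).
    by apply: eq_Rintegral => w _; rewrite tnth_lcomb !mul1r.
  by rewrite ExD// Ek Ybe// -natr1; ring.
- transitivity (\int[P]_w ((tnth (psum k w) j : R) ^+ 2 +
      (2 * ((tnth (psum k w) j : R) * (tnth (Y k w) j : R)) + (tnth (Y k w) j : R) ^+ 2))).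
    by apply: eq_Rintegral => w _; rewrite tnth_lcomb; ring.
  have h2 : momfin P (fun w => (tnth (psum k w) j : R) * (tnth (Y k w) j : R)) by exact: momfinM.
  rewrite ExD; [|exact: momfinX|apply: momfinD; [exact: momfinZ|exact: momfinX]].
  rewrite ExD; [|exact: momfinZ|exact: momfinX].
  rewrite ExZ// Vk Yq//.
  have -> : \int[P]_w ((tnth (psum k w) j : R) * (tnth (Y k w) j : R)) = k%:R * be * be.
    have ind2 A B : measurable A -> measurable B ->
      P (psum k @^-1` A `&` Y k @^-1` B) = (P (psum k @^-1` A) * P (Y k @^-1` B))%E.
      exact: psum_indep.
    have H := @Ex_indepM _ _ _ _ _ _ _ P (psum k) (Y k) (measurable_psum k) (mY k) ind2
      (fun s => tnth s j : R) (fun s => tnth s j : R) (k%:R * c) c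
      (measurable_tnth j) (measurable_tnth j) Sk (Yc k kn).
    by rewrite H Ek Ybe.
  by rewrite big_ord_recr /= -natr1; ring.
Qed.

End partial_sums.

(** * Lindeberg replacement *)

Section swap.
Context (R : realType) (m : nat).
Local Notation RB := (measurableTypeR R).
Local Notation N := (@std_normal_vec R m).
Implicit Types (h y z b : m.-tuple RB) (F : m.-tuple RB -> R).

Definition gsmooth (v : R) F h : R := \int[N]_y F (lcomb v 1 y h).

Lemma measurable_gsmooth v F M : measurable_fun setT F -> (forall x, `|F x| <= M) ->
  measurable_fun setT (gsmooth v F).
Proof.
move=> mF FM.
apply: (@measurable_Ex_param _ _ _ _ _ N (fun z : m.-tuple RB * m.-tuple RB =>
  F (lcomb v 1 z.2 z.1)) M) => //.
by apply: (measurableT_comp mF); exact: measurable_lcomb.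
Qed.

Lemma gsmooth_bounded v F M : measurable_fun setT F -> (forall x, `|F x| <= M) ->
  forall h, `|gsmooth v F h| <= M.
Proof.
move=> mF FM h; apply: Ex_bounded => //.
by apply: (measurableT_comp mF); exact: measurable_lcomb.
Qed.

Lemma gauss_semigroupR (a b c : R) F M :
  0 < a -> 0 < b -> 0 < c -> c ^+ 2 = a ^+ 2 + b ^+ 2 ->
  measurable_fun setT F -> (forall x, `|F x| <= M) ->
  \int[N]_z \int[N]_y F (lcomb a b y z) = \int[N]_y F (lcomb c 0 y y).
Proof.
move=> a0 b0 c0 cab mF FM.
have mab z : measurable_fun setT (fun y => F (lcomb a b y z)).
  by apply: (measurableT_comp mF); exact: measurable_lcomb.
have mcc : measurable_fun setT (fun y => F (lcomb c 0 y y)).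
  by apply: (measurableT_comp mF); exact: measurable_lcomb.
have h1 z : momfin N (fun y => F (lcomb a b y z)) by apply: (@momfin_bounded _ _ _ _ _ M).
have h2 : momfin N (fun y => F (lcomb c 0 y y)) by apply: (@momfin_bounded _ _ _ _ _ M).
have h3 : momfin N (fun z => \int[N]_y F (lcomb a b y z)).
  apply: (@momfin_bounded _ _ _ _ _ M).
    apply: (@measurable_Ex_param _ _ _ _ _ N (fun z : m.-tuple RB * m.-tuple RB =>
      F (lcomb a b z.2 z.1)) M) => //.
    by apply: (measurableT_comp mF); exact: measurable_lcomb.
  by move=> z; exact: Ex_bounded.
have hM := @momfin_cst _ _ R N M.
have mFM : measurable_fun setT (fun z => (F z + M)%:E).
  by apply/measurable_EFinP; exact: measurable_funD.
have FM0 z : (0 <= (F z + M)%:E)%E.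
  by rewrite lee_fin -lerBlDr sub0r; have := FM z; rewrite ler_norml => /andP[].
have : \int[N]_z (\int[N]_y F (lcomb a b y z) + M) = \int[N]_y (F (lcomb c 0 y y) + M).
  congr fine; rewrite -(gauss_semigroup a0 b0 c0 cab mFM FM0).
  apply: eq_integral => z _; rewrite -[X in (_ + X)%:E](Ex_cst N) -ExD//.
  rewrite /Rintegral fineK//; apply: (@integrable_fin_num _ _ _ N setT) => //.
  by apply: momfin_integrable; apply: momfinD.
by rewrite !ExD// Ex_cst; move/addIr.
Qed.

Lemma moment_expansion d (T : measurableType d) (P : probability T R)
    (Y : T -> m.-tuple RB) (F : m.-tuple RB -> R) (A0 : R) (A : 'I_m -> R)
    (B : 'I_m -> 'I_m -> R) (K M : R) :
  measurable_fun setT Y -> (forall j, momfin P (fun w => tnth (Y w) j : R)) ->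
  measurable_fun setT F -> (forall x, `|F x| <= M) ->
  (forall h, `|F h - (A0 + \sum_(j < m) A j * (tnth h j : R) +
       \sum_(j < m) \sum_(k < m) B j k * ((tnth h j : R) * (tnth h k : R)))| <=
      K * (l1 h ^+ 3 + l1 h ^+ 6)) ->
  `|\int[P]_w F (Y w) - (A0 + \sum_(j < m) A j * \int[P]_w (tnth (Y w) j : R) +
       \sum_(j < m) \sum_(k < m) B j k *
          \int[P]_w ((tnth (Y w) j : R) * (tnth (Y w) k : R)))| <=
  K * (\int[P]_w (l1 (Y w) ^+ 3) + \int[P]_w (l1 (Y w) ^+ 6)).
Proof.
move=> mY hY mF FM H.
have hl1 : momfin P (fun w => l1 (Y w)).
  by apply: momfin_sum => i; exact: momfin_norm.
have hF : momfin P (fun w => F (Y w)).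
  by apply: (@momfin_bounded _ _ _ _ _ M) => //; exact: (measurableT_comp mF).
have hYY j k : momfin P (fun w => (tnth (Y w) j : R) * (tnth (Y w) k : R)).
  exact: momfinM.
have hl k : momfin P (fun w => l1 (Y w) ^+ k) by exact: momfinX.
have h1 : momfin P (fun w => \sum_(j < m) A j * (tnth (Y w) j : R)).
  by apply: momfin_sum => j; exact: momfinZ.
have h2 : momfin P (fun w => \sum_(j < m) \sum_(k < m) B j k *
     ((tnth (Y w) j : R) * (tnth (Y w) k : R))).
  by apply: momfin_sum => j; apply: momfin_sum => k; exact: momfinZ.
have hA := @momfin_cst _ _ R P A0.
rewrite -ExD// -ExZ; last exact: momfinD.
have -> : A0 + \sum_(j < m) A j * \int[P]_w (tnth (Y w) j : R) +
       \sum_(j < m) \sum_(k < m) B j k *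
          \int[P]_w ((tnth (Y w) j : R) * (tnth (Y w) k : R)) =
  \int[P]_w (A0 + \sum_(j < m) A j * (tnth (Y w) j : R) +
       \sum_(j < m) \sum_(k < m) B j k * ((tnth (Y w) j : R) * (tnth (Y w) k : R))).
  rewrite ExD//; last exact: momfinD.
  rewrite ExD// Ex_cst; congr (_ + _ + _).
    rewrite Ex_sum; last by move=> j; exact: momfinZ.
    by apply: eq_bigr => j _; rewrite ExZ.
  rewrite Ex_sum; last by move=> j; apply: momfin_sum => k; exact: momfinZ.
  apply: eq_bigr => j _; rewrite Ex_sum; last by move=> k; exact: momfinZ.
  by apply: eq_bigr => k _; rewrite ExZ.
rewrite -ExB//; last by apply: momfinD => //; exact: momfinD.
apply: Ex_norm_le.
- by apply: momfinB => //; apply: momfinD => //; exact: momfinD.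
- by apply: momfinZ; exact: momfinD.
- by move=> w; exact: H.
Qed.

Lemma sixth_le (x y : R) : 0 <= x -> 0 <= y -> (x + y) ^+ 6 <= 32 * (x ^+ 6 + y ^+ 6).
Proof.
move=> x0 y0; have H := cube_le x0 y0.
have -> : (x + y) ^+ 6 = ((x + y) ^+ 3) ^+ 2 by rewrite -exprM.
have : ((x + y) ^+ 3) ^+ 2 <= (4 * (x ^+ 3 + y ^+ 3)) ^+ 2.
  rewrite lerXn2r ?nnegrE// ?exprn_ge0 ?addr_ge0//.
  by rewrite mulr_ge0// addr_ge0// exprn_ge0.
move/le_trans; apply.
rewrite -subr_ge0.
have -> : 32 * (x ^+ 6 + y ^+ 6) - (4 * (x ^+ 3 + y ^+ 3)) ^+ 2 =
  16 * (x ^+ 3 - y ^+ 3) ^+ 2 by ring.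
by rewrite mulr_ge0// sqr_ge0.
Qed.

(** Both integrals are expanded by [gauss_taylor] with the same coefficients. The first-order terms
    agree because the means do, and the quadratic ones differ by at most [C * M * ep]. *)
Lemma gsmooth_swap (sg : R) : 0 < sg -> exists2 C : R, 0 <= C &
  forall F (M v : R), measurable_fun setT F -> (forall x, `|F x| <= M) -> sg <= v ->
  forall d (T : measurableType d) (P : probability T R) (Y : T -> m.-tuple RB)
    (b : m.-tuple RB) (c be ep : R),
  measurable_fun setT Y -> (forall w, l1 (Y w) <= c) -> 0 <= be ->
  (forall j, \int[P]_w (tnth (Y w) j : R) = tnth b j) ->
  \sum_(j < m) \sum_(k < m) `|\int[P]_w ((tnth (Y w) j : R) * (tnth (Y w) k : R))
     - (tnth b j : R) * (tnth b k : R) - be ^+ 2 * (j == k)%:R| <= ep ->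
  `|\int[P]_w gsmooth v F (Y w) - \int[N]_z gsmooth v F (lcomb be 1 z b)| <=
  C * M * (ep + (c ^+ 3 + c ^+ 6) + (be ^+ 3 + be ^+ 6)).
Proof.
move=> sg0; have [C C0 HC] := gauss_taylor m sg0.
pose G3 := \int[N]_z (l1 z ^+ 3); pose G6 := \int[N]_z (l1 z ^+ 6).
have hl1 := @momfin_l1 R m.
have G30 : 0 <= G3 by apply: Rintegral_ge0 => z _; rewrite exprn_ge0// l1_ge0.
have G60 : 0 <= G6 by apply: Rintegral_ge0 => z _; rewrite exprn_ge0// l1_ge0.
(* The factors 4 and 32 of [cube_le] and [sixth_le], both taken as 32, come from the Gaussian side;
   the side of [Y] adds 1. *)
exists (C * (33 + 32 * G3 + 32 * G6)).
  by rewrite mulr_ge0// !addr_ge0// mulr_ge0.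
move=> F M v mF FM sgv d T P Y b c be ep mY Yc be0 Yb Yep.
have [A0 [A [B [HB HH]]]] := HC F M v mF FM sgv.
have M0 : 0 <= M by exact: le_trans (FM [tuple (0 : RB) | i < m]).
have c0 : 0 <= c by exact: le_trans (l1_ge0 _) (Yc point).
have hYj j : momfin P (fun w => tnth (Y w) j : R).
  apply: (@momfin_bounded _ _ _ _ _ c).
    exact: (measurableT_comp (measurable_tnth j) mY).
  by move=> w; exact: le_trans (le_tnth_l1 _ _) (Yc w).
have hl1Y : momfin P (fun w => l1 (Y w)) by apply: momfin_sum => i; exact: momfin_norm.
have bc : l1 b <= c.
  rewrite /l1; apply: (@le_trans _ _ (\int[P]_w l1 (Y w))).
    rewrite Ex_sum; last by move=> j; exact: momfin_norm.
    by apply: ler_sum => j _; rewrite -Yb; exact: Ex_norm.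
  by rewrite -[leRHS](Ex_cst P); apply: Ex_le => //; exact: momfin_cst.
pose Z z := lcomb be 1 z b.
have hZj j : momfin N (fun z => tnth (Z z) j : R).
  rewrite (_ : (fun z => _) = fun z => be * (tnth z j : R) + 1 * (tnth b j : R)).
    by apply: momfinD; [apply: momfinZ; exact: momfin_tnth|exact: momfin_cst].
  by apply/funext => z; rewrite tnth_lcomb.
have mZ : measurable_fun setT Z by exact: measurable_lcomb.
have mG := measurable_gsmooth v mF FM.
have GM := gsmooth_bounded v mF FM.
have E1 := moment_expansion mY hYj mG GM HH.
have E2 := moment_expansion mZ hZj mG GM HH.
have Zb j : \int[N]_z (tnth (Z z) j : R) = tnth b j.
  transitivity (\int[N]_z (be * (tnth z j : R) + 1 * (tnth b j : R))).
    by apply: eq_Rintegral => z _; rewrite tnth_lcomb.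
  rewrite ExD; [|by apply: momfinZ; exact: momfin_tnth|exact: momfin_cst].
  rewrite ExZ; last exact: momfin_tnth.
  by rewrite gauss_mean mulr0 add0r Ex_cst mul1r.
have ZZ j k : \int[N]_z ((tnth (Z z) j : R) * (tnth (Z z) k : R)) =
   (tnth b j : R) * (tnth b k : R) + be ^+ 2 * (j == k)%:R.
  transitivity (\int[N]_z (be ^+ 2 * ((tnth z j : R) * (tnth z k : R)) +
     (be * (tnth b k : R) * (tnth z j : R) + be * (tnth b j : R) * (tnth z k : R))
     + (tnth b j : R) * (tnth b k : R))).
    by apply: eq_Rintegral => z _; rewrite !tnth_lcomb; ring.
  have ht i : momfin N (fun z => tnth z i : R) by exact: momfin_tnth.
  have hc (a : R) := @momfin_cst _ _ R N a.
  have h1 : momfin N (fun z => be ^+ 2 * ((tnth z j : R) * (tnth z k : R))).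
    by apply: momfinZ; exact: momfinM.
  have h2 : momfin N (fun z => be * (tnth b k : R) * (tnth z j : R) + be * (tnth b j : R) * (tnth z k : R)).
    by apply: momfinD; exact: momfinZ.
  rewrite ExD//; last exact: momfinD.
  rewrite ExD// ExZ; last exact: momfinM.
  rewrite ExD; [|exact: momfinZ|exact: momfinZ].
  by rewrite !ExZ// !gauss_mean gauss_cov Ex_cst; ring.
pose SY := \sum_(j < m) A j * (tnth b j : R).
pose QY := \sum_(j < m) \sum_(k < m) B j k * \int[P]_w ((tnth (Y w) j : R) * (tnth (Y w) k : R)).
pose QZ := \sum_(j < m) \sum_(k < m) B j k * \int[N]_z ((tnth (Z z) j : R) * (tnth (Z z) k : R)).
have {}E1 : `|\int[P]_w gsmooth v F (Y w) - (A0 + SY + QY)| <= C * M * (c ^+ 3 + c ^+ 6).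
  move: E1; under eq_bigr do rewrite Yb; move/le_trans; apply.
  have cX k : \int[P]_w (l1 (Y w) ^+ k) <= c ^+ k.
    rewrite -[leRHS](Ex_cst P); apply: Ex_le; [exact: momfinX|exact: momfin_cst|].
    by move=> w; rewrite lerXn2r ?nnegrE// l1_ge0.
  by rewrite ler_wpM2l ?mulr_ge0// lerD.
have {}E2 : `|\int[N]_z gsmooth v F (Z z) - (A0 + SY + QZ)| <=
    C * M * (32 * (be ^+ 3 * G3 + be ^+ 6 * G6 + c ^+ 3 + c ^+ 6)).
  move: E2; under eq_bigr do rewrite Zb; move/le_trans; apply.
  rewrite ler_wpM2l ?mulr_ge0//.
  have lZ z : l1 (Z z) <= be * l1 z + c.
    apply: (le_trans (l1_lcomb _ _ _ _)); rewrite normr1 mul1r ger0_norm//.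
    by rewrite lerD2l.
  have hlZ : momfin N (fun z => l1 (Z z)) by apply: momfin_sum => i; exact: momfin_norm.
  have I3 : \int[N]_z (l1 (Z z) ^+ 3) <= 4 * (be ^+ 3 * G3 + c ^+ 3).
    apply: (@le_trans _ _ (\int[N]_z (4 * (be ^+ 3 * l1 z ^+ 3 + c ^+ 3)))).
      apply: Ex_le; first exact: momfinX.
        by apply: momfinZ; apply: momfinD; [apply: momfinZ; exact: momfinX|exact: momfin_cst].
      move=> z; have l0 := l1_ge0 z; rewrite -exprMn.
      apply: le_trans (cube_le _ c0); last by rewrite mulr_ge0.
      by rewrite lerXn2r ?nnegrE ?l1_ge0// addr_ge0// mulr_ge0.
    rewrite ExZ; last by apply: momfinD; [apply: momfinZ; exact: momfinX|exact: momfin_cst].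
    rewrite ExD; [|apply: momfinZ; exact: momfinX|exact: momfin_cst].
    by rewrite ExZ ?Ex_cst//; exact: momfinX.
  have I6 : \int[N]_z (l1 (Z z) ^+ 6) <= 32 * (be ^+ 6 * G6 + c ^+ 6).
    apply: (@le_trans _ _ (\int[N]_z (32 * (be ^+ 6 * l1 z ^+ 6 + c ^+ 6)))).
      apply: Ex_le; first exact: momfinX.
        by apply: momfinZ; apply: momfinD; [apply: momfinZ; exact: momfinX|exact: momfin_cst].
      move=> z; have l0 := l1_ge0 z; rewrite -exprMn.
      apply: le_trans (sixth_le _ c0); last by rewrite mulr_ge0.
      by rewrite lerXn2r ?nnegrE ?l1_ge0// addr_ge0// mulr_ge0.
    rewrite ExZ; last by apply: momfinD; [apply: momfinZ; exact: momfinX|exact: momfin_cst].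
    rewrite ExD; [|apply: momfinZ; exact: momfinX|exact: momfin_cst].
    by rewrite ExZ ?Ex_cst//; exact: momfinX.
  have p1 : 0 <= be ^+ 3 * G3 by rewrite mulr_ge0// exprn_ge0.
  have p2 : 0 <= c ^+ 3 by exact: exprn_ge0.
  apply: (le_trans (lerD I3 I6)); lra.
have E3 : `|QY - QZ| <= C * M * ep.
  apply: (@le_trans _ _ (\sum_(j < m) \sum_(k < m) C * M *
     `|\int[P]_w ((tnth (Y w) j : R) * (tnth (Y w) k : R))
     - (tnth b j : R) * (tnth b k : R) - be ^+ 2 * (j == k)%:R|)); last first.
    under eq_bigr do rewrite -mulr_sumr; rewrite -mulr_sumr.
    by rewrite ler_wpM2l// mulr_ge0.
  rewrite /QY /QZ -sumrB (le_trans (ler_norm_sum _ _ _))//; apply: ler_sum => j _.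
  rewrite -sumrB (le_trans (ler_norm_sum _ _ _))//; apply: ler_sum => k _.
  by rewrite -mulrBr ZZ opprD addrA normrM ler_wpM2r.
have p1 : 0 <= be ^+ 3 by exact: exprn_ge0.
have p2 : 0 <= be ^+ 6 by exact: exprn_ge0.
have p3 : 0 <= c ^+ 3 by exact: exprn_ge0.
have p4 : 0 <= c ^+ 6 by exact: exprn_ge0.
have ep0 : 0 <= ep.
  by apply: le_trans Yep; apply: sumr_ge0 => j _; exact: sumr_ge0.
have -> : \int[P]_w gsmooth v F (Y w) - \int[N]_z gsmooth v F (Z z) =
  (\int[P]_w gsmooth v F (Y w) - (A0 + SY + QY)) -
  (\int[N]_z gsmooth v F (Z z) - (A0 + SY + QZ)) + (QY - QZ) by ring.
apply: (le_trans (ler_normD _ _)).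
apply: (le_trans (lerD (le_trans (ler_normB _ _) (lerD E1 E2)) E3)).
have -> : C * (33 + 32 * G3 + 32 * G6) * M * (ep + (c ^+ 3 + c ^+ 6) + (be ^+ 3 + be ^+ 6)) =
   C * M * ((33 + 32 * G3 + 32 * G6) * (ep + (c ^+ 3 + c ^+ 6) + (be ^+ 3 + be ^+ 6))) by ring.
rewrite -mulrDr -mulrDr ler_wpM2l ?mulr_ge0//.
set b3 := be ^+ 3 in p1 *; set b6 := be ^+ 6 in p2 *.
set c3 := c ^+ 3 in p3 *; set c6 := c ^+ 6 in p4 *.
rewrite -subr_ge0.
have -> : (33 + 32 * G3 + 32 * G6) * (ep + (c3 + c6) + (b3 + b6)) -
 (c3 + c6 + 32 * (b3 * G3 + b6 * G6 + c3 + c6) + ep) =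
 32 * ep + 33 * b3 + 33 * b6 + 32 * (G3 * (ep + c3 + c6 + b6) + G6 * (ep + c3 + c6 + b3)) by ring.
by rewrite !addr_ge0// ?mulr_ge0// !addr_ge0// mulr_ge0// !addr_ge0.
Qed.

(* Lindeberg replacement, one summand at a time; by [gauss_semigroupR] the Gaussian
   summands already substituted only increase the smoothing parameter, which hence
   stays at least [sg]. *)
Lemma lindeberg (sg : R) : 0 < sg -> exists2 C : R, 0 <= C &
  forall (f : m.-tuple RB -> R) (M : R), measurable_fun setT f -> (forall x, `|f x| <= M) ->
  forall d (T : measurableType d) (P : probability T R) (n : nat)
    (Y : nat -> T -> m.-tuple RB) (b : m.-tuple RB) (c be ep : R),
  (forall i, measurable_fun setT (Y i)) ->
  (forall (J : {set 'I_n}) (B : 'I_n -> set (m.-tuple RB)),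
    (forall i, measurable (B i)) ->
    P (\bigcap_(i in [set i | i \in J]) (Y i @^-1` B i)) =
    (\prod_(i in J) P (Y i @^-1` B i))%E) ->
  (forall i, (i < n)%N -> forall w, l1 (Y i w) <= c) -> 0 < be ->
  (forall i, (i < n)%N -> forall j, \int[P]_w (tnth (Y i w) j : R) = tnth b j) ->
  (forall i, (i < n)%N ->
    \sum_(j < m) \sum_(k < m) `|\int[P]_w ((tnth (Y i w) j : R) * (tnth (Y i w) k : R))
     - (tnth b j : R) * (tnth b k : R) - be ^+ 2 * (j == k)%:R| <= ep) ->
  `|\int[P]_w gsmooth sg f (psum Y n w) -
    gsmooth (Num.sqrt (sg ^+ 2 + n%:R * be ^+ 2)) f (lcomb n%:R 0 b b)| <=
  n%:R * (C * M * (ep + (c ^+ 3 + c ^+ 6) + (be ^+ 3 + be ^+ 6))).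
Proof.
move=> sg0; have [C C0 HC] := gsmooth_swap sg0; exists C => //.
move=> f M mf fM d T P n Y b c be ep mY indY Yc be0 Yb Yep.
set D := C * M * _.
(* At stage [k] the first [k] summands are the original ones and the [n - k] others Gaussian: these
   add [(n - k) be^2] to the smoothing variance and [(n - k) b] to the mean. Stage [n] is the
   original sum, stage 0 the Gaussian one. *)
pose v (k : nat) := Num.sqrt (sg ^+ 2 + (n - k)%N%:R * be ^+ 2).
have vv k : v k ^+ 2 = sg ^+ 2 + (n - k)%N%:R * be ^+ 2.
  by rewrite sqr_sqrtr// addr_ge0 ?sqr_ge0// mulr_ge0// sqr_ge0.
have sgv k : sg <= v k.
  rewrite -[leLHS](ger0_norm (ltW sg0)) -sqrtr_sqr ler_wsqrtr// lerDl.
  by rewrite mulr_ge0// sqr_ge0.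
pose phi k x := gsmooth (v k) f (lcomb 1 (n - k)%N%:R x b).
have mlc a a' : measurable_fun setT (fun x : m.-tuple RB => lcomb a a' x b).
  exact: measurable_lcomb.
have mphi k : measurable_fun setT (phi k).
  exact: (measurableT_comp (measurable_gsmooth (v k) mf fM) (mlc 1 _)).
have phiM k x : `|phi k x| <= M by exact: gsmooth_bounded.
have mS k : measurable_fun setT (psum Y k) by exact: measurable_psum.
have hphi k : momfin P (fun w => phi k (psum Y k w)).
  apply: (@momfin_bounded _ _ _ _ _ M) => //.
  exact: (measurableT_comp (mphi k) (mS k)).
pose E k := \int[P]_w phi k (psum Y k w).
have step k : (k < n)%N -> `|E k.+1 - E k| <= D.
  move=> kn.
  have nk : (n - k)%N%:R = (n - k.+1)%N%:R + 1 :> R by rewrite -subnSK// natr1.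
  (* The value [s] of the first [k] summands is frozen: by independence the swap takes place
     conditionally on it, with a bound free of [s]. *)
  pose Fs s x := f (lcomb 1 1 x (lcomb 1 (n - k.+1)%N%:R s b)).
  have mFs s : measurable_fun setT (Fs s).
    by apply: (measurableT_comp mf); exact: measurable_lcomb.
  have FsM s x : `|Fs s x| <= M by exact: fM.
  have phiS s y : phi k.+1 (lcomb 1 1 s y) = gsmooth (v k.+1) (Fs s) y.
    rewrite /phi /gsmooth; apply: eq_Rintegral => z _; rewrite /Fs; congr f.
    by apply: eq_from_tnth => i; rewrite !tnth_lcomb; ring.
  have phik s : phi k s = \int[N]_z gsmooth (v k.+1) (Fs s) (lcomb be 1 z b).
    pose G x := f (lcomb 1 1 x (lcomb 1 (n - k)%N%:R s b)).
    have mG : measurable_fun setT G.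
      by apply: (measurableT_comp mf); exact: measurable_lcomb.
    transitivity (\int[N]_z \int[N]_y G (lcomb (v k.+1) be y z)).
      rewrite (@gauss_semigroupR (v k.+1) be (v k) G M)//.
      + rewrite /phi /gsmooth; apply: eq_Rintegral => z _; rewrite /G; congr f.
        by apply: eq_from_tnth => i; rewrite !tnth_lcomb; ring.
      + exact: lt_le_trans (sgv _).
      + exact: lt_le_trans (sgv _).
      + by rewrite !vv nk; ring.
      + by move=> x; exact: fM.
    apply: eq_Rintegral => z _; apply: eq_Rintegral => y _; rewrite /G /Fs; congr f.
    by apply: eq_from_tnth => i; rewrite !tnth_lcomb nk; ring.
  have ind2 A B : measurable A -> measurable B ->
     P (psum Y k @^-1` A `&` Y k @^-1` B) = (P (psum Y k @^-1` A) * P (Y k @^-1` B))%E.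
    exact: (@psum_indep _ _ _ _ _ n Y mY indY).
  have m2 : measurable_fun setT (fun z : m.-tuple RB * m.-tuple RB => phi k.+1 (lcomb 1 1 z.1 z.2)).
    by apply: (measurableT_comp (mphi k.+1)); exact: measurable_lcomb.
  have -> : E k.+1 = \int[P]_w \int[P]_w' phi k.+1 (lcomb 1 1 (psum Y k w) (Y k w')).
    pose ff (z : m.-tuple RB * m.-tuple RB) : R := phi k.+1 (lcomb 1 1 z.1 z.2).
    have ffM q : `|ff q| <= M by exact: phiM.
    have H := @Ex_indep _ _ _ _ _ _ _ P (psum Y k) (Y k) (mS k) (mY k) ind2 ff M m2 ffM.
    exact: H.
  have m3 : measurable_fun setT (fun w => \int[P]_w' phi k.+1 (lcomb 1 1 (psum Y k w) (Y k w'))).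
    have m3' : measurable_fun setT (fun s => \int[P]_w' phi k.+1 (lcomb 1 1 s (Y k w'))).
      apply: (@measurable_Ex_param _ _ _ _ _ P (fun z : m.-tuple RB * T =>
        phi k.+1 (lcomb 1 1 z.1 (Y k z.2))) M) => //.
      apply: (measurableT_comp (mphi k.+1)); apply: measurable_lcomb => //.
      exact: (measurableT_comp (mY k)).
    exact: (measurableT_comp m3' (mS k)).
  have h3 : momfin P (fun w => \int[P]_w' phi k.+1 (lcomb 1 1 (psum Y k w) (Y k w'))).
    apply: (@momfin_bounded _ _ _ _ _ M) => // w; apply: Ex_bounded => //.
    by apply: (measurableT_comp (mphi k.+1)); exact: measurable_lcomb.
  rewrite /E -ExB//; apply: Ex_bounded; first exact: measurable_funB (momfin_measurable (hphi k)).
  move=> w; rewrite phik.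
  have -> : \int[P]_w' phi k.+1 (lcomb 1 1 (psum Y k w) (Y k w')) =
      \int[P]_w' gsmooth (v k.+1) (Fs (psum Y k w)) (Y k w').
    by apply: eq_Rintegral => w' _; rewrite phiS.
  apply: HC => //; [exact: Yc|exact: ltW|exact: Yb|exact: Yep].
have tele k : (k <= n)%N -> `|E k - E 0| <= k%:R * D.
  elim: k => [_|k IH kn]; first by rewrite subrr normr0 mul0r.
  have -> : E k.+1 - E 0 = (E k.+1 - E k) + (E k - E 0) by rewrite addrA subrK.
  rewrite (le_trans (ler_normD _ _))// -natr1 mulrDl mul1r addrC lerD//.
    by apply: IH; exact: ltnW.
  exact: step.
have := tele n (leqnn n); rewrite /E.
have -> : \int[P]_w phi n (psum Y n w) = \int[P]_w gsmooth sg f (psum Y n w).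
  apply: eq_Rintegral => w _; rewrite /phi /v subnn mul0r addr0 sqrtr_sqr ger0_norm ?ltW//.
  by congr gsmooth; apply: eq_from_tnth => i; rewrite tnth_lcomb; ring.
have -> : \int[P]_w phi 0 (psum Y 0 w) =
    gsmooth (Num.sqrt (sg ^+ 2 + n%:R * be ^+ 2)) f (lcomb n%:R 0 b b).
  rewrite -[RHS](Ex_cst P); apply: eq_Rintegral => w _; rewrite /phi /v subn0.
  by congr gsmooth; apply: eq_from_tnth => i; rewrite !tnth_lcomb tnth_mktuple; ring.
by [].
Qed.

End swap.

(** * Limits of real sequences *)

Section real_sequences.
Context (R : realType).
Implicit Types (u v : nat -> R) (a b : R).

Lemma seq_cvgD u v a b : u n @[n --> \oo] --> a -> v n @[n --> \oo] --> b ->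
  u n + v n @[n --> \oo] --> a + b.
Proof. exact: cvgD. Qed.

Lemma seq_cvgB u v a b : u n @[n --> \oo] --> a -> v n @[n --> \oo] --> b ->
  u n - v n @[n --> \oo] --> a - b.
Proof. exact: cvgB. Qed.

Lemma seq_cvgM u v a b : u n @[n --> \oo] --> a -> v n @[n --> \oo] --> b ->
  u n * v n @[n --> \oo] --> a * b.
Proof. exact: cvgM. Qed.

Lemma seq_cvgZ (c : R) u a : u n @[n --> \oo] --> a ->
  c * u n @[n --> \oo] --> c * a.
Proof. by apply: seq_cvgM; exact: cvg_cst. Qed.

Lemma seq_cvgX u a k : u n @[n --> \oo] --> a -> u n ^+ k @[n --> \oo] --> a ^+ k.
Proof.
move=> ua; elim: k => [|k IH].
  by under eq_fun do rewrite expr0; rewrite expr0; exact: cvg_cst.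
by under eq_fun do rewrite exprS; rewrite exprS; exact: seq_cvgM.
Qed.

Lemma seq_cvg_norm u a : u n @[n --> \oo] --> a -> `|u n| @[n --> \oo] --> `|a|.
Proof. exact: cvg_norm. Qed.

Lemma seq_cvg_sum (I : Type) (s : seq I) (u : I -> nat -> R) (a : I -> R) :
  (forall i, u i n @[n --> \oo] --> a i) ->
  \sum_(i <- s) u i n @[n --> \oo] --> \sum_(i <- s) a i.
Proof.
move=> ua; elim: s => [|i s IH].
  by under eq_fun do rewrite big_nil; rewrite big_nil; exact: cvg_cst.
by under eq_fun do rewrite big_cons; rewrite big_cons; exact: seq_cvgD.
Qed.

(** The hypotheses on samples, and the divisions by [n], make sense for [0 < n] only. *)
Lemma seq_cvg_pos_eq u v a : (forall n, (0 < n)%N -> u n = v n) ->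
  u n @[n --> \oo] --> a -> v n @[n --> \oo] --> a.
Proof.
move=> uv; apply: cvg_trans; apply: near_eq_cvg; near=> n.
by rewrite uv//; near: n; exact: nbhs_infty_gt.
Unshelve. all: by end_near. Qed.

Lemma cvg_sqrt_nat : Num.sqrt n%:R @[n --> \oo] --> (+oo : set_system R).
Proof.
apply/cvgryPge => A; near=> n.
rewrite (le_trans (ler_norm A))// -sqrtr_sqr ler_wsqrtr//.
by near: n; exact: nbhs_infty_ger.
Unshelve. all: by end_near. Qed.

Lemma cvg_sqrt_natV : (Num.sqrt n%:R)^-1 @[n --> \oo] --> (0 : R).
Proof.
apply/gtr0_cvgV0; last exact: cvg_sqrt_nat.
by near=> n; rewrite sqrtr_gt0 ltr0n; near: n; exact: nbhs_infty_gt.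
Unshelve. all: by end_near. Qed.

(** The form given below to successive limits: at a fixed level [sg] the error bound tends to
    [sg * K] as [n] grows, and [sg] tends to 0 afterwards. *)
Lemma seq_cvg_of_bound u a (K : R) :
  (forall sg : R, 0 < sg <= 1 -> exists2 U : nat -> R, U n @[n --> \oo] --> sg * K &
    forall n, (0 < n)%N -> `|u n - a| <= U n) ->
  u n @[n --> \oo] --> a.
Proof.
move=> H0; apply/cvgrPdist_le => e e0.
have K0 : 0 < 2 * (`|K| + 1) by rewrite mulr_gt0// ltr_wpDl.
pose sg := Num.min 1 (e / (2 * (`|K| + 1))).
have sg01 : 0 < sg <= 1 by rewrite lt_min ltr01 divr_gt0//= ge_min lexx.
have sgK : sg * K <= e / 2.
  apply: (@le_trans _ _ (sg * (`|K| + 1))).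
    have /andP[sg0 _] := sg01; rewrite ler_pM2l//.
    by rewrite (le_trans (ler_norm _))// lerDl.
  apply: (@le_trans _ _ (e / (2 * (`|K| + 1)) * (`|K| + 1))).
    by rewrite ler_wpM2r ?addr_ge0// ge_min lexx orbT.
  by rewrite le_eqVlt; apply/orP; left; apply/eqP; field; rewrite gt_eqF// ltr_wpDl.
have [U /cvgrPdist_le /(_ (e / 2)) + uU] := H0 _ sg01; rewrite divr_gt0// => /(_ isT) H.
near=> n.
have n0 : (0 < n)%N by near: n; exact: nbhs_infty_gt.
rewrite distrC (le_trans (uU _ n0))//.
have : `|sg * K - U n| <= e / 2 by near: n.
rewrite ler_norml => /andP[+ _]; lra.
Unshelve. all: by end_near. Qed.

End real_sequences.

(** * Cost of smoothing a function of the squared coordinates *)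

Section sq_lipschitz.
Context (R : realType) (m : nat).
Local Notation RB := (measurableTypeR R).
Local Notation N := (@std_normal_vec R m).

(* The statistics are Lipschitz functions of the squared coordinates, but not of
   the coordinates themselves. *)
Definition sq_lipschitz (L : R) (f : m.-tuple RB -> R) :=
  forall x y : m.-tuple RB, `|f x - f y| <=
    L * \sum_(j < m) `|(tnth x j : R) ^+ 2 - (tnth y j : R) ^+ 2|.

(** The increment [(sg u + z)^2 - z^2] is at most [sg (2 u^2 + z^2)]. The error grows with the
    squares of the coordinates of [x], so that second moments are needed once [x] is the scaled
    sum. *)
Lemma gsmooth_close (L M sg : R) (f : m.-tuple RB -> R) (x : m.-tuple RB) :
  measurable_fun setT f -> (forall x, `|f x| <= M) -> 0 <= L ->
  sq_lipschitz L f -> 0 < sg <= 1 ->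
  `|gsmooth sg f x - f x| <= L * sg * \sum_(j < m) (2 + (tnth x j : R) ^+ 2).
Proof.
move=> mf fM L0 fL /andP[s0 s1].
have mg : measurable_fun setT (fun y => f (lcomb sg 1 y x)).
  by apply: (measurableT_comp mf); exact: measurable_lcomb.
have hg : momfin N (fun y => f (lcomb sg 1 y x)) by exact: (@momfin_bounded _ _ _ _ _ M).
have ht j : momfin N (fun y => (tnth y j : R) ^+ 2) by apply: momfinX; exact: momfin_tnth.
rewrite /gsmooth -[X in _ - X](Ex_cst N) -ExB//; last exact: momfin_cst.
have h2 j : momfin N (fun y => 2 * (tnth y j : R) ^+ 2 + (tnth x j : R) ^+ 2).
  by apply: momfinD; [exact: momfinZ|exact: momfin_cst].
apply: (@le_trans _ _ (\int[N]_y (L * sg * \sum_(j < m) (2 * (tnth y j : R) ^+ 2 + (tnth x j : R) ^+ 2)))).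
  apply: Ex_norm_le.
  - by apply: momfinB => //; exact: momfin_cst.
  - by apply: momfinZ; exact: momfin_sum.
  move=> y; apply: (le_trans (fL _ _)); rewrite -mulrA ler_wpM2l// mulr_sumr.
  apply: ler_sum => j _; rewrite tnth_lcomb mul1r.
  set u := (tnth y j : R); set z := (tnth x j : R).
  have -> : (sg * u + z) ^+ 2 - z ^+ 2 = sg * (sg * u ^+ 2 + 2 * (u * z)) by ring.
  rewrite normrM (gtr0_norm s0) ler_wpM2l ?(ltW s0)//.
  have H1 : sg * u ^+ 2 <= u ^+ 2 by rewrite ler_piMl// sqr_ge0.
  have H2 : 0 <= sg * u ^+ 2 by rewrite mulr_ge0 ?sqr_ge0 ?(ltW s0).
  rewrite ler_norml; apply/andP; split; have := sqr_ge0 (u - z); have := sqr_ge0 (u + z); nra.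
rewrite ExZ; last exact: momfin_sum.
rewrite Ex_sum// ler_wpM2l ?mulr_ge0 ?(ltW s0)//; apply: ler_sum => j _.
rewrite ExD; [|exact: momfinZ|exact: momfin_cst].
by rewrite ExZ// gauss_var Ex_cst mulr1.
Qed.

(** Lindeberg replacement ends at a Gaussian law of variance [1 + sg^2]; this compares it with unit
    variance and moves the mean from [x] to its limit [y]. *)
Lemma gauss_shift_close (L M s sg : R) (f : m.-tuple RB -> R) (x y : m.-tuple RB) :
  measurable_fun setT f -> (forall x, `|f x| <= M) -> 0 <= L ->
  sq_lipschitz L f -> 0 < sg <= 1 -> 0 <= s -> s ^+ 2 = 1 + sg ^+ 2 ->
  `|gsmooth s f x - gsmooth 1 f y| <= L * \sum_(j < m)
     (sg * (1 + 2 * `|tnth y j : R|) + 4 * `|(tnth x j : R) - (tnth y j : R)|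
      + `|(tnth x j : R) ^+ 2 - (tnth y j : R) ^+ 2|).
Proof.
move=> mf fM L0 fL /andP[s0 s1] s_ge0 sE.
have s_ge1 : 1 <= s by nra.
have s_le : s <= 1 + sg by nra.
have s_le2 : s <= 2 by lra.
have mg a z : measurable_fun setT (fun y => f (lcomb a 1 y z)).
  by apply: (measurableT_comp mf); exact: measurable_lcomb.
have hg a z : momfin N (fun y => f (lcomb a 1 y z)) by exact: (@momfin_bounded _ _ _ _ _ M).
have ht j : momfin N (fun y => (tnth y j : R) ^+ 2) by apply: momfinX; exact: momfin_tnth.
rewrite /gsmooth -ExB//.
pose A j := `|s * (tnth x j : R) - (tnth y j : R)|.
pose B j := `|(tnth x j : R) ^+ 2 - (tnth y j : R) ^+ 2|.
have h2 j : momfin N (fun z => (sg ^+ 2 + A j) * (tnth z j : R) ^+ 2 + (A j + B j)).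
  by apply: momfinD; [exact: momfinZ|exact: momfin_cst].
apply: (@le_trans _ _ (\int[N]_z (L * \sum_(j < m)
    ((sg ^+ 2 + A j) * (tnth z j : R) ^+ 2 + (A j + B j))))).
  apply: Ex_norm_le.
  - exact: momfinB.
  - by apply: momfinZ; exact: momfin_sum.
  move=> z; apply: (le_trans (fL _ _)); rewrite ler_wpM2l//.
  apply: ler_sum => j _; rewrite !tnth_lcomb !mul1r.
  rewrite /A /B; set u := (tnth z j : R); set a := (tnth x j : R); set b := (tnth y j : R).
  have -> : (s * u + a) ^+ 2 - (u + b) ^+ 2 =
    (s ^+ 2 - 1) * u ^+ 2 + (2 * u * (s * a - b) + (a ^+ 2 - b ^+ 2)) by ring.
  have -> : s ^+ 2 - 1 = sg ^+ 2 by rewrite sE; ring.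
  apply: (le_trans (ler_normD _ _)).
  have -> : (sg ^+ 2 + `|s * a - b|) * u ^+ 2 + (`|s * a - b| + `|a ^+ 2 - b ^+ 2|) =
    sg ^+ 2 * u ^+ 2 + ((u ^+ 2 + 1) * `|s * a - b| + `|a ^+ 2 - b ^+ 2|) by ring.
  apply: lerD; first by rewrite ger0_norm// mulr_ge0// sqr_ge0.
  apply: (le_trans (ler_normD _ _)); rewrite lerD2r normrM ler_wpM2r//.
  by rewrite ler_norml; apply/andP; split; have := sqr_ge0 (u - 1); have := sqr_ge0 (u + 1); nra.
rewrite ExZ; last exact: momfin_sum.
rewrite Ex_sum// ler_wpM2l//; apply: ler_sum => j _.
rewrite ExD; [|exact: momfinZ|exact: momfin_cst].
rewrite ExZ// gauss_var Ex_cst mulr1 addrA -/(B j) lerD2r.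
have HA : A j <= 2 * `|(tnth x j : R) - (tnth y j : R)| + sg * `|tnth y j : R|.
  rewrite /A; have -> : s * (tnth x j : R) - (tnth y j : R) =
     s * ((tnth x j : R) - (tnth y j : R)) + (s - 1) * (tnth y j : R) by ring.
  apply: (le_trans (ler_normD _ _)); rewrite !normrM; apply: lerD.
    by rewrite ler_wpM2r// ger0_norm.
  by rewrite ler_wpM2r// ger0_norm ?subr_ge0//; lra.
have : sg ^+ 2 <= sg by rewrite expr2 ler_piMl// ltW.
by move: HA; lra.
Qed.

End sq_lipschitz.

(** * Convergence of normalized sums of bounded rows *)

Section clt.
Context (R : realType) (m : nat).
Local Notation RB := (measurableTypeR R).
Local Notation N := (@std_normal_vec R m).
Variables (d : nat -> measure_display) (T : forall n, measurableType (d n))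
  (P : forall n, probability (T n) R) (Y : forall n, nat -> T n -> m.-tuple RB).
Variables (c : R) (b : nat -> m.-tuple RB) (q : nat -> 'I_m -> 'I_m -> R)
  (mu : m.-tuple RB).
Hypothesis mY : forall n i, measurable_fun setT (@Y n i).
Hypothesis indY : forall n, (0 < n)%N ->
  forall (J : {set 'I_n}) (B : 'I_n -> set (m.-tuple RB)),
  (forall i, measurable (B i)) ->
  P n (\bigcap_(i in [set i | i \in J]) (@Y n i @^-1` B i)) =
  (\prod_(i in J) P n (@Y n i @^-1` B i))%E.
Hypothesis Yc : forall n i, (i < n)%N -> forall w, l1 (@Y n i w) <= c.
Hypothesis Yb : forall n i, (i < n)%N -> forall j,
  \int[P n]_w (tnth (@Y n i w) j : R) = tnth (b n) j.
Hypothesis Yq : forall n i, (i < n)%N -> forall j k,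
  \int[P n]_w ((tnth (@Y n i w) j : R) * (tnth (@Y n i w) k : R)) = q n j k.
Hypothesis b_cvg : forall j,
  Num.sqrt n%:R * (tnth (b n) j : R) @[n --> \oo] --> (tnth mu j : R).
Hypothesis q_cvg : forall j k, q n j k @[n --> \oo] --> ((j == k)%:R : R).

Definition scaled_sum n w : m.-tuple RB :=
  lcomb (Num.sqrt n%:R)^-1 0 (psum (@Y n) n w) (psum (@Y n) n w).

Arguments scaled_sum : clear implicits.

Lemma measurable_scaled_sum n : measurable_fun setT (scaled_sum n).
Proof. by apply: measurable_lcomb; exact: measurable_psum. Qed.

Lemma tnth_scaled_sum n w j : (tnth (scaled_sum n w) j : R) =
  (Num.sqrt n%:R)^-1 * \sum_(i < n) (tnth (@Y n i w) j : R).
Proof. by rewrite tnth_lcomb tnth_psum mul0r addr0. Qed.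

Let sqrt_gt0 n : (0 < n)%N -> 0 < Num.sqrt n%:R :> R.
Proof. by move=> n0; rewrite sqrtr_gt0 ltr0n. Qed.

Lemma momfin_scaled_sum n j : (0 < n)%N -> momfin (P n) (fun w => tnth (scaled_sum n w) j : R).
Proof.
move=> n0; apply: (@momfin_bounded _ _ _ _ _ ((Num.sqrt n%:R)^-1 * (n%:R * c))).
  exact: (measurableT_comp (measurable_tnth j) (@measurable_scaled_sum n)).
move=> w; rewrite tnth_scaled_sum normrM ger0_norm ?invr_ge0 ?sqrtr_ge0//.
rewrite ler_wpM2l ?invr_ge0 ?sqrtr_ge0// (le_trans (ler_norm_sum _ _ _))//.
rewrite (le_trans (ler_sum _ (fun i _ => le_trans (le_tnth_l1 _ _) (Yc (ltn_ord i) w))))//.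
by rewrite sumr_const card_ord mulr_natl.
Qed.

Lemma scaled_sum_moments n j : (0 < n)%N ->
  \int[P n]_w (tnth (scaled_sum n w) j : R) = Num.sqrt n%:R * (tnth (b n) j : R) /\
  \int[P n]_w ((tnth (scaled_sum n w) j : R) ^+ 2) =
    q n j j - (tnth (b n) j : R) ^+ 2 + (Num.sqrt n%:R * (tnth (b n) j : R)) ^+ 2.
Proof.
move=> n0.
have [Sc E1 E2] := @psum_moments _ _ _ (P n) m n (@Y n) (@mY n) (indY n0) j c (tnth (b n) j) (fun=> q n j j)
  (fun i ii w => le_trans (le_tnth_l1 _ _) (Yc ii w)) (fun i ii => Yb ii j)
  (fun i ii => Yq ii j j) n (leqnn n).
have s0 := sqrt_gt0 n0.
have sE : Num.sqrt n%:R ^+ 2 = n%:R :> R by rewrite sqr_sqrtr// ler0n.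
have hS : momfin (P n) (fun w => tnth (psum (@Y n) n w) j : R).
  apply: (@momfin_bounded _ _ _ _ _ (n%:R * c)) => //.
  exact: (measurableT_comp (measurable_tnth j) (@measurable_psum _ _ _ _ _ (@mY n) n)).
split.
  transitivity (\int[P n]_w ((Num.sqrt n%:R)^-1 * (tnth (psum (@Y n) n w) j : R))).
    by apply: eq_Rintegral => w _; rewrite tnth_lcomb mul0r addr0.
  rewrite ExZ// E1 -[in n%:R * _]sE; field; exact: lt0r_neq0.
transitivity (\int[P n]_w (n%:R^-1 * (tnth (psum (@Y n) n w) j : R) ^+ 2)).
  by apply: eq_Rintegral => w _; rewrite tnth_lcomb mul0r addr0 exprMn exprVn sE.
rewrite ExZ; last exact: momfinX.
rewrite E2 sumr_const card_ord -[(_ - _) *+ n]mulr_natl [in RHS]exprMn sE; field.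
by rewrite pnatr_eq0 -lt0n.
Qed.

(** The error has three parts: smoothing the test function, replacing the summands, and changing the
    variance and mean of the final Gaussian law. The second is the defect of the second moments plus
    a term of order [n^-1/2], the scaled summands being bounded by [c] over the root of [n]; the
    other two are of order [sg] up to terms vanishing with [n]. *)
Theorem clt_sq_lipschitz (L M : R) (f : m.-tuple RB -> R) :
  measurable_fun setT f -> (forall x, `|f x| <= M) -> 0 <= L -> sq_lipschitz L f ->
  \int[P n]_w f (scaled_sum n w) @[n --> \oo] --> gsmooth 1 f mu.
Proof.
move=> mf fM L0 fL.
have M0 : 0 <= M by exact: le_trans (fM [tuple (0 : RB) | i < m]).
pose Em n := lcomb (Num.sqrt n%:R) 0 (b n) (b n).
have EmE n j : (tnth (Em n) j : R) = Num.sqrt n%:R * (tnth (b n) j : R).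
  by rewrite tnth_lcomb mul0r addr0.
have main (sg : R) : 0 < sg <= 1 -> exists2 C : R, 0 <= C & forall n, (0 < n)%N ->
  `|\int[P n]_w f (scaled_sum n w) - gsmooth 1 f mu| <=
    L * sg * (\sum_(j < m) (2 + (q n j j + (tnth (Em n) j : R) ^+ 2)))
    + (C * M * (\sum_(j < m) \sum_(k < m) `|q n j k - (tnth (b n) j : R) * (tnth (b n) k : R) - (j == k)%:R|
       + (c ^+ 3 + c ^+ 6 + 2) * (Num.sqrt n%:R)^-1))
    + L * \sum_(j < m) (sg * (1 + 2 * `|tnth mu j : R|) + 4 * `|(tnth (Em n) j : R) - (tnth mu j : R)|
      + `|(tnth (Em n) j : R) ^+ 2 - (tnth mu j : R) ^+ 2|).
  move=> sg01; have /andP[sg0 sg1] := sg01.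
  have [C C0 HC] := lindeberg m sg0; exists C => // n n0.
  have s0 := sqrt_gt0 n0.
  have sE : Num.sqrt n%:R ^+ 2 = n%:R :> R by rewrite sqr_sqrtr// ler0n.
  (* Standard deviation of the Gaussian substituted for one scaled summand, so that
     [n * be ^+ 2 = 1]. *)
  pose be : R := (Num.sqrt n%:R)^-1.
  have be0 : 0 < be by rewrite invr_gt0.
  have be1 : be <= 1.
    by rewrite /be invf_le1// -[leLHS]sqrtr1 ler_wsqrtr// ler1n.
  have nbe : n%:R * be ^+ 2 = 1.
    by rewrite /be exprVn sE divff// pnatr_eq0 -lt0n.
  have c0 : 0 <= c by exact: le_trans (l1_ge0 _) (Yc n0 point).
  pose Z i w := lcomb be 0 (@Y n i w) (@Y n i w).
  have mZ i : measurable_fun setT (Z i) by exact: measurable_lcomb.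
  have mbe : measurable_fun setT (fun x : m.-tuple RB => lcomb be 0 x x).
    exact: measurable_lcomb.
  have indZ (J : {set 'I_n}) (B : 'I_n -> set (m.-tuple RB)) : (forall i, measurable (B i)) ->
    P n (\bigcap_(i in [set i | i \in J]) (Z i @^-1` B i)) =
    (\prod_(i in J) P n (Z i @^-1` B i))%E.
    move=> mB; apply: (indY n0 J (B := fun i => (fun x => lcomb be 0 x x) @^-1` B i)) => i.
    by rewrite -[X in measurable X]setTI; exact: mbe.
  have Zc i : (i < n)%N -> forall w, l1 (Z i w) <= be * c.
    move=> i_n w; apply: (le_trans (l1_lcomb _ _ _ _)).
    by rewrite normr0 mul0r addr0 gtr0_norm// ler_pM2l// Yc.
  have hYj i j : (i < n)%N -> momfin (P n) (fun w => tnth (@Y n i w) j : R).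
    move=> i_n; apply: (@momfin_bounded _ _ _ _ _ c).
      exact: (measurableT_comp (measurable_tnth j) (@mY n i)).
    by move=> w; exact: le_trans (le_tnth_l1 _ _) (Yc i_n w).
  have Zb i : (i < n)%N -> forall j, \int[P n]_w (tnth (Z i w) j : R) = tnth (lcomb be 0 (b n) (b n)) j.
    move=> i_n j; rewrite tnth_lcomb mul0r addr0 -(Yb i_n) -ExZ; last exact: hYj.
    by apply: eq_Rintegral => w _; rewrite tnth_lcomb mul0r addr0.
  pose ep := be ^+ 2 * \sum_(j < m) \sum_(k < m)
     `|q n j k - (tnth (b n) j : R) * (tnth (b n) k : R) - (j == k)%:R|.
  have Zep i : (i < n)%N -> \sum_(j < m) \sum_(k < m)
     `|\int[P n]_w ((tnth (Z i w) j : R) * (tnth (Z i w) k : R))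
     - (tnth (lcomb be 0 (b n) (b n)) j : R) * (tnth (lcomb be 0 (b n) (b n)) k : R)
     - be ^+ 2 * (j == k)%:R| <= ep.
    move=> i_n; rewrite /ep mulr_sumr; apply: ler_sum => j _; rewrite mulr_sumr.
    apply: ler_sum => k _; rewrite -(Yq i_n).
    have -> : \int[P n]_w ((tnth (Z i w) j : R) * (tnth (Z i w) k : R)) =
       be ^+ 2 * \int[P n]_w ((tnth (@Y n i w) j : R) * (tnth (@Y n i w) k : R)).
      rewrite -ExZ; last by apply: momfinM; exact: hYj.
      by apply: eq_Rintegral => w _; rewrite !tnth_lcomb; ring.
    rewrite !tnth_lcomb !mul0r !addr0.
    rewrite -[X in X * `| _ |](ger0_norm (sqr_ge0 be)) -normrM le_eqVlt; apply/orP; left.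
    by apply/eqP; congr (`|_|); ring.
  have := HC f M mf fM _ _ (P n) n Z (lcomb be 0 (b n) (b n)) (be * c) be ep mZ indZ Zc be0 Zb Zep.
  rewrite nbe.
  have -> : lcomb n%:R 0 (lcomb be 0 (b n) (b n)) (lcomb be 0 (b n) (b n)) = Em n.
    have nbe1 : n%:R * be = Num.sqrt n%:R.
      by rewrite -[X in X * _]sE expr2 mulfK// gt_eqF.
    by apply: eq_from_tnth => j; rewrite EmE !tnth_lcomb !mul0r !addr0 mulrA nbe1.
  have -> : \int[P n]_w gsmooth sg f (psum Z n w) = \int[P n]_w gsmooth sg f (scaled_sum n w).
    apply: eq_Rintegral => w _; congr gsmooth; apply: eq_from_tnth => j.
    rewrite tnth_scaled_sum tnth_psum mulr_sumr; apply: eq_bigr => i _.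
    by rewrite tnth_lcomb mul0r addr0.
  set s := Num.sqrt (sg ^+ 2 + 1) => H2.
  have H1 : `|\int[P n]_w f (scaled_sum n w) - \int[P n]_w gsmooth sg f (scaled_sum n w)| <=
     L * sg * \sum_(j < m) (2 + (q n j j + (tnth (Em n) j : R) ^+ 2)).
    have h1 : momfin (P n) (fun w => f (scaled_sum n w)).
      apply: (@momfin_bounded _ _ _ _ _ M) => //.
      exact: (measurableT_comp mf (@measurable_scaled_sum n)).
    have h2 : momfin (P n) (fun w => gsmooth sg f (scaled_sum n w)).
      apply: (@momfin_bounded _ _ _ _ _ M).
        exact: (measurableT_comp (measurable_gsmooth sg mf fM) (@measurable_scaled_sum n)).
      by move=> w; exact: gsmooth_bounded.
    have h3 j : momfin (P n) (fun w => 2 + (tnth (scaled_sum n w) j : R) ^+ 2).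
      by apply: momfinD; [exact: momfin_cst|apply: momfinX; exact: momfin_scaled_sum].
    rewrite -ExB//; apply: (@le_trans _ _ (\int[P n]_w (L * sg * \sum_(j < m)
        (2 + (tnth (scaled_sum n w) j : R) ^+ 2)))).
      apply: Ex_norm_le; [exact: momfinB|by apply: momfinZ; exact: momfin_sum|].
      by move=> w; rewrite distrC; exact: (gsmooth_close _ mf fM L0 fL sg01).
    rewrite ExZ; last exact: momfin_sum.
    rewrite ler_wpM2l ?mulr_ge0 ?(ltW sg0)// Ex_sum//; apply: ler_sum => j _.
    rewrite ExD; [|exact: momfin_cst|by apply: momfinX; exact: momfin_scaled_sum].
    rewrite Ex_cst lerD2l (scaled_sum_moments j n0).2 EmE lerD2r.
    by rewrite lerBlDr lerDl sqr_ge0.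
  have H3 : `|gsmooth s f (Em n) - gsmooth 1 f mu| <= L * \sum_(j < m) (sg * (1 + 2 * `|tnth mu j : R|) + 4 * `|(tnth (Em n) j : R) - (tnth mu j : R)|
      + `|(tnth (Em n) j : R) ^+ 2 - (tnth mu j : R) ^+ 2|).
    apply: (gauss_shift_close _ _ mf fM L0 fL sg01); first exact: sqrtr_ge0.
    by rewrite sqr_sqrtr ?addr_ge0 ?sqr_ge0// addrC.
  have H2' : n%:R * (C * M * (ep + ((be * c) ^+ 3 + (be * c) ^+ 6) + (be ^+ 3 + be ^+ 6))) <=
     (C * M * (\sum_(j < m) \sum_(k < m) `|q n j k - (tnth (b n) j : R) * (tnth (b n) k : R) - (j == k)%:R|
       + (c ^+ 3 + c ^+ 6 + 2) * be)).
    rewrite mulrCA ler_wpM2l ?mulr_ge0// /ep.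
    set Sq := \sum_(j < m) _.
    have -> : n%:R * (be ^+ 2 * Sq + ((be * c) ^+ 3 + (be * c) ^+ 6) + (be ^+ 3 + be ^+ 6)) =
      (n%:R * be ^+ 2) * (Sq + (be * c ^+ 3 + be ^+ 4 * c ^+ 6) + (be + be ^+ 4)) by ring.
    rewrite nbe mul1r.
    have b4 : be ^+ 4 <= be by rewrite exprS ler_piMr ?(ltW be0)// exprn_ile1 ?(ltW be0).
    have c6 : 0 <= c ^+ 6 by exact: exprn_ge0.
    have := ler_wpM2r c6 b4.
    move: b4; set B4 := be ^+ 4; set C6 := c ^+ 6; set C3 := c ^+ 3 => b4 H; nra.
  have -> : \int[P n]_w f (scaled_sum n w) - gsmooth 1 f mu =
    (\int[P n]_w f (scaled_sum n w) - \int[P n]_w gsmooth sg f (scaled_sum n w)) +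
    (\int[P n]_w gsmooth sg f (scaled_sum n w) - gsmooth s f (Em n)) +
    (gsmooth s f (Em n) - gsmooth 1 f mu) by ring.
  apply: (le_trans (ler_normD _ _)); apply: lerD; last exact: H3.
  apply: (le_trans (ler_normD _ _)); apply: lerD; first exact: H1.
  exact: le_trans H2 H2'.
have cE j : (tnth (Em n) j : R) @[n --> \oo] --> (tnth mu j : R).
  by under eq_fun do rewrite EmE; exact: b_cvg.
(* The means are of the order of the inverse root of [n]: centring does not affect the limit of the
   second moments. *)
have cb j : (tnth (b n) j : R) @[n --> \oo] --> (0 : R).
  rewrite -[X in _ --> X](mulr0 (tnth mu j : R)).
  apply: (@seq_cvg_pos_eq _ (fun n => (tnth (Em n) j : R) * (Num.sqrt n%:R)^-1)).
    by move=> n n0; rewrite EmE mulrAC divff ?mul1r// lt0r_neq0// sqrt_gt0.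
  by apply: seq_cvgM => //; exact: cvg_sqrt_natV.
pose K := L * (\sum_(j < m) (2 + (1 + (tnth mu j : R) ^+ 2)))
  + L * \sum_(j < m) (1 + 2 * `|tnth mu j : R|).
apply: (@seq_cvg_of_bound _ _ _ K) => sg sg01.
have [C C0 HC] := main sg sg01.
eexists; last exact: HC.
(* The vanishing terms are written out so that the limit matches the bound of [main] term by
   term. *)
have -> : sg * K = L * sg * (\sum_(j < m) (2 + (1 + (tnth mu j : R) ^+ 2))) +
   C * M * (\sum_(j < m) \sum_(k < m) `|(j == k)%:R - 0 * 0 - (j == k)%:R| + (c ^+ 3 + c ^+ 6 + 2) * 0) +
   L * \sum_(j < m) (sg * (1 + 2 * `|tnth mu j : R|) + 4 * `|(tnth mu j : R) - (tnth mu j : R)|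
      + `|(tnth mu j : R) ^+ 2 - (tnth mu j : R) ^+ 2|).
  rewrite [X in _ + C * M * (X + _)]big1; last first.
    by move=> j _; rewrite big1// => k _; rewrite mulr0 subr0 subrr normr0.
  rewrite !mulr0 addr0 mulr0 addr0 /K mulrDr mulrA (mulrC sg L); congr (_ + _).
  rewrite mulrCA mulr_sumr; congr (_ * _); apply: eq_bigr => j _.
  by rewrite !subrr normr0 mulr0 !addr0.
apply: seq_cvgD.
  apply: seq_cvgD.
    apply: seq_cvgZ; apply: seq_cvg_sum => j; apply: seq_cvgD; first exact: cvg_cst.
    apply: seq_cvgD; last exact: seq_cvgX.
    by have := q_cvg (j := j) (k := j); rewrite eqxx.
  apply: seq_cvgZ; apply: seq_cvgD.
    apply: seq_cvg_sum => j; apply: seq_cvg_sum => k; apply: seq_cvg_norm.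
    apply: seq_cvgB; last exact: cvg_cst.
    by apply: seq_cvgB; [exact: q_cvg|exact: seq_cvgM].
  by apply: seq_cvgZ; exact: cvg_sqrt_natV.
apply: seq_cvgZ; apply: seq_cvg_sum => j; apply: seq_cvgD.
  apply: seq_cvgD; first exact: cvg_cst.
  by apply: seq_cvgZ; apply: seq_cvg_norm; apply: seq_cvgB => //; exact: cvg_cst.
by apply: seq_cvg_norm; apply: seq_cvgB; [exact: seq_cvgX|exact: cvg_cst].
Qed.

End clt.

(** * Convergence in distribution *)

Section inf_convolution.
Context (R : realType) (f : R -> R) (M : R).
Hypothesis fM : forall x, `|f x| <= M.

(* [inf_conv k] is [k]-Lipschitz and increases to [f] as [k] grows, whence the
   reduction to Lipschitz test functions below. *)
Definition inf_conv (k x : R) : R := inf (range (fun y => f y + k * `|x - y|)).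

Let f_ge y : - M <= f y.
Proof. by have := fM y; rewrite ler_norml => /andP[]. Qed.

Let f_le y : f y <= M.
Proof. by have := fM y; rewrite ler_norml => /andP[]. Qed.

Let lb k x : 0 <= k -> lbound (range (fun y => f y + k * `|x - y|)) (- M).
Proof. by move=> k0 _ [y _ <-]; rewrite (le_trans (f_ge y))// lerDl mulr_ge0. Qed.

Let ne k x : range (fun y => f y + k * `|x - y|) !=set0.
Proof. by exists (f 0 + k * `|x - 0|), 0. Qed.

Lemma inf_conv_le k x y : 0 <= k -> inf_conv k x <= f y + k * `|x - y|.
Proof.
move=> k0; apply: ge_inf; last by exists y.
by exists (- M); exact: lb.
Qed.

Lemma inf_conv_le_self k x : 0 <= k -> inf_conv k x <= f x.
Proof. by move=> /(inf_conv_le x x); rewrite subrr normr0 mulr0 addr0. Qed.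

Lemma inf_conv_ge k x (z : R) : (forall y, z <= f y + k * `|x - y|) -> z <= inf_conv k x.
Proof. by move=> H; apply: lb_le_inf => // _ [y _ <-]. Qed.

Lemma inf_conv_bounded k x : 0 <= k -> `|inf_conv k x| <= M.
Proof.
move=> k0; rewrite ler_norml (le_trans (inf_conv_le_self x k0)) ?f_le// andbT.
by apply: inf_conv_ge => y; rewrite (le_trans (f_ge y))// lerDl mulr_ge0.
Qed.

Lemma inf_conv_lipschitz k x y : 0 <= k ->
  `|inf_conv k x - inf_conv k y| <= k * `|x - y|.
Proof.
move=> k0.
have H a b : inf_conv k a - k * `|a - b| <= inf_conv k b.
  apply: inf_conv_ge => z; rewrite lerBlDr (le_trans (inf_conv_le a z k0))//.
  rewrite -addrA lerD2l -mulrDr ler_wpM2l// (le_trans _ (ler_normD _ _))//.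
  by rewrite [b - z + _]addrC addrA subrK.
rewrite ler_norml; have := H x y; have := H y x; rewrite (distrC y x); lra.
Qed.

Lemma inf_conv_cvg x : continuous f -> inf_conv n%:R x @[n --> \oo] --> f x.
Proof.
move=> cf; apply/cvgrPdist_le => e e0.
have /cvgrPdist_le /(_ e e0) := cf x.
move=> /nbhs_ballP[dl /= dl0 Hd].
near=> n.
rewrite ger0_norm ?subr_ge0 ?inf_conv_le_self// lerBlDl -lerBlDr.
apply: inf_conv_ge => y.
(* Within [dl] of [x], continuity bounds [f y] from below; farther away the penalty is at least
   [n * dl], hence at least [2 * M] for large [n]. *)
have [xy|xy] := ltP `|x - y| dl.
  have := Hd y xy; rewrite /= ler_norml => /andP[_ H].
  by rewrite (@le_trans _ _ (f y)) ?lerDl ?mulr_ge0// lerBlDl -lerBlDr.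
apply: (@le_trans _ _ (- M + 2 * M)); first by have := f_le x; lra.
apply: lerD => //.
apply: (@le_trans _ _ (n%:R * dl)); last by rewrite ler_wpM2l.
rewrite -ler_pdivrMr//.
by near: n; exact: nbhs_infty_ger.
Unshelve. all: by end_near. Qed.

End inf_convolution.

Section portmanteau.
Context (R : realType).

Lemma bounded_cvg d (T : measurableType d) (P : probability T R) (f : nat -> T -> R)
    (g : T -> R) (M : R) :
  (forall n, measurable_fun setT (f n)) -> measurable_fun setT g ->
  (forall n x, `|f n x| <= M) -> (forall x, f n x @[n --> \oo] --> g x) ->
  \int[P]_x f n x @[n --> \oo] --> \int[P]_x g x.
Proof.
move=> mf mg fM fg.
have gM x : `|g x| <= M.
  have H : `|f n x| @[n --> \oo] --> `|g x| by exact: cvg_norm (fg x).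
  rewrite -(cvg_lim (@Rhausdorff R) H); apply: limr_le.
    by apply/cvg_ex; exists `|g x|.
  by apply: nearW => n.
have := @dominated_cvg _ T R P setT measurableT (fun n x => (f n x)%:E) (fun x => (g x)%:E) (fun=> M%:E).
move=> H.
apply: fine_cvg; rewrite fineK; last first.
  by apply: (@integrable_fin_num _ _ _ P setT) => //; apply: momfin_integrable; exact: momfin_bounded gM.
apply: H.
- by move=> n; apply/measurable_EFinP.
- by move=> x _; apply: cvg_EFin; [exact: nearW|exact: fg].
- by [].
- exact: (momfin_integrable (momfin_cst P M)).
- by move=> n x _; rewrite lee_fin.
Qed.

Lemma lipschitz_measurable (h : R -> R) (L : R) :
  (forall x y, `|h x - h y| <= L * `|x - y|) -> measurable_fun setT h.
Proof.
move=> hL; apply: continuous_measurable_fun => x; apply/cvgrPdist_le => e e0.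
near=> y; rewrite (le_trans (hL _ _))//.
apply: (@le_trans _ _ ((`|L| + 1) * `|x - y|)).
  by rewrite ler_wpM2r// (le_trans (ler_norm _))// lerDl.
rewrite mulrC -ler_pdivlMr ?ltr_wpDl//.
near: y; apply: cvgr_dist_le; first exact: cvg_id.
by rewrite divr_gt0// ltr_wpDl.
Unshelve. all: by end_near. Qed.

Lemma lipschitz_cvg_in_distribution (d : nat -> measure_display)
    (T : forall n, measurableType (d n)) (P : forall n, probability (T n) R)
    (X : forall n, T n -> R) (d' : measure_display) (T' : measurableType d')
    (Q : probability T' R) (Y : T' -> R) :
  (forall n, measurable_fun setT (X n)) -> measurable_fun setT Y ->
  (forall (h : R -> R) (L M : R), 0 <= L -> (forall x y, `|h x - h y| <= L * `|x - y|) ->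
    (forall x, `|h x| <= M) ->
    \int[P n]_w h (X n w) @[n --> \oo] --> \int[Q]_y h (Y y)) ->
  cvg_in_distribution P X Q Y.
Proof.
move=> mX mY H f cf [M fM].
have mf : measurable_fun setT f by exact: continuous_measurable_fun.
have hX (g : R -> R) (K : R) n : measurable_fun setT g -> (forall x, `|g x| <= K) ->
    momfin (P n) (fun w => g (X n w)).
  by move=> mg gK; apply: (@momfin_bounded _ _ _ _ _ K) => //; exact: (measurableT_comp mg (mX n)).
have hY (g : R -> R) (K : R) : measurable_fun setT g -> (forall x, `|g x| <= K) ->
    momfin Q (fun w => g (Y w)).
  by move=> mg gK; apply: (@momfin_bounded _ _ _ _ _ K) => //; exact: (measurableT_comp mg mY).
(* The lower half of the convergence: [inf_conv g k] lies below [g], and for large [k] loses little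
   mean under the limit law. The upper half is the same statement for [- f]. *)
have lower (g : R -> R) : continuous g -> (forall x, `|g x| <= M) -> forall e, 0 < e ->
    \forall n \near \oo, \int[Q]_y g (Y y) - e <= \int[P n]_w g (X n w).
  move=> cg gM e e0.
  have mg : measurable_fun setT g by exact: continuous_measurable_fun.
  have mi k : measurable_fun setT (inf_conv g k%:R).
    by apply: (@lipschitz_measurable _ k%:R) => x y; exact: inf_conv_lipschitz gM _ _ _ _.
  have iM k x : `|inf_conv g k%:R x| <= M by exact: inf_conv_bounded.
  have : \int[Q]_y inf_conv g k%:R (Y y) @[k --> \oo] --> \int[Q]_y g (Y y).
    apply: (@bounded_cvg _ _ _ _ _ M) => //.
    - by move=> k; exact: (measurableT_comp (mi k) mY).
    - exact: (measurableT_comp mg mY).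
    - by move=> y; exact: inf_conv_cvg gM _ cg.
  move=> /cvgrPdist_le /(_ (e / 2)); rewrite divr_gt0// => /(_ isT) /filter_ex[k Hk].
  have /cvgrPdist_le /(_ (e / 2)) := H (inf_conv g k%:R) k%:R M (ler0n _ k)
    (fun x y => inf_conv_lipschitz gM x y (ler0n _ k)) (iM k).
  rewrite divr_gt0// => /(_ isT); apply: filterS => n Hn.
  have le_ : \int[P n]_w inf_conv g k%:R (X n w) <= \int[P n]_w g (X n w).
    apply: Ex_le; [exact: (hX _ M)|exact: (hX _ M)|].
    by move=> w; exact: inf_conv_le_self.
  by move: Hn Hk; rewrite !ler_norml => /andP[_ Hn] /andP[_ Hk]; lra.
have E n : 'E_(P n)[f \o X n]%E = (\int[P n]_w f (X n w))%:E.
  by rewrite expectation_Ex//; exact: (hX _ M).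
rewrite (_ : 'E_Q[f \o Y]%E = (\int[Q]_y f (Y y))%:E); last first.
  by rewrite expectation_Ex//; exact: (hY _ M).
rewrite (_ : (fun n => _) = (fun n => (\int[P n]_w f (X n w))%:E)); last first.
  by apply/funext => n; rewrite -E.
apply: cvg_EFin; first exact: nearW.
apply/cvgrPdist_le => e e0.
have L1 := lower f cf fM e e0.
have fNM x : `|- f x| <= M by rewrite normrN.
have cNf : continuous (fun x => - f x) by move=> x; apply: cvgN; exact: cf.
have L2 := lower (fun x => - f x) cNf fNM e e0.
near=> n.
rewrite ler_norml.
have H1 : \int[Q]_y f (Y y) - e <= \int[P n]_w f (X n w) by near: n.
have : \int[Q]_y (- f (Y y)) - e <= \int[P n]_w (- f (X n w)) by near: n.
have -> : \int[Q]_y (- f (Y y)) = - \int[Q]_y f (Y y).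
  rewrite -mulN1r -ExZ; last exact: (hY _ M).
  by apply: eq_Rintegral => y _; rewrite mulN1r.
have -> : \int[P n]_w (- f (X n w)) = - \int[P n]_w f (X n w).
  rewrite -mulN1r -ExZ; last exact: (hX _ M).
  by apply: eq_Rintegral => y _; rewrite mulN1r.
rewrite -[(fine \o _) n]/(\int[P n]_w f (X n w)); lra.
Unshelve. all: by end_near. Qed.

End portmanteau.

(** * Slutsky's lemma and Markov bounds *)

Section slutsky.
Context (R : realType).

Lemma Ex_indic d (T : measurableType d) (P : probability T R) (A : set T) :
  measurable A -> \int[P]_x (\1_A x) = fine (P A).
Proof. by move=> mA; rewrite /Rintegral integral_indic// setIT. Qed.

Lemma momfin_indic d (T : measurableType d) (P : probability T R) (A : set T) :
  measurable A -> momfin P (\1_A).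
Proof.
move=> mA; apply: (@momfin_bounded _ _ _ _ _ 1) => // x.
by rewrite indicE; case: (_ \in _); rewrite ?normr1// normr0.
Qed.

Variables (d : nat -> measure_display) (T : forall n, measurableType (d n))
  (P : forall n, probability (T n) R).

(** Where [|D - dl| <= ep dl / 2], the ratio moves by at most [ep N / dl], whose mean is controlled
    by [B]; the complement is handled by Chebyshev's inequality and the bound on [h]. *)
Lemma slutsky_ratio (Nn Dn : forall n, T n -> R) (dl B L M l : R) (h : R -> R) :
  0 < dl -> 0 <= L -> (forall x y, `|h x - h y| <= L * `|x - y|) -> (forall x, `|h x| <= M) ->
  (forall n, (0 < n)%N -> momfin (P n) (Nn n)) ->
  (forall n, (0 < n)%N -> momfin (P n) (Dn n)) ->
  (forall n, measurable_fun setT (fun w => Nn n w / Dn n w)) ->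
  (forall n w, 0 <= Nn n w) ->
  (forall n, (0 < n)%N -> \int[P n]_w Nn n w <= B) ->
  \int[P n]_w (Dn n w - dl) ^+ 2 @[n --> \oo] --> (0 : R) ->
  \int[P n]_w h (Nn n w / dl) @[n --> \oo] --> l ->
  \int[P n]_w h (Nn n w / Dn n w) @[n --> \oo] --> l.
Proof.
move=> dl0 L0 hL hM mN mD mND N0 NB Dcvg hcvg.
have mh := lipschitz_measurable hL.
have M0 : 0 <= M by exact: le_trans (hM 0).
suff H : \int[P n]_w h (Nn n w / Dn n w) - \int[P n]_w h (Nn n w / dl) @[n --> \oo] --> (0 : R).
  have := seq_cvgD H hcvg; rewrite add0r.
  by under eq_fun do rewrite subrK.
apply: (@seq_cvg_of_bound _ _ _ (L * B / dl)) => ep /andP[ep0 ep1].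
(* [8 M / (ep dl)^2] is the bound [2 M] on the increments of [h] over the squared threshold
   [(ep dl / 2)^2]. *)
exists (fun n => ep * (L * B / dl) + (8 * M / (ep * dl) ^+ 2) * \int[P n]_w (Dn n w - dl) ^+ 2).
  rewrite -[X in _ --> X]addr0 -[X in _ + X](mulr0 (8 * M / (ep * dl) ^+ 2)).
  by apply: seq_cvgD; [exact: cvg_cst|exact: seq_cvgZ].
move=> n n0; rewrite subr0.
have h1 : momfin (P n) (fun w => h (Nn n w / Dn n w)).
  by apply: (@momfin_bounded _ _ _ _ _ M) => //; exact: (measurableT_comp mh (mND n)).
have hN : momfin (P n) (fun w => dl^-1 * Nn n w) by apply: momfinZ; exact: mN.
have h2 : momfin (P n) (fun w => h (Nn n w / dl)).
  apply: (@momfin_bounded _ _ _ _ _ M) => //; apply: (measurableT_comp mh).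
  by under eq_fun do rewrite mulrC; exact: momfin_measurable hN.
have hD : momfin (P n) (fun w => (Dn n w - dl) ^+ 2).
  by apply: momfinX; apply: momfinB; [exact: mD|exact: momfin_cst].
rewrite -ExB//.
apply: (@le_trans _ _ (\int[P n]_w ((ep * L) * (dl^-1 * Nn n w) +
   8 * M / (ep * dl) ^+ 2 * (Dn n w - dl) ^+ 2))).
  apply: Ex_norm_le; [exact: momfinB|by apply: momfinD; exact: momfinZ|].
  move=> w; set N := Nn n w; set D := Dn n w.
  have epdl : 0 < ep * dl by exact: mulr_gt0.
  have NN : 0 <= N by exact: N0.
  have [HD|HD] := lerP `|D - dl| (ep * dl / 2).
    have D0 : dl / 2 <= D.
      by move: HD; rewrite ler_norml => /andP[+ _]; nra.
    have D1 : 0 < D by apply: lt_le_trans D0; rewrite divr_gt0.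
    apply: ler_wpDr; first by rewrite mulr_ge0 ?sqr_ge0// divr_ge0 ?sqr_ge0// mulr_ge0.
    apply: (le_trans (hL _ _)).
    have -> : N / D - N / dl = - (N * (D - dl)) / (D * dl).
      by field; rewrite !gt_eqF.
    rewrite normrM normrN normrM (ger0_norm NN) [X in _ * (_ * X)]ger0_norm; last first.
      by rewrite invr_ge0 mulr_ge0// ltW.
    have -> : ep * L * (dl^-1 * N) = L * (ep * (dl^-1 * N)) by ring.
    rewrite ler_wpM2l// ler_pdivrMr ?mulr_gt0//.
    have -> : ep * (dl^-1 * N) * (D * dl) = N * (ep * D) by field; rewrite gt_eqF.
    by rewrite ler_wpM2l// (le_trans HD)// -mulrA ler_wpM2l// ltW.
  apply: ler_wpDl.
    by rewrite mulr_ge0 ?mulr_ge0 ?invr_ge0// ltW.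
  apply: (@le_trans _ _ (M + M)).
    by rewrite (le_trans (ler_normB _ _))// lerD.
  have sq : (ep * dl / 2) ^+ 2 <= (D - dl) ^+ 2.
    rewrite -[leRHS]real_normK ?num_real// lerXn2r ?nnegrE ?divr_ge0 ?(ltW epdl)//.
    exact: ltW.
  have -> : M + M = 8 * M / (ep * dl) ^+ 2 * (ep * dl / 2) ^+ 2.
    by field; rewrite !gt_eqF.
  by rewrite ler_wpM2l// divr_ge0 ?sqr_ge0// mulr_ge0.
rewrite ExD; [|exact: momfinZ|exact: momfinZ].
rewrite !ExZ//; last exact: mN.
rewrite lerD2r -mulrA ler_pM2l// -[L * B / dl]mulrA ler_wpM2l// mulrC.
by rewrite ler_pM2r ?invr_gt0// NB.
Qed.

Lemma slutsky_diff (S W : forall n, T n -> R) (L M l : R) (h : R -> R) :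
  0 <= L -> (forall x y, `|h x - h y| <= L * `|x - y|) -> (forall x, `|h x| <= M) ->
  (forall n, measurable_fun setT (S n)) -> (forall n, measurable_fun setT (W n)) ->
  cvg_in_probability0 P (fun n w => S n w - W n w) ->
  \int[P n]_w h (W n w) @[n --> \oo] --> l ->
  \int[P n]_w h (S n w) @[n --> \oo] --> l.
Proof.
move=> L0 hL hM mS mW SW hcvg.
have mh := lipschitz_measurable hL.
have M0 : 0 <= M by exact: le_trans (hM 0).
suff H : \int[P n]_w h (S n w) - \int[P n]_w h (W n w) @[n --> \oo] --> (0 : R).
  have := seq_cvgD H hcvg; rewrite add0r.
  by under eq_fun do rewrite subrK.
apply: (@seq_cvg_of_bound _ _ _ L) => ep /andP[ep0 ep1].
pose A n := [set w | (ep <= `|S n w - W n w|)%R].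
have mSW n : measurable_fun setT (fun w => `|S n w - W n w|).
  by apply: measurableT_comp => //; exact: measurable_funB.
have mA n : measurable (A n).
  rewrite (_ : A n = (fun w => `|S n w - W n w|) @^-1` `[ep, +oo[%classic).
    by rewrite -[X in measurable X]setTI; apply: mSW => //; exact: measurable_itv.
  by apply/seteqP; split => w /=; rewrite in_itv/= andbT.
exists (fun n => ep * L + 2 * M * fine (P n (A n))).
  rewrite -[X in _ --> X]addr0 -[X in _ + X](mulr0 (2 * M)).
  apply: seq_cvgD; first exact: cvg_cst.
  by apply: seq_cvgZ; apply: fine_cvg; exact: SW.
move=> n n0; rewrite subr0.
have h1 (X : T n -> R) : measurable_fun setT X -> momfin (P n) (fun w => h (X w)).
  by move=> mX; apply: (@momfin_bounded _ _ _ _ _ M) => //; exact: (measurableT_comp mh).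
have hA := momfin_indic (P n) (mA n).
rewrite -ExB; [|exact: h1|exact: h1].
apply: (@le_trans _ _ (\int[P n]_w (ep * L + 2 * M * \1_(A n) w))).
  apply: Ex_norm_le; [by apply: momfinB; exact: h1|by apply: momfinD; [exact: momfin_cst|exact: momfinZ]|].
  move=> w; rewrite indicE; have [wA|wA] := boolP (w \in A n).
    rewrite mulr1; apply: ler_wpDl; first by rewrite mulr_ge0// ltW.
    by rewrite (le_trans (ler_normB _ _))// mulr_natl mulr2n lerD.
  rewrite mulr0 addr0 (le_trans (hL _ _))// mulrC ler_wpM2r//.
  by move: wA; rewrite notin_setE /A/= => /negP; rewrite -ltNge => /ltW.
rewrite ExD; [|exact: momfin_cst|exact: momfinZ].
by rewrite Ex_cst ExZ// Ex_indic.
Qed.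

(** Markov's inequality in a form where [G] may add up the bounds of several exceptional events, one
    of them governed by an auxiliary level [sg]. *)
Lemma cvg_in_probability0_of_bound (X : forall n, T n -> R) (K : R) :
  (forall n, measurable_fun setT (X n)) ->
  (forall ep sg : R, 0 < ep -> 0 < sg <= 1 ->
    exists2 U : nat -> R, U n @[n --> \oo] --> sg * K &
      forall n, (0 < n)%N -> exists G : T n -> R, [/\ momfin (P n) G, forall w, 0 <= G w,
        forall w, ep <= `|X n w| -> 1 <= G w & \int[P n]_w G w <= U n]) ->
  cvg_in_probability0 P X.
Proof.
move=> mX H ep ep0.
pose A n := [set w | (ep <= `|X n w|)%R].
have mA n : measurable (A n).
  rewrite (_ : A n = (fun w => `|X n w|) @^-1` `[ep, +oo[%classic).
    rewrite -[X in measurable X]setTI.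
    have mnX : measurable_fun setT (fun w => `|X n w|) by exact: measurableT_comp.
    by apply: mnX => //; exact: measurable_itv.
  by apply/seteqP; split => w /=; rewrite in_itv/= andbT.
rewrite -/(A _) (_ : (fun n => _) = fun n => (fine (P n (A n)))%:E); last first.
  by apply/funext => n; rewrite fineK// fin_num_measure.
apply: cvg_EFin; first exact: nearW.
apply: (@seq_cvg_of_bound _ _ _ K) => sg sg01.
have [U UK HU] := H ep sg ep0 sg01; exists U => // n n0; rewrite subr0 /=.
have [G [hG G0 AG GU]] := HU n n0.
rewrite -Ex_indic// ger0_norm; last first.
  by apply: Rintegral_ge0 => w _; rewrite indicE ler0n.
apply: le_trans GU; apply: Ex_le => //; first exact: momfin_indic.
move=> w; rewrite indicE; have [/set_mem wA|_] := boolP (w \in A n); last exact: G0.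
exact: AG.
Qed.

End slutsky.

(** * Rotationally symmetric laws *)

Section law_equality.
Context (R : realType).
Local Notation RB := (measurableTypeR R).

Lemma eq_rays_eq_measure (m1 m2 : probability RB R) :
  (forall x : R, m1 `]-oo, x]%classic = m2 `]-oo, x]%classic) ->
  forall A : set RB, measurable A -> m1 A = m2 A.
Proof.
move=> H A mA.
have mray (x : R) : measurable (`]-oo, x]%classic : set RB) by exact: measurable_itv.
pose n1 : {measure set RB -> \bar R} := m1.
pose n2 : {measure set RB -> \bar R} := m2.
suff : n1 A = n2 A by [].
have mG : (measurable : set (set RB)) = <<s @ocitv R >> by [].
have Gg n : @ocitv R (`]- n%:R, n%:R]%classic : set RB) by exists (- n%:R, n%:R).
have cover : \bigcup_n (`]- n%:R, n%:R]%classic : set RB) = setT.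
  apply/seteqP; split => // x _; exists (Num.truncn `|x|).+1 => //=.
  rewrite in_itv/=; have : `|x| < (Num.truncn `|x|).+1%:R by exact: truncnS_gt.
  by rewrite ltr_norml => /andP[-> /ltW].
have agree B : @ocitv R B -> n1 B = n2 B.
  move=> [[a b] _ <-] /=.
  have [ab|ba] := leP a b; last by rewrite set_itv_ge ?measure0// bnd_simp -leNgt ltW.
  have E (m : probability RB R) : m `]a, b]%classic = (m `]-oo, b]%classic - m `]-oo, a]%classic)%E.
    have -> : `]a, b]%classic = `]-oo, b]%classic `\` `]-oo, a]%classic :> set RB.
      apply/seteqP; split => x /=; rewrite !in_itv/=.
        by move=> /andP[ax ->]; split => //; apply/negP; rewrite -ltNge.
      by move=> [-> /negP]; rewrite -ltNge => ->.
    rewrite measureD//; last by rewrite -ge0_fin_numE ?fin_num_measure.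
    congr (_ - m _)%E; apply: setIidr => x /=.
    by rewrite !in_itv/= => /le_trans; apply.
  by rewrite -[n1 _]/(m1 _) -[n2 _]/(m2 _) !E !H.
have fin k : (n1 ((`]- k%:R, k%:R]%classic : set RB)%R) < +oo)%E.
  by rewrite -ge0_fin_numE//; apply: (@fin_num_measure _ _ _ m1); exact: measurable_itv.
exact: (@measure_unique _ R RB _ _ mG (@ocitvI R) Gg cover n1 n2 agree fin A mA).
Qed.

Lemma Rintegral_eq_law d1 d2 d3 (T1 : measurableType d1) (T2 : measurableType d2)
    (S : measurableType d3) (P1 : probability T1 R) (P2 : probability T2 R)
    (X1 : T1 -> S) (X2 : T2 -> S) (f : S -> R) :
  measurable_fun setT X1 -> measurable_fun setT X2 ->
  (forall A, measurable A -> P1 (X1 @^-1` A) = P2 (X2 @^-1` A)) ->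
  measurable_fun setT f ->
  \int[P1]_w f (X1 w) = \int[P2]_w f (X2 w).
Proof.
move=> mX1 mX2 H mf; apply: Rintegral_same_law => // g mg g0.
pose m1 := measure_function_pushforward__canonical__measure_function_Measure P1 mX1.
pose m2 := measure_function_pushforward__canonical__measure_function_Measure P2 mX2.
transitivity (\int[m1]_x g x)%E; first by rewrite ge0_integral_pushforward.
transitivity (\int[m2]_x g x)%E; last by rewrite ge0_integral_pushforward.
by apply: eq_measure_integral => A mA _; exact: H.
Qed.

(** Through this the common [F] of a row gives all its terms the same axial moments. *)
Lemma Rintegral_eq_cdf d1 d2 (T1 : measurableType d1) (T2 : measurableType d2)
    (P1 : probability T1 R) (P2 : probability T2 R) (X1 : T1 -> R) (X2 : T2 -> R)
    (f : R -> R) :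
  measurable_fun setT X1 -> measurable_fun setT X2 ->
  (forall x, P1 [set w | X1 w <= x] = P2 [set w | X2 w <= x]) ->
  measurable_fun setT f ->
  \int[P1]_w f (X1 w) = \int[P2]_w f (X2 w).
Proof.
move=> mX1 mX2 H mf.
have mX1' : measurable_fun setT (X1 : T1 -> RB) by [].
have mX2' : measurable_fun setT (X2 : T2 -> RB) by [].
apply: (@Rintegral_eq_law _ _ _ _ _ RB P1 P2 X1 X2) => // A mA.
pose Y1 : {mfun T1 >-> RB} := HB.pack X1 (isMeasurableFun.Build _ _ _ _ _ mX1').
pose Y2 : {mfun T2 >-> RB} := HB.pack X2 (isMeasurableFun.Build _ _ _ _ _ mX2').
apply: (@eq_rays_eq_measure (distribution P1 Y1) (distribution P2 Y2)); last exact: mA.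
move=> x; have E d (T : measurableType d) (X : T -> R) :
    X @^-1` `]-oo, x]%classic = [set w | X w <= x].
  by apply/seteqP; split => w /=; rewrite in_itv.
transitivity (P1 [set w | X1 w <= x]); first by rewrite -E.
by rewrite H -E.
Qed.

End law_equality.

(** * Inner products and reflections *)

Section dotv_theory.
Context (R : realType) (p : nat).
Implicit Types (x y z v : 'cV[R]_p) (O H : 'M[R]_p).

Lemma dotvE x y : dotv x y = \sum_(i < p) x i 0 * y i 0.
Proof. by rewrite /dotv mxE; apply: eq_bigr => i _; rewrite mxE. Qed.

Lemma dotvC x y : dotv x y = dotv y x.
Proof. by rewrite !dotvE; apply: eq_bigr => i _; rewrite mulrC. Qed.

Lemma dotvDr x y z : dotv x (y + z) = dotv x y + dotv x z.
Proof. by rewrite /dotv mulmxDr mxE. Qed.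

Lemma dotvZr (a : R) x y : dotv x (a *: y) = a * dotv x y.
Proof. by rewrite /dotv -scalemxAr mxE. Qed.

Lemma dotvNr x y : dotv x (- y) = - dotv x y.
Proof. by rewrite -scaleN1r dotvZr mulN1r. Qed.

Lemma dotvBr x y z : dotv x (y - z) = dotv x y - dotv x z.
Proof. by rewrite dotvDr dotvNr. Qed.

Lemma dotvDl x y z : dotv (y + z) x = dotv y x + dotv z x.
Proof. by rewrite dotvC dotvDr !(dotvC x). Qed.

Lemma dotvZl (a : R) x y : dotv (a *: y) x = a * dotv y x.
Proof. by rewrite dotvC dotvZr (dotvC x). Qed.

Lemma dotvNl x y : dotv (- y) x = - dotv y x.
Proof. by rewrite dotvC dotvNr (dotvC x). Qed.

Lemma dotvBl x y z : dotv (y - z) x = dotv y x - dotv z x.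
Proof. by rewrite dotvDl dotvNl. Qed.

Lemma dotv0r x : dotv x 0 = 0.
Proof. by rewrite /dotv mulmx0 mxE. Qed.

Lemma dotv_sumr (I : Type) (s : seq I) x (F : I -> 'cV[R]_p) :
  dotv x (\sum_(i <- s) F i) = \sum_(i <- s) dotv x (F i).
Proof. by apply: (big_morph (dotv x)); [exact: dotvDr|exact: dotv0r]. Qed.

Lemma dotv_ge0 x : 0 <= dotv x x.
Proof. by rewrite dotvE sumr_ge0// => i _; rewrite -expr2 sqr_ge0. Qed.

Lemma dotv_eq0 x : (dotv x x == 0) = (x == 0).
Proof.
apply/idP/eqP => [|->]; last by rewrite dotv0r eqxx.
rewrite dotvE psumr_eq0; last by move=> i _; rewrite -expr2 sqr_ge0.
move=> /allP H; apply/colP => i; rewrite mxE.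
have := H i (mem_index_enum i); rewrite /= -expr2 sqrf_eq0 => /eqP.
by [].
Qed.

Lemma enorm_sqr x : enorm x ^+ 2 = dotv x x.
Proof. by rewrite /enorm sqr_sqrtr// dotv_ge0. Qed.

Lemma unit_sphereE x : unit_sphere x <-> dotv x x = 1.
Proof.
rewrite /unit_sphere /=; split => [x1|x1]; first by rewrite -enorm_sqr x1 expr1n.
by rewrite /enorm x1 sqrtr1.
Qed.

Lemma dotv_orth O x y : orthogonal_mx O -> dotv (O *m x) (O *m y) = dotv x y.
Proof. by move=> OO; rewrite /dotv trmx_mul -mulmxA (mulmxA O^T) OO mul1mx. Qed.

Lemma orthogonal_mul O H : orthogonal_mx O -> orthogonal_mx H -> orthogonal_mx (O *m H).
Proof. by move=> OO HH; rewrite /orthogonal_mx trmx_mul -mulmxA (mulmxA O^T) OO mul1mx. Qed.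

Lemma orthogonal_trmx O : orthogonal_mx O -> O *m O^T = 1%:M.
Proof. exact: mulmx1C. Qed.

Lemma normr_dotv_le1 x y : dotv x x = 1 -> dotv y y = 1 -> `|dotv x y| <= 1.
Proof.
move=> x1 y1.
have := dotv_ge0 (x + y); have := dotv_ge0 (x - y).
rewrite dotvBl !dotvBr dotvDl !dotvDr x1 y1 (dotvC y x) ler_norml; lra.
Qed.

Lemma mul_col_dotv v z : v *m (v^T *m z) = dotv v z *: v.
Proof. by rewrite [v^T *m z]mx11_scalar mul_mx_scalar. Qed.

(** The reflection along [x - y], or the identity when [x = y]. With [y = - x] it reverses a
    direction; the clause on [z] is what keeps [theta] fixed. *)
Lemma householder x y : dotv x x = dotv y y ->
  exists H, [/\ orthogonal_mx H, H *m x = y &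
    forall z, dotv z x = 0 -> dotv z y = 0 -> H *m z = z].
Proof.
move=> xy; have [->|xNy] := eqVneq x y.
  by exists 1%:M; split => [||z _ _]; rewrite ?mul1mx// /orthogonal_mx trmx1 mulmx1.
pose v := x - y; pose k := 2 / dotv v v.
have vv0 : dotv v v != 0 by rewrite dotv_eq0 subr_eq0.
pose H := 1%:M - k *: (v *m v^T).
have HE z : H *m z = z - (k * dotv v z) *: v.
  by rewrite /H mulmxBl mul1mx -scalemxAl -mulmxA mul_col_dotv scalerA.
have HT : H^T = H.
  by rewrite /H linearB/= trmx1 linearZ/= trmx_mul trmxK.
exists H; split.
- rewrite /orthogonal_mx HT.
  have vvT : v *m v^T *m (v *m v^T) = dotv v v *: (v *m v^T).
    by rewrite mulmxA -(mulmxA v) mul_col_dotv -scalemxAl.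
  rewrite {1}/H mulmxBl mul1mx -scalemxAl /H mulmxBr mulmx1 -scalemxAr vvT scalerA.
  rewrite scalerBr scalerA opprB addrA.
  have -> : k * (k * dotv v v) = k + k by rewrite /k; field.
  by rewrite scalerDl; rewrite addrA subrK addrK.
- rewrite HE; have vx : dotv v v = 2 * dotv v x.
    by rewrite /v dotvBr !dotvBl (dotvC y x) xy; ring.
  have -> : k * dotv v x = 1.
    by move: vv0; rewrite /k vx => vv0; rewrite invfM; field; move: vv0; rewrite mulf_eq0 negb_or => /andP[].
  by rewrite scale1r /v subKr.
- move=> z zx zy; rewrite HE (dotvC v) /v dotvBr zx zy subrr mulr0 scale0r subr0.
  by [].
Qed.

End dotv_theory.

Section colvec_measurable.
Context (R : realType) (p : nat).
Local Notation RB := (measurableTypeR R).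

Lemma measurable_colvec_coord (i : 'I_p) : measurable_fun [set: 'cV[R]_p] (fun x => x i 0).
Proof.
move=> _ Y mY; rewrite setTI; apply: sub_sigma_algebra => /=.
rewrite -bigcup_seq/=; exists i => /=; first by rewrite mem_index_enum.
by exists Y => //; rewrite setTI.
Qed.

Lemma measurable_dotv (v : 'cV[R]_p) : measurable_fun [set: 'cV[R]_p] (dotv v).
Proof.
rewrite (_ : dotv v = fun x => \sum_(i < p) v i 0 * x i 0); last first.
  by apply/funext => x; rewrite dotvE.
apply: (@measurable_sum _ _ R) => i; apply: measurable_funM => //.
exact: measurable_colvec_coord.
Qed.

End colvec_measurable.

(** * Mean and second moments under rotational symmetry *)

Section rotsym_moments.
Context (R : realType) (m : nat) (d : measure_display) (T : measurableType d)
  (P : probability T R) (X : {RV P >-> 'cV[R]_m.+2}) (theta : 'cV[R]_m.+2).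
Hypothesis theta1 : unit_sphere theta.
Hypothesis rotX : rotationally_symmetric X theta.

Let XX w : dotv (X w) (X w) = 1.
Proof. by have [H _] := rotX; apply/unit_sphereE. Qed.

Let tt : dotv theta theta = 1.
Proof. exact/unit_sphereE. Qed.

Let mX : measurable_fun setT X := measurable_funPT X.

Lemma momfin_dotv v : momfin P (fun w => dotv v (X w)).
Proof.
have m1 : measurable_fun setT (fun w => dotv v (X w)).
  exact: (measurableT_comp (measurable_dotv v) mX).
apply: (@momfin_bounded _ _ _ _ _ (dotv v v + 1)) => // w.
have := dotv_ge0 (v + X w); have := dotv_ge0 (v - X w); have := dotv_ge0 v.
rewrite dotvBl !dotvBr dotvDl !dotvDr XX (dotvC (X w) v) ler_norml; lra.
Qed.

Lemma rotsym_invariance (O : 'M[R]_m.+2) (g : 'cV[R]_m.+2 -> R) :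
  orthogonal_mx O -> O *m theta = theta ->
  measurable_fun setT g -> measurable_fun setT (fun x => g (O *m x)) ->
  \int[P]_w g (O *m X w) = \int[P]_w g (X w).
Proof.
move=> OO Ot mg mgO.
apply: (@Rintegral_eq_law R _ _ _ T T (measurableTypeR R) P P (fun w => g (O *m X w)) (fun w => g (X w)) id) => //.
- exact: (measurableT_comp mgO mX).
- exact: (measurableT_comp mg mX).
- move=> A mA; have [_ H] := rotX; apply: (H O OO Ot (g @^-1` A)).
  by rewrite -[X in measurable X]setTI; exact: mg.
Qed.

Let m_dotvO v (O : 'M[R]_m.+2) : measurable_fun setT (fun x => dotv v (O *m x)).
Proof.
rewrite (_ : (fun x => _) = dotv (O^T *m v)); first exact: measurable_dotv.
by apply/funext => x; rewrite /dotv trmx_mul trmxK mulmxA.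
Qed.

Let reflect_fix (v w : 'cV[R]_m.+2) : dotv v theta = 0 -> dotv w theta = 0 ->
  dotv v v = dotv w w -> exists H, [/\ orthogonal_mx H, H *m theta = theta, H *m v = w &
    forall z, dotv z v = 0 -> dotv z w = 0 -> H *m z = z].
Proof.
move=> vt wt vw; have [H [HO Hv Hz]] := householder vw.
by exists H; split => //; apply: Hz; rewrite dotvC.
Qed.

(** Only the component along [w] changes sign, so every moment odd in it vanishes. *)
Let orth_neg (w : 'cV[R]_m.+2) : dotv w theta = 0 ->
  exists H, [/\ orthogonal_mx H, H *m theta = theta,
    forall x, dotv w (H *m x) = - dotv w x &
    forall z x, dotv z w = 0 -> dotv z (H *m x) = dotv z x].
Proof.
move=> wt; have wt' : dotv (- w) theta = 0 by rewrite dotvNl wt oppr0.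
have [|H [HO Ht Hw Hz]] := @reflect_fix w (- w) wt wt'.
  by rewrite dotvNl dotvNr opprK.
exists H; split => // [x|z x zw].
  have Hw' : H *m (- w) = w by rewrite mulmxN Hw opprK.
  by rewrite -{1}Hw' dotv_orth// dotvNl.
by rewrite -{1}(Hz z) ?dotv_orth// dotvNr zw oppr0.
Qed.

Let orth_mean (w : 'cV[R]_m.+2) : dotv w theta = 0 -> \int[P]_x dotv w (X x) = 0.
Proof.
move=> wt; have [H [HO Ht Hw _]] := orth_neg wt.
have := rotsym_invariance HO Ht (measurable_dotv w) (m_dotvO w H).
rewrite (_ : \int[P]_x dotv w (H *m X x) = -1 * \int[P]_x dotv w (X x)); first by lra.
by rewrite -ExZ; [apply: eq_Rintegral => x _; rewrite Hw mulN1r|exact: momfin_dotv].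
Qed.

Let orth_cross (w z : 'cV[R]_m.+2) : dotv w theta = 0 -> dotv z w = 0 ->
  \int[P]_x (dotv w (X x) * dotv z (X x)) = 0.
Proof.
move=> wt zw; have [H [HO Ht Hw Hz]] := orth_neg wt.
have mg : measurable_fun setT (fun x : 'cV[R]_m.+2 => dotv w x * dotv z x).
  by apply: measurable_funM; exact: measurable_dotv.
have mgH : measurable_fun setT (fun x => dotv w (H *m x) * dotv z (H *m x)).
  by apply: measurable_funM; exact: m_dotvO.
have := rotsym_invariance HO Ht mg mgH => /=.
rewrite (_ : \int[P]_x (dotv w (H *m X x) * dotv z (H *m X x)) =
   -1 * \int[P]_x (dotv w (X x) * dotv z (X x))); first by lra.
rewrite -ExZ; last by apply: momfinM; exact: momfin_dotv.
by apply: eq_Rintegral => x _; rewrite Hw Hz// mulN1r mulNr.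
Qed.

Let orth_sq (v w : 'cV[R]_m.+2) : dotv v theta = 0 -> dotv w theta = 0 ->
  dotv v v = dotv w w ->
  \int[P]_x (dotv v (X x) ^+ 2) = \int[P]_x (dotv w (X x) ^+ 2).
Proof.
move=> vt wt vw; have [H [HO Ht Hv _]] := reflect_fix vt wt vw.
have mg : measurable_fun setT (fun x : 'cV[R]_m.+2 => dotv w x ^+ 2).
  by apply: measurable_funX; exact: measurable_dotv.
have mgH : measurable_fun setT (fun x => dotv w (H *m x) ^+ 2).
  by apply: measurable_funX; exact: m_dotvO.
rewrite -(rotsym_invariance HO Ht mg mgH); apply: eq_Rintegral => x _.
by rewrite -Hv dotv_orth.
Qed.

Definition rot_mean : R := \int[P]_x dotv theta (X x).
Definition rot_m2 : R := \int[P]_x (dotv theta (X x) ^+ 2).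
(* Second moment of [X] along a unit vector orthogonal to [theta]. *)
Definition rot_c : R := (1 - rot_m2) / m.+1%:R.

(** In an orthonormal basis starting with [theta], the [m.+1] tangential second moments are equal by
    [orth_sq], and together they make up [1 - rot_m2], since [X] has norm 1. *)
Let orth_var (w : 'cV[R]_m.+2) : dotv w theta = 0 ->
  \int[P]_x (dotv w (X x) ^+ 2) = dotv w w * rot_c.
Proof.
move=> wt.
pose e (j : 'I_m.+2) : 'cV[R]_m.+2 := delta_mx j 0.
have ee j x : dotv (e j) x = x j 0.
  rewrite dotvE (bigD1 j)//= mxE !eqxx mul1r big1 ?addr0// => i /negbTE ij.
  by rewrite mxE ij mul0r.
have [|Q [QO Qt _]] := @householder R _ theta (e 0); first by rewrite ee mxE !eqxx.
pose r j := Q^T *m e j.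
have rE j x : dotv (r j) x = (Q *m x) j 0.
  by rewrite -ee /dotv trmx_mul trmxK mulmxA.
have r0 : r 0 = theta by rewrite /r -Qt mulmxA QO mul1mx.
have rt j : j != 0 -> dotv (r j) theta = 0.
  by move=> /negbTE j0; rewrite rE Qt mxE j0.
have QT : orthogonal_mx Q^T by rewrite /orthogonal_mx trmxK; exact: orthogonal_trmx.
have rr j : dotv (r j) (r j) = 1 by rewrite dotv_orth// ee mxE !eqxx.
pose c' := \int[P]_x (dotv (r (lift 0 0)) (X x) ^+ 2).
have cE (j : 'I_m.+1) : \int[P]_x (dotv (r (lift 0 j)) (X x) ^+ 2) = c'.
  by apply: orth_sq; rewrite ?rt ?rr.
have h2 v : momfin P (fun x => dotv v (X x) ^+ 2) by apply: momfinX; exact: momfin_dotv.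
have total : 1 = rot_m2 + m.+1%:R * c'.
  transitivity (\int[P]_x \sum_(j < m.+2) dotv (r j) (X x) ^+ 2).
    rewrite -[LHS](Ex_cst P); apply: eq_Rintegral => x _.
    by rewrite -(XX x) -(dotv_orth _ _ QO) dotvE; apply: eq_bigr => j _; rewrite rE.
  rewrite Ex_sum// big_ord_recl r0 -/rot_m2; congr (_ + _).
  by rewrite (eq_bigr (fun=> c')) ?sumr_const ?card_ord ?mulr_natl.
have -> : rot_c = c'.
  by rewrite /rot_c {1}total addrC addKr mulrC mulKf// pnatr_eq0.
rewrite (@orth_sq w (enorm w *: r (lift 0 0)))//; last 2 first.
- by rewrite dotvZl rt ?mulr0.
- by rewrite dotvZl dotvZr rr mulr1 -expr2 enorm_sqr.
rewrite -enorm_sqr -ExZ//; apply: eq_Rintegral => x _.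
by rewrite dotvZl exprMn.
Qed.

Lemma rotsym_mean v : \int[P]_x dotv v (X x) = dotv v theta * rot_mean.
Proof.
pose w := v - dotv v theta *: theta.
have wt : dotv w theta = 0 by rewrite dotvBl dotvZl tt mulr1 subrr.
transitivity (\int[P]_x (dotv v theta * dotv theta (X x) + dotv w (X x))).
  by apply: eq_Rintegral => x _; rewrite /w dotvBl dotvZl addrC subrK.
rewrite ExD; [|by apply: momfinZ; exact: momfin_dotv|exact: momfin_dotv].
by rewrite (orth_mean wt) addr0 ExZ//; exact: momfin_dotv.
Qed.

Let rotsym_sq v : \int[P]_x (dotv v (X x) ^+ 2) =
  dotv v theta ^+ 2 * rot_m2 + rot_c * (dotv v v - dotv v theta ^+ 2).
Proof.
pose w := v - dotv v theta *: theta.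
have wt : dotv w theta = 0 by rewrite dotvBl dotvZl tt mulr1 subrr.
have hd u := momfin_dotv u.
have h2 u : momfin P (fun x => dotv u (X x) ^+ 2) by apply: momfinX.
have hc : momfin P (fun x => dotv w (X x) * dotv theta (X x)) by exact: momfinM.
transitivity (\int[P]_x (dotv v theta ^+ 2 * dotv theta (X x) ^+ 2 +
   (2 * dotv v theta * (dotv w (X x) * dotv theta (X x)) + dotv w (X x) ^+ 2))).
  apply: eq_Rintegral => x _.
  have -> : dotv v (X x) = dotv v theta * dotv theta (X x) + dotv w (X x).
    by rewrite /w dotvBl dotvZl addrC subrK.
  ring.
rewrite ExD; [|exact: momfinZ|by apply: momfinD => //; exact: momfinZ].
rewrite ExD//; last exact: momfinZ.
have tw : dotv theta w = 0 by rewrite dotvC.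
rewrite !ExZ// (orth_cross wt tw) (orth_var wt) -/rot_m2.
rewrite mulr0 add0r [dotv w w * _]mulrC; congr (_ + _ * _).
by rewrite /w dotvBl !dotvBr !dotvZl !dotvZr tt (dotvC theta v); ring.
Qed.

(** Polarization of [rotsym_sq]. *)
Lemma rotsym_cov v w : \int[P]_x (dotv v (X x) * dotv w (X x)) =
  dotv v theta * dotv w theta * rot_m2 +
  rot_c * (dotv v w - dotv v theta * dotv w theta).
Proof.
have h2 u : momfin P (fun x => dotv u (X x) ^+ 2) by apply: momfinX; exact: momfin_dotv.
transitivity (\int[P]_x (2^-1 * (dotv (v + w) (X x) ^+ 2 - (dotv v (X x) ^+ 2 + dotv w (X x) ^+ 2)))).
  by apply: eq_Rintegral => x _; rewrite dotvDl; field.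
rewrite ExZ; last by apply: momfinB => //; exact: momfinD.
rewrite ExB//; last exact: momfinD.
rewrite ExD// !rotsym_sq !dotvDl !dotvDr (dotvC w v); by field.
Qed.

End rotsym_moments.

Section cos_moments.
Context (R : realType) (p : nat) (d : measure_display) (T : measurableType d)
  (P : probability T R) (X : {RV P >-> 'cV[R]_p}) (theta : 'cV[R]_p).

Lemma cos_meanE : momfin P (fun w => dotv (X w) theta) ->
  cos_mean X theta = \int[P]_w dotv theta (X w).
Proof.
move=> h; rewrite /cos_mean expectation_Ex//=.
by apply: eq_Rintegral => w _; rewrite dotvC.
Qed.

Lemma cos_varE : momfin P (fun w => dotv (X w) theta) ->
  cos_var X theta = \int[P]_w (dotv theta (X w) ^+ 2) - cos_mean X theta ^+ 2.
Proof.
move=> h; have h2 : momfin P (fun w => dotv (X w) theta ^+ 2) by exact: momfinX.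
have hm : 'E_P[fun w => dotv (X w) theta]%E = (cos_mean X theta)%:E.
  by rewrite /cos_mean expectation_Ex.
rewrite /cos_var /variance unlock hm /=; set e := cos_mean X theta.
have -> : (((fun w => dotv (X w) theta) \- cst e) * ((fun w => dotv (X w) theta) \- cst e))
    = (fun w => dotv (X w) theta ^+ 2 - (2 * e * dotv (X w) theta - e ^+ 2)).
  by apply/funext => w; rewrite !fctE /=; ring.
have h3 : momfin P (fun w => 2 * e * dotv (X w) theta - e ^+ 2).
  by apply: momfinB; [exact: momfinZ|exact: momfin_cst].
rewrite expectation_Ex/=; last exact: momfinB.
rewrite ExB// ExB; [|exact: momfinZ|exact: momfin_cst].
rewrite ExZ// Ex_cst.
have -> : \int[P]_w dotv (X w) theta = e.
  by rewrite /e cos_meanE//; apply: eq_Rintegral => w _; rewrite dotvC.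
have -> : \int[P]_w dotv (X w) theta ^+ 2 = \int[P]_w dotv theta (X w) ^+ 2.
  by apply: eq_Rintegral => w _; rewrite dotvC.
ring.
Qed.

End cos_moments.

(** * The test statistics *)

Lemma measurable_funV_total (R : realType) d (T : measurableType d) (f : T -> R) :
  measurable_fun setT f -> measurable_fun setT (fun x => (f x)^-1).
Proof.
apply: measurableT_comp; rewrite -(setvU [set 0]).
apply/measurable_funU; [exact: measurableC|exact: measurable_set1|split].
  apply: open_continuous_measurable_fun; first by apply: closed_openC; exact: (@closed_eq R 0).
  by move=> x; rewrite inE => /eqP x0; exact: inv_continuous.
exact: measurable_fun_set1.
Qed.

Section statistics_algebra.
Context (R : realType) (p : nat) (theta0 : 'cV[R]_p).
Variables (n : nat) (x : nat -> 'cV[R]_p).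

Definition axial_stat : R := Num.sqrt n%:R * dotv theta0 (sample_mean n x).

Definition tangent_stat : R :=
  n%:R * dotv (sample_mean n x) (tangent_proj theta0 *m sample_mean n x).

Lemma dotv_tangent_proj y :
  dotv y (tangent_proj theta0 *m y) = dotv y y - dotv theta0 y ^+ 2.
Proof.
rewrite /tangent_proj mulmxBl mul1mx -mulmxA mul_col_dotv dotvBr dotvZr.
by rewrite (dotvC y).
Qed.

Lemma W_statE : W_stat theta0 n x =
  (p%:R - 1) * tangent_stat / (1 - cos_second_moment theta0 n x).
Proof. by rewrite /W_stat /tangent_stat; congr (_ / _); ring. Qed.

(** The squared norm of the sample mean is the sum of its axial and tangential parts, which turns
    the normalization of [spherical_mean] into the denominator [axial_stat ^+ 2 + tangent_stat]. *)
Lemma S_statE : S_stat theta0 n x =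
  (p%:R - 1) * (axial_stat ^+ 2 * tangent_stat / (axial_stat ^+ 2 + tangent_stat))
  / (1 - cos_second_moment theta0 n x).
Proof.
rewrite /S_stat; congr (_ / _); rewrite /axial_stat /tangent_stat /spherical_mean.
set y := sample_mean n x.
have -> : dotv ((enorm y)^-1 *: y) (tangent_proj theta0 *m ((enorm y)^-1 *: y)) =
    (dotv y y)^-1 * dotv y (tangent_proj theta0 *m y).
  by rewrite -scalemxAr dotvZl dotvZr -enorm_sqr -exprVn mulrA expr2.
rewrite dotv_tangent_proj.
rewrite (dotvC y theta0) exprMn sqr_sqrtr ?ler0n// -mulrDr [_ ^+ 2 + (_ - _)]addrC subrK invfM.
set D := (dotv y y)^-1; set a := dotv theta0 y; set Y := dotv y y.
(* For [n = 0] the factor [n / n] is 0 and not 1, but both sides vanish. *)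
have [->|n0] := eqVneq (n%:R : R) 0; first by rewrite !mul0r !mulr0.
transitivity (n%:R * (p%:R - 1) * a ^+ 2 * D * (Y - a ^+ 2) * (n%:R * n%:R^-1)); last by ring.
by rewrite divff//; ring.
Qed.

End statistics_algebra.

(** Two reflections: one sends [theta0] to the first basis vector, the other sends the tangential
    part of [t] to the second axis and leaves the first basis vector in place. The tangential
    coordinates of [t] are then literally the mean vector in the definition of [chi2], so that its
    invariance under rotations of the mean does not come up. *)
Lemma adapted_basis (R : realType) (m : nat) (theta0 t : 'cV[R]_m.+2) :
  dotv theta0 theta0 = 1 ->
  exists v : 'I_m.+2 -> 'cV[R]_m.+2, [/\ forall j k, dotv (v j) (v k) = (j == k)%:R,
    v ord0 = theta0, forall y, dotv y y = \sum_j dotv (v j) y ^+ 2 &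
    forall j : 'I_m.+1, dotv (v (lift ord0 j)) t =
      chi2_mean (dotv t t - dotv theta0 t ^+ 2) j].
Proof.
move=> t01.
pose e (j : 'I_m.+2) : 'cV[R]_m.+2 := delta_mx j 0.
have ey j x : dotv (e j) x = x j 0.
  rewrite dotvE (bigD1 j)//= mxE !eqxx mul1r big1 ?addr0// => i /negbTE ij.
  by rewrite mxE ij mul0r.
have ee j k : dotv (e j) (e k) = (j == k)%:R by rewrite ey mxE eqxx andbT.
have [|H1 [H1O H1t _]] := @householder R _ theta0 (e 0).
  by rewrite t01 ee eqxx.
pose u := H1 *m t; pose u0 := dotv (e 0) u; pose u' := u - u0 *: e 0.
have u0E : u0 = dotv theta0 t by rewrite /u0 -H1t dotv_orth.
have eu' : dotv (e 0) u' = 0 by rewrite /u' dotvBr dotvZr ee eqxx mulr1 subrr.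
have uu' : dotv u' u' = dotv t t - dotv theta0 t ^+ 2.
  rewrite {1}/u' dotvBl dotvZl eu' mulr0 subr0 /u' dotvBr dotvZr (dotvC u (e 0)) -/u0.
  by rewrite u0E /u dotv_orth// expr2.
pose r := Num.sqrt (dotv t t - dotv theta0 t ^+ 2).
have rr : r * r = dotv u' u' by rewrite -expr2 /r -uu' sqr_sqrtr// dotv_ge0.
pose i1 : 'I_m.+2 := lift ord0 ord0.
have [|H2 [H2O H2u H2z]] := @householder R _ u' (r *: e i1).
  by rewrite dotvZl dotvZr ee eqxx mulr1 rr.
have H2e : H2 *m e 0 = e 0 by apply: H2z => //; rewrite dotvZr ee mulr0.
pose O := H2 *m H1.
have OO : orthogonal_mx O by exact: orthogonal_mul.
have Ot0 : O *m theta0 = e 0 by rewrite /O -mulmxA H1t.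
have Ott : O *m t = r *: e i1 + u0 *: e 0.
  rewrite /O -mulmxA -/u -[u in LHS](subrK (u0 *: e 0)) mulmxDr H2u.
  by rewrite -scalemxAr H2e.
have ve j y : dotv (O^T *m e j) y = (O *m y) j 0.
  by rewrite -ey /dotv trmx_mul trmxK mulmxA.
exists (fun j => O^T *m e j); split.
- move=> j k; rewrite dotv_orth ?ee// /orthogonal_mx trmxK.
  exact: orthogonal_trmx.
- by rewrite -Ot0 mulmxA OO mul1mx.
- move=> y; rewrite -(dotv_orth y y OO) dotvE; apply: eq_bigr => j _.
  by rewrite ve expr2.
- move=> j; rewrite ve Ott !mxE /chi2_mean -/r eqxx !andbT.
  rewrite [_ == 0]/(_ == _ :> nat) /= mulr0 addr0.
  have -> : (lift ord0 j == i1) = (val j == 0%N).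
    by rewrite /i1 (inj_eq lift_inj).
  by case: eqP; rewrite ?mulr1 ?mulr0.
Qed.

Section harmonic.
Context (R : realType).

(* [harm 0 0 = 0], in agreement with [S_stat] when the sample mean vanishes. *)
Definition harm (a b : R) : R := a * b / (a + b).

Lemma harm_ge0 a b : 0 <= a -> 0 <= b -> 0 <= harm a b.
Proof. by move=> a0 b0; rewrite divr_ge0 ?addr_ge0 ?mulr_ge0. Qed.

Lemma harmC a b : harm a b = harm b a.
Proof. by rewrite /harm [a * b]mulrC [a + b]addrC. Qed.

Lemma harm_le a b : 0 <= a -> 0 <= b -> harm a b <= b.
Proof.
move=> a0; rewrite le0r => /orP[/eqP->|b0]; first by rewrite /harm mulr0 mul0r.
have ab : 0 < a + b by rewrite ltr_wpDl.
by rewrite /harm ler_pdivrMr// mulrC ler_pM2l// lerDl ltW.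
Qed.

Lemma harmZ k a b : k != 0 -> harm (k * a) (k * b) = k * harm a b.
Proof.
move=> k0; rewrite /harm -mulrDr invfM.
transitivity (k * (a * b * (a + b)^-1) * (k * k^-1)); first by ring.
by rewrite divff ?mulr1.
Qed.

(** The increment is [a - a'] times [b^2 / ((a + b) (a' + b))], a factor at most 1. *)
Let harm_lip1 a a' b : 0 <= a -> 0 <= a' -> 0 <= b ->
  `|harm a b - harm a' b| <= `|a - a'|.
Proof.
move=> a0 a'0; rewrite le0r => /orP[/eqP->|b0].
  by rewrite /harm !mulr0 !mul0r subrr normr0.
have ab : 0 < a + b by rewrite ltr_wpDl.
have ab' : 0 < a' + b by rewrite ltr_wpDl.
have -> : harm a b - harm a' b = (a - a') * (b * b / ((a + b) * (a' + b))).
  by rewrite /harm; field; rewrite !lt0r_neq0.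
rewrite normrM ler_piMr// ger0_norm; last by rewrite divr_ge0 ?mulr_ge0 ?ltW.
by rewrite ler_pdivrMr ?mulr_gt0// mul1r ler_pM ?(ltW b0)// lerDr.
Qed.

(** Being Lipschitz up to the boundary of the quadrant, [harm] makes the numerator of [S_stat] a
    Lipschitz function of the squared coordinates, within reach of [clt_sq_lipschitz]. *)
Lemma harm_lip a b a' b' : 0 <= a -> 0 <= a' -> 0 <= b -> 0 <= b' ->
  `|harm a b - harm a' b'| <= `|a - a'| + `|b - b'|.
Proof.
move=> a0 a'0 b0 b'0.
have -> : harm a b - harm a' b' = (harm a b - harm a' b) + (harm b a' - harm b' a').
  by rewrite ![harm b _]harmC ![harm b' _]harmC; ring.
by rewrite (le_trans (ler_normD _ _))// lerD// harm_lip1.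
Qed.

End harmonic.

Section chi2_theory.
Context (R : realType).
Local Notation RB := (measurableTypeR R).

Lemma chi2_meanZ m (k x : R) (j : 'I_m) : 0 <= k ->
  k * chi2_mean x j = chi2_mean (k ^+ 2 * x) j.
Proof.
move=> k0; rewrite /chi2_mean; case: ifP => _; last by rewrite mulr0.
by rewrite sqrtrM ?sqr_ge0// sqrtr_sqr ger0_norm.
Qed.

Lemma Rintegral_chi2 m (lam : R) (f : RB -> R) : measurable_fun setT f ->
  \int[chi2 m lam]_q f q =
  \int[std_normal_vec R m]_y f (shifted_sqnorm (chi2_mean lam) y).
Proof.
move=> mf.
apply: (@Rintegral_same_law R _ _ _ _ _ _ (chi2 m lam) (std_normal_vec R m) id) => // g mg g0.
by rewrite ge0_integral_distribution.
Qed.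

(** The independence of the two limit variables comes from the product structure of
    [std_normal_vec R m.+1]: its first coordinate supplies [Z], the others [Q]. *)
Lemma Rintegral_normal_chi2 m (lam : R) (f : RB * RB -> R) : measurable_fun setT f ->
  \int[(normal_prob (0 : R) 1 \x chi2 m lam)%E]_zq f zq =
  \int[std_normal_vec R m.+1]_y
    f (tnth y ord0, \sum_(j < m) (chi2_mean lam j + (tnth y (lift ord0 j) : R)) ^+ 2).
Proof.
move=> mf.
pose g (y : m.+1.-tuple RB) : RB * RB :=
  (tnth y ord0, \sum_(j < m) (chi2_mean lam j + (tnth y (lift ord0 j) : R)) ^+ 2).
apply: (@Rintegral_same_law R _ _ _ _ _ _ (normal_prob (0 : R) 1 \x chi2 m lam)%E
  (std_normal_vec R m.+1) id g) => // k mk k0.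
have mg : measurable_fun setT g.
  apply: measurable_fun_pair; first exact: measurable_tnth.
  apply: (@measurable_sum _ _ R) => j; apply: measurable_funX.
  by apply: measurable_funD => //; exact: measurable_tnth.
rewrite fubini_tonelli1// ge0_integral_cons//; last exact: (measurableT_comp mk mg).
apply: eq_integral => z _; rewrite /fubini_F ge0_integral_distribution//; last first.
  exact: measurableT_comp.
apply: eq_integral => y _ /=; congr (k (_, _)).
by apply: eq_bigr => j _; rewrite tnthS.
Qed.

(* The integrands differ only on the null set [zq.1 = - a], where the division by
   zero makes the right-hand one [h zq.2]. *)
Lemma Rintegral_harm (Q : probability RB R) (a : R) (h : R -> R) : measurable_fun setT h ->
  \int[(normal_prob (0 : R) 1 \x Q)%E]_zq h (harm ((zq.1 + a) ^+ 2) zq.2) =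
  \int[(normal_prob (0 : R) 1 \x Q)%E]_zq h ((1 + zq.2 / (zq.1 + a) ^+ 2)^-1 * zq.2).
Proof.
move=> mh; congr fine.
have m1 : measurable_fun setT (fun z : RB * RB => (z.1 + a) ^+ 2 : R).
  by apply: measurable_funX; exact: measurable_funD.
apply: ae_eq_integral => //.
- apply/measurable_EFinP; apply: (measurableT_comp mh).
  apply: measurable_funM; first exact: measurable_funM.
  by apply: measurable_funV_total; exact: measurable_funD.
- apply/measurable_EFinP; apply: (measurableT_comp mh).
  apply: measurable_funM => //; apply: measurable_funV_total; apply: measurable_funD => //.
  by apply: measurable_funM => //; exact: measurable_funV_total.
have ma : measurable ([set - a] : set RB) by exact: measurable_set1.
exists ([set - a] `*` setT); split.
- exact: measurableX.
- apply: (etrans (product_measure1E _ _ ma measurableT)).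
  suff a0 : normal_prob (0 : R) 1 [set - a] = 0%E.
    by apply: (etrans (congr1 (fun x => x * Q setT)%E a0)); exact: mul0e.
  have /null_content_dominatesP := @normal_prob_dominates R 0 1; apply => //.
  exact: lebesgue_measure_set1.
move=> [z q] /= H; split => //; apply: contrapT => za; apply: H => _.
have u0 : (z + a) ^+ 2 != 0.
  by rewrite sqrf_eq0; apply/eqP => zE; apply: za; rewrite -(addrK a z) zE sub0r.
congr (h _)%:E; rewrite /harm.
have -> : 1 + q / (z + a) ^+ 2 = ((z + a) ^+ 2 + q) / (z + a) ^+ 2.
  by rewrite mulrDl divff.
by rewrite invf_div mulrAC.
Qed.

End chi2_theory.

Lemma sqrt_nat_mulV (R : realType) n : Num.sqrt n%:R * n%:R^-1 = (Num.sqrt n%:R)^-1 :> R.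
Proof.
case: n => [|n]; first by rewrite sqrtr0 invr0 mulr0.
by rewrite -{2}(sqr_sqrtr (ler0n R n.+1)) expr2 invfM mulrA divff ?mul1r.
Qed.

Section cvg_complements.
Context (R : realType).
Implicit Types (u v : nat -> R) (a b : R).

Lemma seq_cvg_unique u a b : u n @[n --> \oo] --> a -> u n @[n --> \oo] --> b -> a = b.
Proof. by move=> /(cvg_lim (@Rhausdorff R)) <- /(cvg_lim (@Rhausdorff R)) <-. Qed.

Lemma seq_cvg_mul_pinfty u v a : u n @[n --> \oo] --> (+oo : set_system R) ->
  v n @[n --> \oo] --> a -> 0 < a -> u n * v n @[n --> \oo] --> (+oo : set_system R).
Proof.
move=> /cvgryPge uoo va a0; apply/cvgryPge => z.
have a2 : 0 < a / 2 by rewrite divr_gt0.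
near=> n.
have vn : a / 2 <= v n.
  have : `|a - v n| <= a / 2 by near: n; move/cvgrPdist_le: va; exact.
  by rewrite ler_norml => /andP[_]; lra.
have un : Num.max 0 z / (a / 2) <= u n by near: n; exact: uoo.
apply: (@le_trans _ _ (Num.max 0 z)); first by rewrite le_max lexx orbT.
rewrite -[leLHS](divfK (lt0r_neq0 a2)) ler_pM ?(ltW a2)//.
by rewrite divr_ge0 ?(ltW a2)// le_max lexx.
Unshelve. all: by end_near. Qed.

End cvg_complements.

(** * Rows of rotationally symmetric vectors *)

Section rotsym_array.
Context (R : realType) (m : nat).
Local Notation RB := (measurableTypeR R).
Local Notation cv := 'cV[R]_m.+2.
Variables (theta0 : cv) (theta : nat -> cv) (F : nat -> R -> R).
Variables (d : nat -> measure_display) (T : forall n, measurableType (d n))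
  (P : forall n, probability (T n) R) (X : forall n, nat -> {RV (P n) >-> cv}).
Arguments X : clear implicits.
Hypothesis theta01 : dotv theta0 theta0 = 1.
Hypothesis theta_unit : forall n, (0 < n)%N -> unit_sphere (theta n).
Hypothesis iidX : forall n, (0 < n)%N -> iid_rotsym n (X n) (theta n) (F n).

Let e n := rot_mean (X n 0%N) (theta n).
Let m2 n := rot_m2 (X n 0%N) (theta n).
Let c n := rot_c (X n 0%N) (theta n).

Let rotX n i : (i < n)%N -> rotationally_symmetric (X n i) (theta n).
Proof. by move=> i_n; have [_ /(_ i i_n)[]] := iidX (leq_ltn_trans (leq0n i) i_n). Qed.

Let tt n i : (i < n)%N -> unit_sphere (theta n).
Proof. by move=> i_n; exact: theta_unit (leq_ltn_trans (leq0n i) i_n). Qed.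

Let mX n i : measurable_fun setT (X n i) := measurable_funPT (X n i).

Lemma measurable_dotX n i v : measurable_fun setT (fun w => dotv v (X n i w)).
Proof. exact: (measurableT_comp (measurable_dotv v) (@mX n i)). Qed.

Let same_axial n i (f : R -> R) : (i < n)%N -> measurable_fun setT f ->
  \int[P n]_w f (dotv (theta n) (X n i w)) = \int[P n]_w f (dotv (theta n) (X n 0%N w)).
Proof.
move=> i_n mf; have n0 := leq_ltn_trans (leq0n i) i_n.
apply: Rintegral_eq_cdf => //; [exact: measurable_dotX|exact: measurable_dotX|].
move=> x; have [_ H] := iidX n0.
have E k : (k < n)%N -> P n [set w | dotv (theta n) (X n k w) <= x] = (F n x)%:E.
  move=> kn; rewrite -(H k kn).2; congr (P n _).
  by apply/seteqP; split => w /=; rewrite dotvC.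
by rewrite !E.
Qed.

Let same_mean n i : (i < n)%N -> rot_mean (X n i) (theta n) = e n.
Proof. by move=> i_n; exact: (@same_axial n i id). Qed.

Let same_m2 n i : (i < n)%N -> rot_m2 (X n i) (theta n) = m2 n.
Proof.
by move=> i_n; apply: (@same_axial n i (fun x => x ^+ 2)).
Qed.

Lemma array_mean n i v : (i < n)%N -> \int[P n]_w dotv v (X n i w) = dotv v (theta n) * e n.
Proof. by move=> i_n; rewrite (rotsym_mean (tt i_n) (rotX i_n)) same_mean. Qed.

Lemma array_cov n i u v : (i < n)%N ->
  \int[P n]_w (dotv u (X n i w) * dotv v (X n i w)) =
  dotv u (theta n) * dotv v (theta n) * m2 n +
  c n * (dotv u v - dotv u (theta n) * dotv v (theta n)).
Proof.
move=> i_n; rewrite (rotsym_cov (tt i_n) (rotX i_n)) /c /rot_c.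
by rewrite same_m2.
Qed.

Lemma array_momfin n i v : (i < n)%N -> momfin (P n) (fun w => dotv v (X n i w)).
Proof. by move=> i_n; exact: momfin_dotv (rotX i_n) _. Qed.

Lemma array_bound n i v w : (i < n)%N -> dotv v v = 1 -> `|dotv v (X n i w)| <= 1.
Proof.
move=> i_n v1; apply: normr_dotv_le1 => //.
by apply/unit_sphereE; have [] := rotX i_n.
Qed.

Section coordinates.
Variables (k : nat) (u : 'I_k -> cv) (s : R).

(** The family [u] is left open: it is the tangential part of the basis when the axial second moment
    need not tend to [s ^+ 2], and the whole basis when it does. *)
Definition coord_tuple n i (w : T n) : k.-tuple RB :=
  [tuple s^-1 * dotv (u j) (X n i w) | j < k].

Lemma tnth_coord_tuple n i w j :
  tnth (@coord_tuple n i w) j = s^-1 * dotv (u j) (X n i w) :> R.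
Proof. by rewrite tnth_mktuple. Qed.

Lemma measurable_coord_tuple n i : measurable_fun setT (@coord_tuple n i).
Proof.
apply/measurable_fun_tnthP => j.
rewrite (_ : _ \o _ = fun w => s^-1 * dotv (u j) (X n i w)); last first.
  by apply/funext => w /=; rewrite tnth_coord_tuple.
by apply: measurable_funM => //; exact: measurable_dotX.
Qed.

Let mY := measurable_coord_tuple.

Let mcoord : measurable_fun setT (fun x : cv => [tuple s^-1 * dotv (u j) x | j < k] : k.-tuple RB).
Proof.
apply/measurable_fun_tnthP => j.
rewrite (_ : _ \o _ = fun x => s^-1 * dotv (u j) x); last first.
  by apply/funext => x /=; rewrite tnth_mktuple.
by apply: measurable_funM => //; exact: measurable_dotv.
Qed.

Let indY n : (0 < n)%N -> forall (J : {set 'I_n}) (B : 'I_n -> set (k.-tuple RB)),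
  (forall i, measurable (B i)) ->
  P n (\bigcap_(i in [set i | i \in J]) (@coord_tuple n i @^-1` B i)) =
  (\prod_(i in J) P n (@coord_tuple n i @^-1` B i))%E.
Proof.
move=> n0 J B mB; have [H _] := iidX n0.
apply: (H J (fun i => (fun x : cv => [tuple s^-1 * dotv (u j) x | j < k] : k.-tuple RB) @^-1` B i)) => i.
by rewrite -[X in measurable X]setTI; exact: mcoord.
Qed.

Lemma scaled_sum_sample_mean n w j :
  tnth (scaled_sum coord_tuple w) j =
  s^-1 * (Num.sqrt n%:R * dotv (u j) (sample_mean n (fun i => X n i w))) :> R.
Proof.
rewrite tnth_scaled_sum /sample_mean dotvZr dotv_sumr.
have -> : Num.sqrt n%:R * (n%:R^-1 * \sum_(i < n) dotv (u j) (X n i w)) =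
   (Num.sqrt n%:R)^-1 * \sum_(i < n) dotv (u j) (X n i w).
  by rewrite mulrA sqrt_nat_mulV.
rewrite [RHS]mulrCA; congr (_ * _); rewrite mulr_sumr; apply: eq_bigr => i _.
by rewrite tnth_coord_tuple.
Qed.

Hypothesis s0 : 0 < s.
Hypothesis u_orthonormal : forall i j, dotv (u i) (u j) = (i == j)%:R.

Let b n : k.-tuple RB := [tuple s^-1 * (dotv (u j) (theta n) * e n) | j < k].
(** An isotropic matrix plus a rank-one matrix along [theta n] with weight [m2 n - c n]. [cross_cvg]
    below removes the latter, either because the [u j] become orthogonal to [theta n] or because
    [m2] and [c] have the same limit. *)
Let q n i j : R := s^-1 ^+ 2 *
  (dotv (u i) (theta n) * dotv (u j) (theta n) * (m2 n - c n) + c n * (i == j)%:R).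

Let Yc n i : (i < n)%N -> forall w, l1 (@coord_tuple n i w) <= k%:R * s^-1.
Proof.
move=> i_n w; rewrite /l1.
apply: (@le_trans _ _ (\sum_(j < k) s^-1)); last by rewrite sumr_const card_ord mulr_natl.
apply: ler_sum => j _; rewrite tnth_coord_tuple normrM ger0_norm ?invr_ge0 ?(ltW s0)//.
by rewrite ler_piMr ?invr_ge0 ?(ltW s0)// array_bound// u_orthonormal eqxx.
Qed.

Let Yb n i : (i < n)%N -> forall j,
  \int[P n]_w (tnth (@coord_tuple n i w) j : R) = tnth (b n) j.
Proof.
move=> i_n j; rewrite tnth_mktuple -(array_mean _ i_n) -ExZ; last exact: array_momfin.
by apply: eq_Rintegral => w _; rewrite tnth_coord_tuple.
Qed.

Let Yq n i : (i < n)%N -> forall j l,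
  \int[P n]_w ((tnth (@coord_tuple n i w) j : R) * (tnth (@coord_tuple n i w) l : R)) = q n j l.
Proof.
move=> i_n j l.
transitivity (\int[P n]_w (s^-1 ^+ 2 * (dotv (u j) (X n i w) * dotv (u l) (X n i w)))).
  by apply: eq_Rintegral => w _; rewrite !tnth_coord_tuple; ring.
rewrite ExZ; last by apply: momfinM; exact: array_momfin.
by rewrite array_cov// u_orthonormal /q; ring.
Qed.

Lemma coord_sum_momfin n j : (0 < n)%N ->
  momfin (P n) (fun w => tnth (scaled_sum coord_tuple w) j : R).
Proof. exact: momfin_scaled_sum mY Yc _ _. Qed.

Lemma coord_sum_moments n j : (0 < n)%N ->
  \int[P n]_w (tnth (scaled_sum coord_tuple w) j : R) =
    Num.sqrt n%:R * (s^-1 * (dotv (u j) (theta n) * e n)) /\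
  \int[P n]_w ((tnth (scaled_sum coord_tuple w) j : R) ^+ 2) =
    s^-1 ^+ 2 * (dotv (u j) (theta n) ^+ 2 * (m2 n - c n) + c n)
    - (s^-1 * (dotv (u j) (theta n) * e n)) ^+ 2
    + (Num.sqrt n%:R * (s^-1 * (dotv (u j) (theta n) * e n))) ^+ 2.
Proof.
move=> n0; have [-> ->] := scaled_sum_moments mY indY Yc Yb Yq j n0.
by rewrite !tnth_mktuple /q eqxx mulr1 -expr2.
Qed.

Hypothesis c_cvg : c n @[n --> \oo] --> s ^+ 2.
Hypothesis cross_cvg : forall i j,
  dotv (u i) (theta n) * dotv (u j) (theta n) * (m2 n - c n) @[n --> \oo] --> (0 : R).

Let q_cvg i j : q n i j @[n --> \oo] --> ((i == j)%:R : R).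
Proof.
have -> : (i == j)%:R = s^-1 ^+ 2 * (0 + s ^+ 2 * (i == j)%:R) :> R.
  by rewrite add0r mulrA -exprMn mulVf ?lt0r_neq0// expr1n mul1r.
apply: seq_cvgZ; apply: seq_cvgD => //.
by apply: seq_cvgM => //; exact: cvg_cst.
Qed.

Variable mu : k.-tuple RB.
Hypothesis mu_cvg : forall j,
  Num.sqrt n%:R * (s^-1 * (dotv (u j) (theta n) * e n)) @[n --> \oo] --> (tnth mu j : R).

Let b_cvg j : Num.sqrt n%:R * (tnth (b n) j : R) @[n --> \oo] --> (tnth mu j : R).
Proof. by under eq_fun do rewrite tnth_mktuple; exact: mu_cvg. Qed.

Lemma coord_sum_clt (L M : R) (f : k.-tuple RB -> R) :
  measurable_fun setT f -> (forall x, `|f x| <= M) -> 0 <= L -> sq_lipschitz L f ->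
  \int[P n]_w f (scaled_sum coord_tuple w) @[n --> \oo] --> gsmooth 1 f mu.
Proof. exact: clt_sq_lipschitz mY indY Yc Yb Yq b_cvg q_cvg _ _ _. Qed.

Lemma coord_sum_sq_bounded j : exists B : R, forall n, (0 < n)%N ->
  \int[P n]_w ((tnth (scaled_sum coord_tuple w) j : R) ^+ 2) <= B.
Proof.
have H : q n j j + (Num.sqrt n%:R * (tnth (b n) j : R)) ^+ 2 @[n --> \oo] -->
    (j == j)%:R + (tnth mu j : R) ^+ 2.
  by apply: seq_cvgD; [exact: q_cvg|exact: seq_cvgX].
have : cvgn (fun n => q n j j + (Num.sqrt n%:R * (tnth (b n) j : R)) ^+ 2).
  by apply/cvg_ex; eexists; exact: H.
move=> /cvg_seq_bounded /pinfty_ex_gt0[B B0 /= HB]; exists B => n n0.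
rewrite (scaled_sum_moments mY indY Yc Yb Yq j n0).2.
apply: le_trans (le_trans (ler_norm _) (HB n I)).
by rewrite lerD2r lerBlDr lerDl sqr_ge0.
Qed.

End coordinates.

Let den n w := 1 - cos_second_moment theta0 n (fun i => X n i w).

(** One-dimensional tuples, so that the results on [psum] apply to the empirical second moment. *)
Let axial_sq n i (w : T n) : 1.-tuple RB := [tuple dotv theta0 (X n i w) ^+ 2 | j < 1].

Let m_axial_sq n i : measurable_fun setT (@axial_sq n i).
Proof.
apply/measurable_fun_tnthP => j.
rewrite (_ : _ \o _ = fun w => dotv theta0 (X n i w) ^+ 2); last first.
  by apply/funext => w /=; rewrite tnth_mktuple.
by apply: measurable_funX; exact: measurable_dotX.
Qed.

Let ind_axial_sq n : (0 < n)%N -> forall (J : {set 'I_n}) (B : 'I_n -> set (1.-tuple RB)),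
  (forall i, measurable (B i)) ->
  P n (\bigcap_(i in [set i | i \in J]) (@axial_sq n i @^-1` B i)) =
  (\prod_(i in J) P n (@axial_sq n i @^-1` B i))%E.
Proof.
move=> n0 J B mB; have [H _] := iidX n0.
pose f (x : cv) : 1.-tuple RB := [tuple dotv theta0 x ^+ 2 | j < 1].
have mf : measurable_fun setT f.
  apply/measurable_fun_tnthP => j.
  rewrite (_ : _ \o _ = fun x => dotv theta0 x ^+ 2); last first.
    by apply/funext => x /=; rewrite tnth_mktuple.
  by apply: measurable_funX; exact: measurable_dotv.
apply: (H J (fun i => f @^-1` B i)) => i.
by rewrite -[X in measurable X]setTI; exact: mf.
Qed.

Let denE n w : @den n w = 1 - n%:R^-1 * (tnth (psum (@axial_sq n) n w) ord0 : R).
Proof.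
rewrite /den /cos_second_moment tnth_psum; congr (_ - _ * _).
by apply: eq_bigr => i _; rewrite tnth_mktuple dotvC.
Qed.

Lemma measurable_den n : measurable_fun setT (@den n).
Proof.
rewrite (_ : @den n = fun w => 1 - n%:R^-1 * (tnth (psum (@axial_sq n) n w) ord0 : R)); last first.
  by apply/funext => w; rewrite denE.
apply: measurable_funB => //; apply: measurable_funM => //.
exact: (measurableT_comp (measurable_tnth _) (@measurable_psum _ _ _ _ _ (@m_axial_sq n) n)).
Qed.

Let axial_sq_moments n : (0 < n)%N ->
  let g := dotv theta0 (theta n) ^+ 2 * (m2 n - c n) + c n in
  [/\ momfin (P n) (fun w => tnth (psum (@axial_sq n) n w) ord0 : R),
    \int[P n]_w (tnth (psum (@axial_sq n) n w) ord0 : R) = n%:R * g &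
    \int[P n]_w ((tnth (psum (@axial_sq n) n w) ord0 : R) ^+ 2) <= n%:R + (n%:R * g) ^+ 2].
Proof.
move=> n0 g.
have Y1 i : (i < n)%N -> forall w, `|tnth (@axial_sq n i w) ord0 : R| <= 1.
  by move=> i_n w; rewrite tnth_mktuple normrX exprn_ile1// array_bound.
have mt i : measurable_fun setT (fun w => tnth (@axial_sq n i w) ord0 : R).
  exact: (measurableT_comp (measurable_tnth _) (@m_axial_sq n i)).
have Yg i : (i < n)%N -> \int[P n]_w (tnth (@axial_sq n i w) ord0 : R) = g.
  move=> i_n; transitivity (\int[P n]_w (dotv theta0 (X n i w) * dotv theta0 (X n i w))).
    by apply: eq_Rintegral => w _; rewrite tnth_mktuple expr2.
  by rewrite array_cov// theta01 /g; ring.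
have [Sn E1 E2] := @psum_moments _ _ _ (P n) 1 n (@axial_sq n) (@m_axial_sq n)
  (ind_axial_sq n0) ord0 1 g
  (fun i => \int[P n]_w ((tnth (@axial_sq n i w) ord0 : R) ^+ 2)) Y1 Yg (fun i _ => erefl)
  n (leqnn n).
split => //.
  apply: (@momfin_bounded _ _ _ _ _ (n%:R * 1)) => //.
  exact: (measurableT_comp (measurable_tnth _) (@measurable_psum _ _ _ _ _ (@m_axial_sq n) n)).
rewrite E2 lerD2r.
apply: (@le_trans _ _ (\sum_(i < n) 1)); last by rewrite sumr_const card_ord.
apply: ler_sum => i _; rewrite lerBlDr ler_wpDr ?sqr_ge0//.
apply: le_trans (ler_norm _) _; apply: Ex_bounded; first exact: measurable_funX.
by move=> w; rewrite normrX exprn_ile1// Y1.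
Qed.

Lemma den_momfin n : (0 < n)%N -> momfin (P n) (@den n).
Proof.
move=> n0; rewrite (_ : @den n = fun w => 1 - n%:R^-1 * (tnth (psum (@axial_sq n) n w) ord0 : R)); last first.
  by apply/funext => w; rewrite denE.
have [H _ _] := axial_sq_moments n0.
by apply: momfinB; [exact: momfin_cst|exact: momfinZ].
Qed.

(** Bias and variance: the empirical second moment averages [n] independent variables with values in
    [[0, 1]], so its variance is at most [1 / n], and its mean [g n] tends to [1 - dl]. *)
Lemma den_cvg (dl : R) :
  dotv theta0 (theta n) ^+ 2 * (m2 n - c n) + c n @[n --> \oo] --> 1 - dl ->
  \int[P n]_w (@den n w - dl) ^+ 2 @[n --> \oo] --> (0 : R).
Proof.
move=> gcvg; apply: (@seq_cvg_of_bound _ _ _ 0) => sg _.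
pose g n := dotv theta0 (theta n) ^+ 2 * (m2 n - c n) + c n.
exists (fun n => (Num.sqrt n%:R)^-1 ^+ 2 + (g n - (1 - dl)) ^+ 2).
  have -> : sg * 0 = 0 ^+ 2 + (1 - dl - (1 - dl)) ^+ 2 by rewrite subrr expr0n /=; ring.
  apply: seq_cvgD; apply: seq_cvgX; first exact: cvg_sqrt_natV.
  by apply: seq_cvgB => //; exact: cvg_cst.
move=> n n0; rewrite subr0 ger0_norm; last first.
  by apply: Rintegral_ge0 => w _; exact: sqr_ge0.
have [hS E1 E2] := axial_sq_moments n0; rewrite -/(g n) in E1 E2.
set S := fun w => tnth (psum (@axial_sq n) n w) ord0 : R in hS E1 E2.
have nn0 : n%:R != 0 :> R by rewrite pnatr_eq0 -lt0n.
have -> : \int[P n]_w (@den n w - dl) ^+ 2 =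
    \int[P n]_w (n%:R^-1 ^+ 2 * S w ^+ 2 - (2 * (1 - dl) * n%:R^-1 * S w - (1 - dl) ^+ 2)).
  by apply: eq_Rintegral => w _; rewrite denE /S; ring.
have hS2 : momfin (P n) (fun w => S w ^+ 2) by exact: momfinX.
rewrite ExB; [|exact: momfinZ|by apply: momfinB; [exact: momfinZ|exact: momfin_cst]].
rewrite ExB; [|exact: momfinZ|exact: momfin_cst].
have -> : \int[P n]__ (1 - dl) ^+ 2 = (1 - dl) ^+ 2 by exact: Ex_cst.
rewrite !ExZ// E1 [(Num.sqrt _)^-1 ^+ 2]exprVn sqr_sqrtr ?ler0n//.
have -> : 2 * (1 - dl) / n%:R * (n%:R * g n) = 2 * (1 - dl) * g n by field.
apply: (@le_trans _ _ (n%:R^-1 ^+ 2 * (n%:R + (n%:R * g n) ^+ 2) -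
   (2 * (1 - dl) * g n - (1 - dl) ^+ 2))).
  by rewrite lerD2r ler_wpM2l// sqr_ge0.
by rewrite le_eqVlt; apply/orP; left; apply/eqP; field.
Qed.

(** * Limits of the statistics in an adapted basis *)

Section limits.
Variables (v : 'I_m.+2 -> cv) (s : R) (t : cv) (k : R).
Hypothesis vv : forall i j, dotv (v i) (v j) = (i == j)%:R.
Hypothesis v0 : v ord0 = theta0.
Hypothesis vE : forall y, dotv y y = \sum_j dotv (v j) y ^+ 2.
Hypothesis s0 : 0 < s.
Hypothesis k0 : 0 <= k.

Let vt (j : 'I_m.+1) := v (lift ord0 j).
Let Ut n w := @scaled_sum R m.+1 d T (coord_tuple vt s) n w.
Let U n w := @scaled_sum R m.+2 d T (coord_tuple v s) n w.

Let U_lift n w j : tnth (@U n w) (lift ord0 j) = tnth (@Ut n w) j.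
Proof. by rewrite [LHS]scaled_sum_sample_mean [RHS]scaled_sum_sample_mean. Qed.

Let Q n w := tangent_stat theta0 n (fun i => X n i w).
Let A n w := axial_stat theta0 n (fun i => X n i w).

Let tangentE n w : @Q n w = s ^+ 2 * \sum_j (tnth (@Ut n w) j : R) ^+ 2.
Proof.
rewrite /Q /tangent_stat dotv_tangent_proj vE big_ord_recl v0 [_ + _ - _]addrC addKr.
rewrite !mulr_sumr; apply: eq_bigr => j _; rewrite [tnth _ _ in RHS]scaled_sum_sample_mean.
rewrite -[RHS]exprMn [s * _]mulrA divff ?lt0r_neq0// mul1r.
by rewrite exprMn sqr_sqrtr.
Qed.

Let axialE n w : @A n w = s * (tnth (@U n w) ord0 : R).
Proof.
rewrite [tnth _ _ in RHS]scaled_sum_sample_mean v0 mulrA divff ?mul1r//.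
by rewrite lt0r_neq0.
Qed.

Let mUt n j : measurable_fun setT (fun w => tnth (@Ut n w) j : R).
Proof.
apply: (measurableT_comp (measurable_tnth j)).
by apply: measurable_scaled_sum => ? ?; exact: measurable_coord_tuple.
Qed.

Let mU n j : measurable_fun setT (fun w => tnth (@U n w) j : R).
Proof.
apply: (measurableT_comp (measurable_tnth j)).
by apply: measurable_scaled_sum => ? ?; exact: measurable_coord_tuple.
Qed.

Let mQ n : measurable_fun setT (@Q n).
Proof.
rewrite (_ : @Q n = fun w => s ^+ 2 * \sum_j (tnth (@Ut n w) j : R) ^+ 2); last first.
  by apply/funext => w; rewrite tangentE.
apply: measurable_funM => //; apply: (@measurable_sum _ _ R) => j.
exact: measurable_funX.
Qed.

Let mA n : measurable_fun setT (@A n).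
Proof.
rewrite (_ : @A n = fun w => s * (tnth (@U n w) ord0 : R)); last first.
  by apply/funext => w; rewrite axialE.
exact: measurable_funM.
Qed.

Let hQ n : (0 < n)%N -> momfin (P n) (@Q n).
Proof.
move=> n0; rewrite (_ : @Q n = fun w => s ^+ 2 * \sum_j (tnth (@Ut n w) j : R) ^+ 2); last first.
  by apply/funext => w; rewrite tangentE.
apply: momfinZ; apply: momfin_sum => j; apply: momfinX.
by apply: coord_sum_momfin => // i l; rewrite vv (inj_eq lift_inj).
Qed.

Let Q0 n w : 0 <= @Q n w.
Proof. by rewrite tangentE mulr_ge0 ?sqr_ge0// sumr_ge0// => j _; exact: sqr_ge0. Qed.

Let Wn n w := W_stat theta0 n (fun i => X n i w).
Let Sn n w := S_stat theta0 n (fun i => X n i w).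
Let NS n w := m.+1%:R * harm (@A n w ^+ 2) (@Q n w).

Let WE n w : @Wn n w = m.+1%:R * @Q n w / @den n w.
Proof. by rewrite /Wn W_statE -[m.+2%:R]natr1 addrK. Qed.

Let SE n w : @Sn n w = @NS n w / @den n w.
Proof. by rewrite /Sn S_statE -[m.+2%:R]natr1 addrK. Qed.

Lemma measurable_W_stat n : measurable_fun setT (@Wn n).
Proof.
rewrite (_ : @Wn n = fun w => m.+1%:R * @Q n w / @den n w); last by apply/funext => w; exact: WE.
apply: measurable_funM; first exact: measurable_funM.
apply: measurable_funV_total; exact: measurable_den.
Qed.

Let mNS n : measurable_fun setT (@NS n).
Proof.
apply: measurable_funM => //; apply: measurable_funM.
  by apply: measurable_funM => //; exact: measurable_funX.
by apply: measurable_funV_total; apply: measurable_funD => //; exact: measurable_funX.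
Qed.

Lemma measurable_S_stat n : measurable_fun setT (@Sn n).
Proof.
rewrite (_ : @Sn n = fun w => @NS n w / @den n w); last by apply/funext => w; exact: SE.
by apply: measurable_funM => //; apply: measurable_funV_total; exact: measurable_den.
Qed.

Let NS0 n w : 0 <= @NS n w.
Proof. by rewrite mulr_ge0// harm_ge0 ?sqr_ge0. Qed.

Let NSQ n w : @NS n w <= m.+1%:R * @Q n w.
Proof. by rewrite ler_wpM2l// harm_le ?sqr_ge0. Qed.

Let hNS n : (0 < n)%N -> momfin (P n) (@NS n).
Proof.
move=> n0; apply: (@momfin_dom _ _ _ _ _ (fun w => m.+1%:R * @Q n w)) => //.
  by apply: momfinZ; exact: hQ.
by move=> w; rewrite !ger0_norm// mulr_ge0.
Qed.

Hypothesis c_cvg : c n @[n --> \oo] --> s ^+ 2.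
Hypothesis cross_cvg : forall x y, dotv x theta0 = 0 -> dotv y theta0 = 0 ->
  dotv x (theta n) * dotv y (theta n) * (m2 n - c n) @[n --> \oo] --> (0 : R).
Hypothesis axial_cvg :
  dotv theta0 (theta n) ^+ 2 * (m2 n - c n) + c n @[n --> \oo] --> 1 - m.+1%:R * s ^+ 2.
Hypothesis tangent_cvg : forall x, dotv x theta0 = 0 ->
  Num.sqrt n%:R * (s^-1 * (dotv x (theta n) * e n)) @[n --> \oo] --> k * dotv x t.
Hypothesis vt_mean : forall j : 'I_m.+1,
  dotv (v (lift ord0 j)) t = chi2_mean (dotv t t - dotv theta0 t ^+ 2) j.

(** [k] is the limiting factor between the coordinates of [t] and the normalized tangential means;
    it multiplies the tangential part of [t], whose squared norm is the bracket. *)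
Let lam := k ^+ 2 * (dotv t t - dotv theta0 t ^+ 2).
Let mu : m.+1.-tuple RB := [tuple chi2_mean lam j | j < m.+1].

Let vt0 j : dotv (vt j) theta0 = 0.
Proof. by rewrite -v0 vv. Qed.

Let vt_orth i j : dotv (vt i) (vt j) = (i == j)%:R.
Proof. by rewrite vv (inj_eq lift_inj). Qed.

Let Ut_cvg j :
  Num.sqrt n%:R * (s^-1 * (dotv (vt j) (theta n) * e n)) @[n --> \oo] --> (tnth mu j : R).
Proof. by rewrite tnth_mktuple -chi2_meanZ// -vt_mean; exact: tangent_cvg. Qed.

Let Q_bounded : exists B : R, forall n, (0 < n)%N -> \int[P n]_w @Q n w <= B.
Proof.
have /choice[B HB] : forall j, exists b, forall n, (0 < n)%N ->
    \int[P n]_w ((tnth (@Ut n w) j : R) ^+ 2) <= b.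
  move=> j; exact: (@coord_sum_sq_bounded _ vt s s0 vt_orth c_cvg (fun i j => cross_cvg (vt0 i) (vt0 j)) mu Ut_cvg j).
exists (s ^+ 2 * \sum_j B j) => n n0.
have h2 j : momfin (P n) (fun w => (tnth (@Ut n w) j : R) ^+ 2).
  by apply: momfinX; apply: coord_sum_momfin.
have -> : \int[P n]_w @Q n w = \int[P n]_w (s ^+ 2 * \sum_j (tnth (@Ut n w) j : R) ^+ 2).
  by apply: eq_Rintegral => w _; rewrite tangentE.
rewrite ExZ; last exact: momfin_sum.
by rewrite ler_wpM2l ?sqr_ge0// Ex_sum//; apply: ler_sum => j _; exact: HB.
Qed.

(** Limit of the denominator. Its factor [m.+1] cancels the [p - 1] of the numerator, leaving the
    tangential square norm over [s ^+ 2]. *)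
Let dl := m.+1%:R * s ^+ 2.

Let dl0 : 0 < dl.
Proof. by rewrite mulr_gt0 ?exprn_gt0. Qed.

Let dl_cvg : \int[P n]_w (@den n w - dl) ^+ 2 @[n --> \oo] --> (0 : R).
Proof. exact: den_cvg. Qed.

Lemma W_limit (h : R -> R) (L M : R) : 0 <= L ->
  (forall x y, `|h x - h y| <= L * `|x - y|) -> (forall x, `|h x| <= M) ->
  \int[P n]_w h (@Wn n w) @[n --> \oo] --> \int[chi2 m.+1 lam]_q h q.
Proof.
move=> L0 hL hM; have mh := lipschitz_measurable hL.
have [B HB] := Q_bounded.
pose f (x : m.+1.-tuple RB) : R := h (\sum_j (tnth x j : R) ^+ 2).
have mf : measurable_fun setT f.
  apply: (measurableT_comp mh); apply: (@measurable_sum _ _ R) => j.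
  by apply: measurable_funX; exact: measurable_tnth.
have fL : sq_lipschitz L f.
  move=> x y; apply: le_trans (hL _ _) _; rewrite ler_wpM2l// -sumrB.
  exact: ler_norm_sum.
have lim := @coord_sum_clt _ vt s s0 vt_orth c_cvg (fun i j => cross_cvg (vt0 i) (vt0 j))
  mu Ut_cvg L M f mf (fun x => hM _) L0 fL.
have -> : (fun n => \int[P n]_w h (@Wn n w)) =
    (fun n => \int[P n]_w h (m.+1%:R * @Q n w / @den n w)).
  by apply/funext => n; apply: eq_Rintegral => w _; rewrite WE.
apply: (@slutsky_ratio _ _ _ _ _ _ dl (m.+1%:R * B) L M _ h) => //.
- by move=> n n0; apply: momfinZ; exact: hQ.
- exact: den_momfin.
- move=> n; rewrite (_ : (fun w => _) = @Wn n); first exact: measurable_W_stat.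
  by apply/funext => w; rewrite WE.
- by move=> n w; rewrite mulr_ge0.
- by move=> n n0; rewrite ExZ; [rewrite ler_wpM2l// HB|exact: hQ].
have -> : \int[chi2 m.+1 lam]_q h q = gsmooth 1 f mu.
  rewrite (@Rintegral_chi2 R m.+1 lam h mh); apply: eq_Rintegral => y _.
  rewrite /f /shifted_sqnorm; congr h; apply: eq_bigr => j _.
  by rewrite tnth_lcomb tnth_mktuple !mul1r addrC.
rewrite (_ : (fun n => _) = (fun n => \int[P n]_w f (@Ut n w))) //.
apply/funext => n; apply: eq_Rintegral => w _; congr h.
rewrite tangentE mulrA -/dl mulrAC divff ?mul1r//.
exact: lt0r_neq0.
Qed.

(** Equality of the limits of [m2] and [c] makes the second moments asymptotically isotropic, so the
    axial coordinate joins the tangential ones in the central limit theorem; [a0] is the limit of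
    its normalized mean. *)
Lemma S_limit (a0 : R) (h : R -> R) (L M : R) :
  (m2 n - c n) @[n --> \oo] --> (0 : R) ->
  Num.sqrt n%:R * (s^-1 * (dotv theta0 (theta n) * e n)) @[n --> \oo] --> a0 ->
  0 <= L -> (forall x y, `|h x - h y| <= L * `|x - y|) -> (forall x, `|h x| <= M) ->
  \int[P n]_w h (@Sn n w) @[n --> \oo] -->
  \int[(normal_prob (0 : R) 1 \x chi2 m.+1 lam)%E]_zq
     h ((1 + zq.2 / (zq.1 + a0) ^+ 2)^-1 * zq.2).
Proof.
move=> mc_cvg a_cvg L0 hL hM; have mh := lipschitz_measurable hL.
have [B HB] := Q_bounded.
pose nsq (x : m.+2.-tuple RB) : R := \sum_(j < m.+1) (tnth x (lift ord0 j) : R) ^+ 2.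
have nsq0 x : 0 <= nsq x by rewrite sumr_ge0// => j _; exact: sqr_ge0.
pose f (x : m.+2.-tuple RB) : R := h (harm ((tnth x ord0 : R) ^+ 2) (nsq x)).
have mnsq : measurable_fun setT nsq.
  apply: (@measurable_sum _ _ R) => j.
  by apply: measurable_funX; exact: measurable_tnth.
have m0 : measurable_fun setT (fun x : m.+2.-tuple RB => (tnth x ord0 : R) ^+ 2).
  by apply: measurable_funX; exact: measurable_tnth.
have mf : measurable_fun setT f.
  apply: (measurableT_comp mh); apply: measurable_funM; first exact: measurable_funM.
  by apply: measurable_funV_total; exact: measurable_funD.
have fL : sq_lipschitz L f.
  move=> x y; apply: le_trans (hL _ _) _; rewrite ler_wpM2l//.
  rewrite big_ord_recl (le_trans (harm_lip _ _ _ _)) ?sqr_ge0// lerD2l -sumrB.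
  exact: ler_norm_sum.
pose mu' : m.+2.-tuple RB := cons_pair (a0 : RB, mu).
(* [v i] and [theta n] are unit vectors, so the product is at most [|m2 n - c n|] in absolute
   value. *)
have cross i j : dotv (v i) (theta n) * dotv (v j) (theta n) * (m2 n - c n) @[n --> \oo] --> (0 : R).
  apply: (@seq_cvg_of_bound _ _ _ 0) => sg _; exists (fun n => `|m2 n - c n|).
    by rewrite mulr0 -[X in _ --> X](@normr0 _ R); exact: seq_cvg_norm.
  move=> n n0; rewrite subr0 normrM ler_piMl//.
  have H l : `|dotv (v l) (theta n)| <= 1.
    by apply: normr_dotv_le1; [rewrite vv eqxx|apply/unit_sphereE; exact: theta_unit].
  by rewrite normrM -[1]mulr1 ler_pM.
have U_cvg j : Num.sqrt n%:R * (s^-1 * (dotv (v j) (theta n) * e n)) @[n --> \oo] -->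
    (tnth mu' j : R).
  case: (unliftP ord0 j) => [i|] ->; first by rewrite tnthS; exact: Ut_cvg.
  by rewrite tnth0 v0.
have lim := @coord_sum_clt _ v s s0 vv c_cvg cross mu' U_cvg L M f mf (fun x => hM _) L0 fL.
have -> : (fun n => \int[P n]_w h (@Sn n w)) =
    (fun n => \int[P n]_w h (@NS n w / @den n w)).
  by apply/funext => n; apply: eq_Rintegral => w _; rewrite SE.
apply: (@slutsky_ratio _ _ _ _ _ _ dl (m.+1%:R * B) L M _ h) => //.
- exact: den_momfin.
- move=> n; rewrite (_ : (fun w => _) = @Sn n); first exact: measurable_S_stat.
  by apply/funext => w; rewrite SE.
(* The numerator of [S_stat] is dominated by that of [W_stat], whose mean is bounded. *)
- move=> n n0; apply: (@le_trans _ _ (\int[P n]_w (m.+1%:R * @Q n w))).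
    by apply: Ex_le => //; [exact: hNS|by apply: momfinZ; exact: hQ].
  by rewrite ExZ; [rewrite ler_wpM2l// HB|exact: hQ].
have <- : gsmooth 1 f mu' = \int[(normal_prob (0 : R) 1 \x chi2 m.+1 lam)%E]_zq
     h ((1 + zq.2 / (zq.1 + a0) ^+ 2)^-1 * zq.2).
  rewrite -Rintegral_harm// Rintegral_normal_chi2; last first.
    apply: (measurableT_comp mh).
    have m1 : measurable_fun setT (fun z : RB * RB => (z.1 + a0) ^+ 2 : R).
      by apply: measurable_funX; exact: measurable_funD.
    apply: measurable_funM; first exact: measurable_funM.
    by apply: measurable_funV_total; exact: measurable_funD.
  apply: eq_Rintegral => y _; rewrite /f /nsq; congr (h (harm _ _)) => /=.
    by rewrite tnth_lcomb tnth0 !mul1r.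
  by apply: eq_bigr => j _; rewrite tnth_lcomb tnthS tnth_mktuple !mul1r addrC.
rewrite (_ : (fun n => _) = (fun n => \int[P n]_w f (@U n w))) //.
apply/funext => n; apply: eq_Rintegral => w _; congr h.
rewrite /NS tangentE axialE exprMn harmZ ?sqrf_eq0 ?lt0r_neq0// mulrA -/dl mulrAC.
rewrite divff ?lt0r_neq0// mul1r; congr harm.
by apply: eq_bigr => j _; rewrite U_lift.
Qed.

(** The normalized sum has the variance of a single axial coordinate, which is [g] minus the square
    of its mean. *)
Let axial_moments n : (0 < n)%N ->
  let g := dotv theta0 (theta n) ^+ 2 * (m2 n - c n) + c n in
  let an := Num.sqrt n%:R * (dotv theta0 (theta n) * e n) in
  momfin (P n) (@A n) /\ \int[P n]_w (@A n w - an) ^+ 2 <= g.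
Proof.
move=> n0 g an.
have h : momfin (P n) (fun w => tnth (@U n w) ord0 : R) by exact: coord_sum_momfin.
have hA : momfin (P n) (@A n).
  rewrite (_ : @A n = fun w => s * (tnth (@U n w) ord0 : R)); first exact: momfinZ.
  by apply/funext => w; exact: axialE.
split => //.
have [E1 E2] := @coord_sum_moments _ v s s0 vv n ord0 n0.
have EA : \int[P n]_w @A n w = an.
  transitivity (\int[P n]_w (s * (tnth (@U n w) ord0 : R))).
    by apply: eq_Rintegral => w _; exact: axialE.
  by rewrite ExZ// E1 /an v0; field; exact: lt0r_neq0.
have EA2 : \int[P n]_w (@A n w ^+ 2) = g - (dotv theta0 (theta n) * e n) ^+ 2 + an ^+ 2.
  transitivity (\int[P n]_w (s ^+ 2 * (tnth (@U n w) ord0 : R) ^+ 2)).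
    by apply: eq_Rintegral => w _; rewrite axialE exprMn.
  by rewrite ExZ ?E2; [rewrite /an /g v0; field; exact: lt0r_neq0|exact: momfinX].
have hA2 : momfin (P n) (fun w => @A n w ^+ 2) by exact: momfinX.
have -> : \int[P n]_w (@A n w - an) ^+ 2 = \int[P n]_w (@A n w ^+ 2 - (2 * an * @A n w - an ^+ 2)).
  by apply: eq_Rintegral => w _; ring.
rewrite ExB//; last by apply: momfinB; [exact: momfinZ|exact: momfin_cst].
rewrite ExB; [|exact: momfinZ|exact: momfin_cst].
have -> : \int[P n]__ an ^+ 2 = an ^+ 2 by exact: Ex_cst.
rewrite ExZ// EA EA2.
by have := sqr_ge0 (dotv theta0 (theta n) * e n); lra.
Qed.

(** With [D] the denominator, the difference is [- (p - 1) Q^2 / ((A^2 + Q) D)] when [A] is nonzero.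
    For it to reach [ep] in absolute value, [D] must be off its limit, or [Q] large, or [A] bounded;
    the last event is unlikely because the mean of [A] diverges while its variance stays bounded. *)
Lemma S_sub_W_cvg :
  Num.sqrt n%:R * (dotv theta0 (theta n) * e n) @[n --> \oo] --> (+oo : set_system R) ->
  cvg_in_probability0 P (fun n w => @Sn n w - @Wn n w).
Proof.
move=> acvg; have [B HB] := Q_bounded.
apply: (@cvg_in_probability0_of_bound _ _ _ _ _ B).
  by move=> n; apply: measurable_funB; [exact: measurable_S_stat|exact: measurable_W_stat].
move=> ep sg ep0 /andP[sg0 sg1].
(* If [D >= dl / 2] and [Q < sg^-1], a difference of size [ep] forces
   [ep A^2 dl / 2 <= (p - 1) sg^-2], that is [A^2 <= K]. *)
pose K := 2 * m.+1%:R * sg^-1 ^+ 2 / (ep * dl).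
have K0 : 0 <= K.
  by apply: divr_ge0; [rewrite mulr_ge0 ?sqr_ge0|rewrite ltW// mulr_gt0].
pose g n := dotv theta0 (theta n) ^+ 2 * (m2 n - c n) + c n.
pose an n := Num.sqrt n%:R * (dotv theta0 (theta n) * e n).
have inv_cvg : (an n ^+ 2 + 1)^-1 @[n --> \oo] --> (0 : R).
  apply/gtr0_cvgV0; first by apply: nearW => n; rewrite ltr_wpDl ?sqr_ge0.
  apply/cvgryPge => z; have /cvgryPge /(_ z) := acvg; apply: filterS => n zn.
  apply: (le_trans zn); rewrite -/(an n).
  by have := sqr_ge0 (an n - 1); nra.
exists (fun n => 4 / dl ^+ 2 * (\int[P n]_w (@den n w - dl) ^+ 2) + sg * B +
    (2 * g n + (2 * K + 1)) * (an n ^+ 2 + 1)^-1).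
  rewrite [X in _ --> X](_ : _ = 4 / dl ^+ 2 * 0 + sg * B +
    (2 * (1 - dl) + (2 * K + 1)) * 0); last by ring.
  apply: seq_cvgD; last first.
    apply: seq_cvgM => //; apply: seq_cvgD; last exact: cvg_cst.
    exact: seq_cvgZ.
  by apply: seq_cvgD; [exact: seq_cvgZ|exact: cvg_cst].
move=> n n0; have [hA EA] := axial_moments n0; rewrite -/(g n) -/(an n) in EA.
have hD : momfin (P n) (fun w => (@den n w - dl) ^+ 2).
  by apply: momfinX; apply: momfinB; [exact: den_momfin|exact: momfin_cst].
have hAn : momfin (P n) (fun w => (@A n w - an n) ^+ 2).
  by apply: momfinX; apply: momfinB => //; exact: momfin_cst.
have hQn := hQ n0.
have an0 : 0 < an n ^+ 2 + 1 by rewrite ltr_wpDl ?sqr_ge0.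
(* One term per exceptional event: [D] off by at least [dl / 2], [Q] at least [sg^-1], [A ^+ 2] at
   most [K]. *)
pose G w := 4 / dl ^+ 2 * (@den n w - dl) ^+ 2 + sg * @Q n w +
  ((an n ^+ 2 + 1)^-1 * (2 * (@A n w - an n) ^+ 2 + (2 * K + 1))).
have t1 w : 0 <= 4 / dl ^+ 2 * (@den n w - dl) ^+ 2.
  by rewrite mulr_ge0 ?sqr_ge0// divr_ge0 ?sqr_ge0.
have t2 w : 0 <= sg * @Q n w by rewrite mulr_ge0// ltW.
have t3 w : 0 <= (an n ^+ 2 + 1)^-1 * (2 * (@A n w - an n) ^+ 2 + (2 * K + 1)).
  apply: mulr_ge0; first by rewrite invr_ge0 ltW.
  by apply: addr_ge0; [rewrite mulr_ge0 ?sqr_ge0|rewrite addr_ge0// mulr_ge0].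
exists G; split.
- apply: momfinD; first by apply: momfinD; exact: momfinZ.
  by apply: momfinZ; apply: momfinD; [exact: momfinZ|exact: momfin_cst].
- by move=> w; rewrite !addr_ge0.
- move=> w; rewrite SE WE /NS.
  have [HD|HD] := leP (dl / 2) `|@den n w - dl|.
    move=> _; rewrite /G -addrA ler_wpDr ?addr_ge0//.
    rewrite [leLHS](_ : 1 = 4 / dl ^+ 2 * (dl / 2) ^+ 2); last by field; rewrite lt0r_neq0.
    rewrite ler_wpM2l ?divr_ge0 ?sqr_ge0// -[leRHS]real_normK ?num_real//.
    by rewrite lerXn2r ?nnegrE// divr_ge0// ltW.
  have D0 : dl / 2 <= @den n w by move: HD; rewrite ltr_norml => /andP[+ _]; lra.
  have Dp : 0 < @den n w by apply: lt_le_trans D0; rewrite divr_gt0.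
  have [HQ|HQ] := leP sg^-1 (@Q n w).
    move=> _; rewrite /G -addrA ler_wpDl// ler_wpDr//.
    by rewrite -(mulfV (lt0r_neq0 sg0)) ler_pM2l.
  move=> H; suff aK : @A n w ^+ 2 <= K.
    (* This amounts to [an n ^+ 2 <= 2 (A - an n)^2 + 2 K], which follows from [(2 A - an n)^2 >= 0]
       and [A^2 <= K]. *)
    rewrite /G ler_wpDl ?addr_ge0// mulrC ler_pdivlMr// mul1r.
    have := sqr_ge0 (2 * @A n w - an n); move: aK; set a := @A n w; set x := an n.
    by move=> aK H'; nra.
  have [->|a0] := eqVneq (@A n w) 0; first by rewrite expr0n.
  have aQ : 0 < @A n w ^+ 2 + @Q n w by rewrite ltr_wpDr// exprn_even_gt0.
  have E : m.+1%:R * harm (@A n w ^+ 2) (@Q n w) / @den n w - m.+1%:R * @Q n w / @den n w =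
      - (m.+1%:R * @Q n w ^+ 2 / ((@A n w ^+ 2 + @Q n w) * @den n w)).
    by rewrite /harm; field; rewrite !lt0r_neq0.
  move: H; rewrite E normrN ger0_norm; last first.
    by apply: divr_ge0; [rewrite mulr_ge0 ?sqr_ge0|rewrite ltW// mulr_gt0].
  rewrite ler_pdivlMr ?mulr_gt0// => H.
  rewrite /K ler_pdivlMr ?mulr_gt0//.
  have H1 : ep * (@A n w ^+ 2 * (dl / 2)) <= m.+1%:R * sg^-1 ^+ 2.
    apply: le_trans (le_trans H _).
      rewrite ler_pM2l// ler_pM ?sqr_ge0 ?divr_ge0 ?(ltW dl0)//.
      by rewrite lerDl.
    by rewrite ler_pM2l// lerXn2r ?nnegrE ?invr_ge0 ?(ltW sg0)// ltW.
  move: H1; set a := @A n w ^+ 2; set z := sg^-1 ^+ 2; nra.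
- have h3 : momfin (P n) (fun w => 2 * (@A n w - an n) ^+ 2 + (2 * K + 1)).
    by apply: momfinD; [exact: momfinZ|exact: momfin_cst].
  rewrite /G ExD; [|by apply: momfinD; exact: momfinZ|exact: momfinZ].
  rewrite ExD; [|exact: momfinZ|exact: momfinZ].
  have -> : \int[P n]_w (4 / dl ^+ 2 * (@den n w - dl) ^+ 2) =
    4 / dl ^+ 2 * \int[P n]_w (@den n w - dl) ^+ 2 by exact: ExZ.
  have -> : \int[P n]_w (sg * @Q n w) = sg * \int[P n]_w @Q n w by exact: ExZ.
  rewrite (ExZ _ h3) ExD; [|exact: momfinZ|exact: momfin_cst].
  rewrite ExZ// Ex_cst [_ * (_ + 1)^-1]mulrC.
  apply: lerD; first by rewrite lerD2l ler_pM2l// HB.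
  by rewrite ler_pM2l ?invr_gt0// lerD2r ler_pM2l.
Qed.

Lemma W_cvg_in_distribution : cvg_in_distribution P Wn (chi2 m.+1 lam) id.
Proof.
apply: lipschitz_cvg_in_distribution => //; first exact: measurable_W_stat.
by move=> h L M; exact: W_limit.
Qed.

Lemma S_cvg_in_distribution :
  Num.sqrt n%:R * (dotv theta0 (theta n) * e n) @[n --> \oo] --> (+oo : set_system R) ->
  cvg_in_distribution P Sn (chi2 m.+1 lam) id.
Proof.
move=> acvg; apply: lipschitz_cvg_in_distribution => //; first exact: measurable_S_stat.
move=> h L M L0 hL hM; apply: (@slutsky_diff _ _ _ _ Sn Wn L M) => //.
- exact: measurable_S_stat.
- exact: measurable_W_stat.
- exact: S_sub_W_cvg.
- exact: W_limit hL hM.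
Qed.

Lemma S_cvg_in_distribution_ratio (a0 : R) :
  (m2 n - c n) @[n --> \oo] --> (0 : R) ->
  Num.sqrt n%:R * (s^-1 * (dotv theta0 (theta n) * e n)) @[n --> \oo] --> a0 ->
  cvg_in_distribution P Sn (normal_prob (0 : R) 1 \x chi2 m.+1 lam)%E
    (fun zq => (1 + zq.2 / (zq.1 + a0) ^+ 2)^-1 * zq.2).
Proof.
move=> mc acvg; apply: lipschitz_cvg_in_distribution => //.
- exact: measurable_S_stat.
- have m1 : measurable_fun setT (fun z : RB * RB => (z.1 + a0) ^+ 2 : R).
    by apply: measurable_funX; exact: measurable_funD.
  apply: measurable_funM => //; apply: measurable_funV_total; apply: measurable_funD => //.
  by apply: measurable_funM => //; exact: measurable_funV_total.
- by move=> h L M L0 hL hM; exact: S_limit hL hM.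
Qed.

End limits.

(** * Asymptotic regimes *)

Section regimes.
Variables (tau : nat -> cv) (t : cv).
Hypothesis tau_cvg : forall x, dotv x (tau n) @[n --> \oo] --> dotv x t.
Hypothesis tau_sq_cvg : dotv (tau n) (tau n) @[n --> \oo] --> dotv t t.

(** [kap] is the limit of the axial mean relative to [eta], and [M2] that of the axial second
    moment. This treats [eta = 1] and [eta = o(1)] with diverging rate at once, [M2] being [1 / p]
    in the latter case. *)
Lemma local_alternatives (eta : nat -> R) (kap M2 : R) :
  (forall n, 0 < eta n) ->
  (forall n, theta n = theta0 + (Num.sqrt n%:R * eta n)^-1 *: tau n) ->
  Num.sqrt n%:R * eta n @[n --> \oo] --> (+oo : set_system R) ->
  e n / eta n @[n --> \oo] --> kap -> 0 < kap ->
  m2 n @[n --> \oo] --> M2 -> M2 < 1 ->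
  let K := chi2 m.+1 (kap ^+ 2 * (m.+1%:R / (1 - M2)) * dotv t t) in
  [/\ cvg_in_distribution P (fun n w => W_stat theta0 n (fun i => X n i w)) K id,
      cvg_in_distribution P (fun n w => S_stat theta0 n (fun i => X n i w)) K id &
      cvg_in_probability0 P (fun n w => S_stat theta0 n (fun i => X n i w)
        - W_stat theta0 n (fun i => X n i w))].
Proof.
move=> eta0 thetaE rate_cvg ek kap0 m2_cvg M21 K.
pose nu n := (Num.sqrt n%:R * eta n)^-1.
have rate0 n : (0 < n)%N -> 0 < Num.sqrt n%:R * eta n.
  by move=> n0; rewrite mulr_gt0// sqrtr_gt0 ltr0n.
have nu_cvg : nu n @[n --> \oo] --> (0 : R).
  apply/gtr0_cvgV0 => //; near=> n; apply: rate0.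
  by near: n; exact: nbhs_infty_gt.
have dotE n x : dotv x (theta n) = dotv x theta0 + nu n * dotv x (tau n).
  by rewrite thetaE dotvDr dotvZr.
(* Comparing the unit norms of [theta0] and [theta n] gives [2 theta0' tau + nu |tau|^2 = 0]:
   [tau n] is asymptotically tangent. *)
have t0_cvg : dotv theta0 (tau n) @[n --> \oo] --> (0 : R).
  rewrite [X in _ --> X](_ : _ = - (2^-1) * (0 * dotv t t)); last by ring.
  apply: (@seq_cvg_pos_eq _ (fun n => - 2^-1 * (nu n * dotv (tau n) (tau n)))).
    move=> n n0; have /unit_sphereE := theta_unit n0.
    rewrite thetaE dotvDl !dotvDr !dotvZl !dotvZr theta01 (dotvC (tau n)) -/(nu n) => H.
    have nu0 : nu n != 0 by rewrite invr_eq0 lt0r_neq0// rate0.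
    apply: (mulfI nu0); move: H; lra.
  by apply: seq_cvgZ; exact: seq_cvgM.
have t0t : dotv theta0 t = 0 := seq_cvg_unique (@tau_cvg theta0) t0_cvg.
have tangent_theta x : dotv x theta0 = 0 -> dotv x (theta n) @[n --> \oo] --> (0 : R).
  move=> x0; under eq_fun do rewrite dotE x0 add0r.
  by rewrite -(mul0r (dotv x t)); exact: seq_cvgM.
have rho_cvg : dotv theta0 (theta n) @[n --> \oo] --> (1 : R).
  rewrite [X in _ --> X](_ : _ = 1 + 0 * dotv theta0 t); last by ring.
  under eq_fun do rewrite dotE theta01.
  by apply: seq_cvgD; [exact: cvg_cst|exact: seq_cvgM].
(* The mass [1 - M2] left by the axial direction is shared equally by the [m.+1] tangential ones;
   [M2 < 1] keeps it positive. *)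
pose s := Num.sqrt ((1 - M2) / m.+1%:R).
have sv0 : 0 < (1 - M2) / m.+1%:R by rewrite divr_gt0// subr_gt0.
have s0 : 0 < s by rewrite sqrtr_gt0.
have sE : s ^+ 2 = (1 - M2) / m.+1%:R by rewrite sqr_sqrtr// ltW.
have c_cvg : c n @[n --> \oo] --> s ^+ 2.
  rewrite sE; apply: seq_cvgM; last exact: cvg_cst.
  by apply: seq_cvgB => //; exact: cvg_cst.
have mc_cvg : m2 n - c n @[n --> \oo] --> M2 - s ^+ 2 by exact: seq_cvgB.
have cross x y : dotv x theta0 = 0 -> dotv y theta0 = 0 ->
    dotv x (theta n) * dotv y (theta n) * (m2 n - c n) @[n --> \oo] --> (0 : R).
  move=> x0 y0; rewrite [X in _ --> X](_ : _ = 0 * 0 * (M2 - s ^+ 2)); last by ring.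
  by apply: seq_cvgM => //; apply: seq_cvgM; exact: tangent_theta.
have axial : dotv theta0 (theta n) ^+ 2 * (m2 n - c n) + c n @[n --> \oo] --> 1 - m.+1%:R * s ^+ 2.
  rewrite [X in _ --> X](_ : _ = 1 ^+ 2 * (M2 - s ^+ 2) + s ^+ 2); last first.
    by rewrite sE; field.
  by apply: seq_cvgD => //; apply: seq_cvgM => //; exact: seq_cvgX.
(* The rate of [theta] exactly offsets that of the mean: [sqrt n * nu n * e n = e n / eta n]. *)
have tangent x : dotv x theta0 = 0 ->
    Num.sqrt n%:R * (s^-1 * (dotv x (theta n) * e n)) @[n --> \oo] --> s^-1 * kap * dotv x t.
  move=> x0; apply: (@seq_cvg_pos_eq _ (fun n => s^-1 * (e n / eta n) * dotv x (tau n))).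
    move=> n n0; rewrite dotE x0 add0r /nu; field.
    by rewrite !lt0r_neq0// sqrtr_gt0 ltr0n.
  by apply: seq_cvgM => //; exact: seq_cvgZ.
have [v [vv v0 vE vt]] := adapted_basis t theta01.
have k0 : 0 <= s^-1 * kap by rewrite mulr_ge0 ?invr_ge0 ?ltW.
have acvg : Num.sqrt n%:R * (dotv theta0 (theta n) * e n) @[n --> \oo] --> (+oo : set_system R).
  rewrite (_ : (fun n => _) =
      fun n => (Num.sqrt n%:R * eta n) * (dotv theta0 (theta n) * (e n / eta n))); last first.
    by apply/funext => n; field; rewrite lt0r_neq0.
  by apply: (@seq_cvg_mul_pinfty _ _ _ (1 * kap)) => //; [exact: seq_cvgM|rewrite mul1r].
have -> : K = chi2 m.+1 ((s^-1 * kap) ^+ 2 * (dotv t t - dotv theta0 t ^+ 2)).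
  rewrite /K t0t expr0n subr0 exprMn exprVn sE invf_div; congr (chi2 _ _); ring.
split.
- exact: (W_cvg_in_distribution vv v0 vE s0 k0 c_cvg cross axial tangent vt).
- exact: (S_cvg_in_distribution vv v0 vE s0 k0 c_cvg cross axial tangent vt).
- exact: (S_sub_W_cvg vv v0 vE s0 k0 c_cvg cross axial tangent vt).
Unshelve. all: by end_near. Qed.

(** Here [theta] tends to [theta0 + t] while the signal [sqrt n * e] has a finite limit [om]. The
    normalized means therefore converge in all directions, and the one along [theta0] gives the
    shift of the Gaussian variable. *)
Lemma fixed_alternatives (om : R) : 0 <= om ->
  (forall n, theta n = theta0 + tau n) ->
  Num.sqrt n%:R * e n @[n --> \oo] --> om ->
  m2 n @[n --> \oo] --> (m.+2%:R^-1 : R) ->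
  let K := chi2 m.+1 (om ^+ 2 * m.+2%:R * (dotv t t - dotv theta0 t ^+ 2)) in
  cvg_in_distribution P (fun n w => W_stat theta0 n (fun i => X n i w)) K id /\
  cvg_in_distribution P (fun n w => S_stat theta0 n (fun i => X n i w))
    (normal_prob (0 : R) 1 \x K)%E
    (fun zq => (1 + zq.2 / (zq.1 + Num.sqrt m.+2%:R * om * (1 + dotv theta0 t)) ^+ 2)^-1 * zq.2).
Proof.
move=> om0 thetaE om_cvg m2_cvg K.
have dotE n x : dotv x (theta n) = dotv x theta0 + dotv x (tau n).
  by rewrite thetaE dotvDr.
have dot_cvg x : dotv x (theta n) @[n --> \oo] --> dotv x theta0 + dotv x t.
  under eq_fun do rewrite dotE.
  by apply: seq_cvgD => //; exact: cvg_cst.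
(* The second moments are asymptotically those of the uniform law, [1 / p] in every direction. *)
pose s : R := (Num.sqrt m.+2%:R)^-1.
have s0 : 0 < s by rewrite invr_gt0 sqrtr_gt0.
have sE : s ^+ 2 = m.+2%:R^-1 by rewrite exprVn sqr_sqrtr.
have c_cvg : c n @[n --> \oo] --> s ^+ 2.
  rewrite [X in _ --> X](_ : _ = (1 - m.+2%:R^-1) * m.+1%:R^-1); last first.
    rewrite sE -[m.+2%:R]natr1; field.
    by have := ler0n R m => ?; rewrite !lt0r_neq0//; lra.
  apply: seq_cvgM; last exact: cvg_cst.
  by apply: seq_cvgB => //; exact: cvg_cst.
have mc_cvg : m2 n - c n @[n --> \oo] --> (0 : R).
  by rewrite -(subrr (s ^+ 2)); apply: seq_cvgB => //; rewrite sE.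
have cross x y : dotv x theta0 = 0 -> dotv y theta0 = 0 ->
    dotv x (theta n) * dotv y (theta n) * (m2 n - c n) @[n --> \oo] --> (0 : R).
  move=> _ _; rewrite -(mulr0 ((dotv x theta0 + dotv x t) * (dotv y theta0 + dotv y t))).
  by apply: seq_cvgM => //; exact: seq_cvgM.
have axial : dotv theta0 (theta n) ^+ 2 * (m2 n - c n) + c n @[n --> \oo] --> 1 - m.+1%:R * s ^+ 2.
  rewrite [X in _ --> X](_ : _ = (dotv theta0 theta0 + dotv theta0 t) ^+ 2 * 0 + s ^+ 2); last first.
    rewrite sE -[m.+2%:R]natr1; field.
    by have := ler0n R m => ?; rewrite lt0r_neq0//; lra.
  by apply: seq_cvgD => //; apply: seq_cvgM => //; exact: seq_cvgX.
have mean x : Num.sqrt n%:R * (s^-1 * (dotv x (theta n) * e n)) @[n --> \oo] -->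
    s^-1 * om * (dotv x theta0 + dotv x t).
  apply: (@seq_cvg_pos_eq _ (fun n => s^-1 * (Num.sqrt n%:R * e n) * dotv x (theta n))).
    by move=> n _; move: (s^-1) => s'; ring.
  by apply: seq_cvgM => //; exact: seq_cvgZ.
have tangent x : dotv x theta0 = 0 ->
    Num.sqrt n%:R * (s^-1 * (dotv x (theta n) * e n)) @[n --> \oo] --> s^-1 * om * dotv x t.
  by move=> x0; have := mean x; rewrite x0 add0r.
have [v [vv v0 vE vt]] := adapted_basis t theta01.
have k0 : 0 <= s^-1 * om by rewrite mulr_ge0// invr_ge0 ltW.
have -> : K = chi2 m.+1 ((s^-1 * om) ^+ 2 * (dotv t t - dotv theta0 t ^+ 2)).
  by rewrite /K exprMn exprVn sE invrK; congr (chi2 _ _); ring.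
split; first exact: (W_cvg_in_distribution vv v0 vE s0 k0 c_cvg cross axial tangent vt).
have := mean theta0; rewrite theta01 [in X in X -> _]/s [in X in X -> _]invrK => a_cvg.
by apply: (S_cvg_in_distribution_ratio vv v0 vE s0 k0 c_cvg cross axial tangent vt mc_cvg); rewrite /s invrK.
Qed.

End regimes.

End rotsym_array.

(** * Reduction of the theorem to the two regimes *)

Lemma cvg_eqO1 (R : realType) (u : nat -> R) (l : R) : u n @[n --> \oo] --> l ->
  u =O_\oo (fun=> 1 : R).
Proof.
move=> ul; have : cvgn u by apply/cvg_ex; exists l.
move=> /cvg_seq_bounded /pinfty_ex_gt0[B B0 /= HB]; apply/eqOP.
near=> k; near=> n; rewrite normr1 mulr1 (le_trans (HB n I))//.
Unshelve. all: by end_near. Qed.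

Lemma cvg_coord (R : realType) (p : nat) (u : nat -> 'cV[R]_p) (l : 'cV[R]_p) (i : 'I_p) :
  u n @[n --> \oo] --> l -> u n i 0 @[n --> \oo] --> l i 0.
Proof.
move=> ul; apply: (@cvg_comp _ _ _ u (fun M : 'cV[R]_p => M i 0) \oo (nbhs l) _ ul).
exact: coord_continuous.
Qed.

(** This gives the vanishing and the constant [eta] the common form [e / eta --> xi / sqrt p], the
    only one used for the means afterwards. *)
Lemma near_uniformity_ratio (R : realType) (p : nat) (eta e1 e2 : nat -> R) (xi : R) :
  (forall n, 0 < eta n) -> near_uniformity p eta xi e1 e2 ->
  e1 n / eta n @[n --> \oo] --> xi / Num.sqrt p%:R.
Proof.
move=> eta0 [/eqaddoP H _]; apply/cvgrPdist_le => eps eps0.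
have := H eps eps0; apply: filterS => n /=.
rewrite !fctE (gtr0_norm (eta0 n)) => Hn.
have -> : xi / Num.sqrt p%:R - e1 n / eta n = - ((e1 n - eta n * xi / Num.sqrt p%:R) / eta n).
  rewrite mulrBl opprB; congr (_ - _).
  by rewrite -[eta n * xi / _]mulrA [eta n * _ / _]mulrAC divff ?mul1r ?lt0r_neq0.
by rewrite normrN normrM normfV (gtr0_norm (eta0 n)) ler_pdivrMr.
Qed.

Theorem theorem4p1 (R : realType) (p : nat) (hp : (2 <= p)%N)
    (theta0 : 'cV[R]_p) (htheta0 : unit_sphere theta0)
    (eta : nat -> R) (heta_gt0 : forall n, 0 < eta n)
    (tau : nat -> 'cV[R]_p) (t : 'cV[R]_p)
    (htau : tau n @[n --> \oo] --> t) (ht : t != 0)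
    (nu : nat -> R)
    (hnu_infty : Num.sqrt n%:R * eta n @[n --> \oo] --> +oo ->
       forall n, nu n = (Num.sqrt n%:R * eta n)^-1)
    (hnu_bounded : (fun n => Num.sqrt n%:R * eta n) =O_\oo (fun=> 1 : R) ->
       forall n, nu n = 1)
    (theta : nat -> 'cV[R]_p)
    (htheta : forall n, theta n = theta0 + nu n *: tau n)
    (htheta_sphere : forall n, (0 < n)%N -> unit_sphere (theta n))
    (F : nat -> cumulativeBounded (0 : R) (1 : R))
    (hF : forall n, cdf_on_m11 (F n))
    (d : nat -> measure_display) (T : forall n, measurableType (d n))
    (P : forall n, probability (T n) R)
    (X : forall n, nat -> {RV (P n) >-> 'cV[R]_p})
    (hX : forall n, (0 < n)%N -> iid_rotsym n (X n) (theta n) (F n))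
    (xi e2 : R) (hxi : 0 < xi) (he2 : 0 < e2)
    (e1n := fun n => cos_mean (X n 0%N) (theta n))
    (e2n := fun n => cos_var (X n 0%N) (theta n))
    (heta : ((forall n, eta n = 1) /\ away_from_uniformity p xi e2 e1n e2n)
         \/ (eta n @[n --> \oo] --> 0 /\ near_uniformity p eta xi e1n e2n))
    (W := fun n (w : T n) => W_stat theta0 n (fun i => X n i w))
    (S := fun n (w : T n) => S_stat theta0 n (fun i => X n i w))
    (t2 := enorm t ^+ 2) :
  [/\ (forall n, eta n = 1) -> xi ^+ 2 / p%:R + e2 < 1 ->
      let K := chi2 p.-1
        ((1 - p%:R^-1) / (1 - xi ^+ 2 / p%:R - e2) * xi ^+ 2 * t2) in
      [/\ cvg_in_distribution P W K id, cvg_in_distribution P S K id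
        & cvg_in_probability0 P (fun n w => S n w - W n w)],
      eta n @[n --> \oo] --> 0 ->
      Num.sqrt n%:R * eta n @[n --> \oo] --> +oo ->
      let K := chi2 p.-1 (xi ^+ 2 * t2) in
      [/\ cvg_in_distribution P W K id, cvg_in_distribution P S K id
        & cvg_in_probability0 P (fun n w => S n w - W n w)],
      Num.sqrt n%:R * eta n @[n --> \oo] --> (1 : R) ->
      (* 4^-1 xi^2 t2 (4 - t2) = ||xi (I - theta0 theta0') t||^2, for both W and
         the chi-square component of the limit of S *)
      let K := chi2 p.-1 (4^-1 * xi ^+ 2 * t2 * (4 - t2)) in
      cvg_in_distribution P W K id /\
      cvg_in_distribution P S (normal_prob (0 : R) 1 \x K)%E
        (fun zq => (1 + zq.2 / (zq.1 + xi - xi * t2 / 2) ^+ 2)^-1 * zq.2)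
    & Num.sqrt n%:R * eta n @[n --> \oo] --> (0 : R) ->
      let K := chi2 p.-1 0 in
      cvg_in_distribution P W K id /\
      cvg_in_distribution P S (normal_prob (0 : R) 1 \x K)%E
        (fun zq => (1 + zq.2 / zq.1 ^+ 2)^-1 * zq.2)].
Proof.
(* With [p = m.+2] the number [p.-1] of degrees of freedom computes to [m.+1], which is positive. *)
destruct p as [|[|m]] => //.
have theta01 : dotv theta0 theta0 = 1 by apply/unit_sphereE.
have tau_coord i : tau n i 0 @[n --> \oo] --> t i 0.
  exact: cvg_coord htau.
have tau_cvg x : dotv x (tau n) @[n --> \oo] --> dotv x t.
  rewrite dotvE; under eq_fun do rewrite dotvE.
  by apply: seq_cvg_sum => i; exact: seq_cvgZ.
have tau_sq_cvg : dotv (tau n) (tau n) @[n --> \oo] --> dotv t t.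
  rewrite dotvE; under eq_fun do rewrite dotvE.
  by apply: seq_cvg_sum => i; exact: seq_cvgM.
have t2E : t2 = dotv t t by exact: enorm_sqr.
pose e n := rot_mean (X n 0%N) (theta n).
pose m2 n := rot_m2 (X n 0%N) (theta n).
have momX n : (0 < n)%N -> momfin (P n) (fun w => dotv (X n 0%N w) (theta n)).
  move=> n0; have [_ /(_ 0%N n0)[rot _]] := hX _ n0.
  under eq_fun do rewrite dotvC; exact: momfin_dotv rot _.
have eE n : (0 < n)%N -> e1n n = e n by move=> /momX; exact: cos_meanE.
have m2E n : (0 < n)%N -> e2n n + e1n n ^+ 2 = m2 n.
  by move=> /momX H; rewrite /e2n cos_varE// subrK.
have ratio_cvg : e n / eta n @[n --> \oo] --> xi / Num.sqrt m.+2%:R.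
  apply: (@seq_cvg_pos_eq _ (fun n => e1n n / eta n)); first by move=> n n0; rewrite eE.
  case: heta => [[eta1 [H _]]|[_ H]]; last exact: near_uniformity_ratio H.
  by under eq_fun do rewrite eta1 divr1; exact: H.
have sp : (xi / Num.sqrt m.+2%:R) ^+ 2 = xi ^+ 2 / m.+2%:R by rewrite expr_div_n sqr_sqrtr.
(* The mean is of the order of [eta], so its square does not contribute to the limit of the second
   moment. *)
have near_m2 : eta n @[n --> \oo] --> (0 : R) -> e2n n @[n --> \oo] --> (m.+2%:R^-1 : R) ->
    m2 n @[n --> \oo] --> (m.+2%:R^-1 : R).
  move=> eta_cvg H; apply: (@seq_cvg_pos_eq _ (fun n => e2n n + (e n / eta n * eta n) ^+ 2)).
    by move=> n n0; rewrite divfK ?lt0r_neq0// -(eE _ n0) m2E.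
  rewrite [X in _ --> X](_ : _ = m.+2%:R^-1 + (xi / Num.sqrt m.+2%:R * 0) ^+ 2).
    by apply: seq_cvgD => //; apply: seq_cvgX; exact: seq_cvgM.
  by rewrite mulr0 expr0n addr0.
(* This fact and the next discard the alternative of [heta] that is incompatible with the regime at
   hand. *)
have eta_ne1 : eta n @[n --> \oo] --> (0 : R) -> ~ forall n, eta n = 1.
  move=> eta_cvg eta1; have H : eta n @[n --> \oo] --> (1 : R).
    by under eq_fun do rewrite eta1; exact: cvg_cst.
  by have /eqP := seq_cvg_unique H eta_cvg; rewrite oner_eq0.
have rate_ne1 (l : R) : Num.sqrt n%:R * eta n @[n --> \oo] --> l -> ~ forall n, eta n = 1.
  move=> rate_cvg eta1.
  have H0 : (Num.sqrt n%:R)^-1 * (Num.sqrt n%:R * eta n) @[n --> \oo] --> 0 * l.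
    by apply: seq_cvgM => //; exact: cvg_sqrt_natV.
  have H1 : (Num.sqrt n%:R)^-1 * (Num.sqrt n%:R * eta n) @[n --> \oo] --> (1 : R).
    apply: (@seq_cvg_pos_eq _ (fun=> 1)); last exact: cvg_cst.
    by move=> n n0; rewrite eta1 mulr1 mulVf// sqrtr_eq0 -ltNge ltr0n.
  by have /eqP := seq_cvg_unique H1 H0; rewrite mul0r oner_eq0.
(* Common to the last two cases, with [l = 1] and [l = 0]. *)
have fixed (l : R) : 0 <= l -> Num.sqrt n%:R * eta n @[n --> \oo] --> l ->
    [/\ forall n, theta n = theta0 + tau n, dotv theta0 t = - t2 / 2,
      Num.sqrt n%:R * e n @[n --> \oo] --> l * (xi / Num.sqrt m.+2%:R) &
      m2 n @[n --> \oo] --> (m.+2%:R^-1 : R)].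
  move=> l0 rate_cvg.
  have nu1 := hnu_bounded (cvg_eqO1 rate_cvg).
  have thetaE n : theta n = theta0 + tau n by rewrite htheta nu1 scale1r.
  split => //.
  (* Since [theta0] and [theta0 + tau n] both have norm 1, [2 theta0' tau + |tau|^2 = 0]. *)
  - have H : dotv theta0 (tau n) @[n --> \oo] --> - 2^-1 * dotv t t.
      apply: (@seq_cvg_pos_eq _ (fun n => - 2^-1 * dotv (tau n) (tau n))); last exact: seq_cvgZ.
      move=> n n0; have /unit_sphereE := htheta_sphere _ n0.
      rewrite thetaE dotvDl !dotvDr theta01 (dotvC (tau n) theta0); lra.
    by rewrite (seq_cvg_unique (tau_cvg theta0) H) t2E; ring.
  - apply: (@seq_cvg_pos_eq _ (fun n => Num.sqrt n%:R * eta n * (e n / eta n))).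
      by move=> n _; field; rewrite lt0r_neq0.
    exact: seq_cvgM.
  - case: heta => [[eta1 _]|[eta_cvg [_ H]]]; first by case: (rate_ne1 _ rate_cvg).
    exact: near_m2.
have p0 : 0 < m.+2%:R :> R by [].
have sp0 : 0 < Num.sqrt m.+2%:R :> R by rewrite sqrtr_gt0.
split.
- move=> eta1 D0 K.
  have rate_cvg : Num.sqrt n%:R * eta n @[n --> \oo] --> (+oo : set_system R).
    by under eq_fun do rewrite eta1 mulr1; exact: cvg_sqrt_nat.
  have m2_cvg : m2 n @[n --> \oo] --> xi ^+ 2 / m.+2%:R + e2.
    case: heta => [[_ [H1 H2]]|[/eta_ne1]]; last by [].
    apply: (seq_cvg_pos_eq m2E); rewrite addrC -sp.
    by apply: seq_cvgD => //; exact: seq_cvgX.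
  have thetaE n : theta n = theta0 + (Num.sqrt n%:R * eta n)^-1 *: tau n.
    by rewrite htheta (hnu_infty rate_cvg).
  have kap0 : 0 < xi / Num.sqrt m.+2%:R by rewrite divr_gt0.
  have := @local_alternatives _ _ _ _ _ _ _ _ _ theta01 htheta_sphere hX tau t tau_cvg tau_sq_cvg
    eta _ _ heta_gt0 thetaE rate_cvg ratio_cvg kap0 m2_cvg D0.
  rewrite (_ : chi2 _ _ = K)// /K sp -t2E; congr (chi2 _ _).
  rewrite -[m.+2%:R]natr1; field.
  have m0 := ler0n R m.
  have D1 (q : R) : 0 < q -> xi ^+ 2 / q + e2 < 1 -> xi ^+ 2 + e2 * q < q.
    by move=> q0; rewrite -(ltr_pM2r q0) mulrDl divfK ?lt0r_neq0// mul1r.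
  have := D1 _ p0 D0; rewrite -[m.+2%:R]natr1 -[m.+1%:R]natr1 => {}D1.
  by rewrite !lt0r_neq0//; lra.
- move=> eta_cvg rate_cvg K.
  have m2_cvg : m2 n @[n --> \oo] --> (m.+2%:R^-1 : R).
    by case: heta => [[/(eta_ne1 eta_cvg)]|[_ [_ H]]] //; exact: near_m2.
  have thetaE n : theta n = theta0 + (Num.sqrt n%:R * eta n)^-1 *: tau n.
    by rewrite htheta (hnu_infty rate_cvg).
  have kap0 : 0 < xi / Num.sqrt m.+2%:R by rewrite divr_gt0.
  have p1 : (m.+2%:R : R)^-1 < 1 by rewrite invf_lt1 ?ltr1n.
  have := @local_alternatives _ _ _ _ _ _ _ _ _ theta01 htheta_sphere hX tau t tau_cvg tau_sq_cvg
    eta _ _ heta_gt0 thetaE rate_cvg ratio_cvg kap0 m2_cvg p1.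
  rewrite (_ : chi2 _ _ = K)// /K sp -t2E; congr (chi2 _ _).
  rewrite -[m.+2%:R]natr1; field.
  by have m0 := ler0n R m; rewrite !lt0r_neq0//; lra.
- move=> rate_cvg K; have [thetaE t0E om_cvg m2_cvg] := fixed 1 ler01 rate_cvg.
  rewrite mul1r in om_cvg.
  have om0 : 0 <= xi / Num.sqrt m.+2%:R by rewrite divr_ge0 ?ltW.
  have := @fixed_alternatives _ _ _ _ _ _ _ _ _ theta01 htheta_sphere hX tau t tau_cvg
    _ om0 thetaE om_cvg m2_cvg.
  (* With [theta0' t = - t2 / 2], the tangential part of [t] has squared norm
     [t2 - t2^2 / 4 = t2 (4 - t2) / 4]. *)
  rewrite (_ : chi2 _ _ = K); last first.
    by rewrite /K sp t0E -t2E; congr (chi2 _ _); field.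
  move=> [W_cvg S_cvg]; split => //.
  rewrite (_ : (fun zq : measurableTypeR R * measurableTypeR R => _) =
    (fun zq => (1 + zq.2 / (zq.1 + Num.sqrt m.+2%:R * (xi / Num.sqrt m.+2%:R) * (1 + dotv theta0 t)) ^+ 2)^-1 * zq.2))//.
  apply/funext => zq; congr ((1 + _ / _ ^+ 2)^-1 * _).
  by rewrite t0E -addrA; congr (_ + _); field; rewrite lt0r_neq0.
- move=> rate_cvg K; have [thetaE t0E om_cvg m2_cvg] := fixed 0 (lexx 0) rate_cvg.
  rewrite mul0r in om_cvg.
  have := @fixed_alternatives _ _ _ _ _ _ _ _ _ theta01 htheta_sphere hX tau t tau_cvg
    _ (lexx 0) thetaE om_cvg m2_cvg.
  rewrite (_ : chi2 _ _ = K); last by rewrite expr0n !mul0r.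
  move=> [W_cvg S_cvg]; split => //.
  rewrite (_ : (fun zq : measurableTypeR R * measurableTypeR R => _) =
    (fun zq => (1 + zq.2 / (zq.1 + Num.sqrt m.+2%:R * 0 * (1 + dotv theta0 t)) ^+ 2)^-1 * zq.2))//.
  by apply/funext => zq; rewrite mulr0 mul0r addr0.
Qed.
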